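(* Let $(M,g)$ be an oriented Riemannian manifold. Suppose $M$ is a $\mathbb{K}$-manifold with $\mathbb{K}$ an associative normed algebra, i.e. $\mathbb{K}\in\{\mathbb{R},\mathbb{C},\mathbb{H}\}$. Then $$\sigma\circ\Psi:\Gamma(E^{\mathfrak{su}})\longrightarrow\mathrm{Symb}(\mathcal{S},\mathcal{S}),\qquad \mathcal{S}={\textstyle\bigwedge^\bullet} T^*,$$ is a Lie superalgebra monomorphism (an injective Lie superalgebra homomorphism).
   Context: **$\mathbb{K}$-manifolds.** For $m=n\dim_\mathbb{R}\mathbb{K}$ identify $V=\mathbb{R}^m$ with $\mathbb{K}^n$, with its standard inner product and coordinatewise right multiplication by $\mathbb{K}$. $G_\mathbb{K}=G_\mathbb{K}(n)$ is the group of $\mathbb{R}$-linear isometries $\phi$ of $V$ for which there is a (necessarily unique) $\theta=\theta_\phi\in SO(\mathbb{K})$ with $\phi(x\alpha)=\phi(x)\theta(\alpha)$ for all $x\in V,\alpha\in\mathbb{K}$; $G_\mathbb{K}(n)$ is $O(n)$, $U(n)$, $Sp(n)Sp(1)$ for $\mathbb{K}=\mathbb{R},\mathbb{C},\mathbb{H}$. A Riemannian manifold $(M,g)$ of dimension $m$ is a $\mathbb{K}$-manifold if the holonomy group of its Levi-Civita connection $\nabla$ is contained in $G_\mathbb{K}(n)$. If $M$ is oriented, the holonomy lies in the identity component $G_\mathbb{K}^\circ$ and $P$ denotes the corresponding principal $G_\mathbb{K}^\circ$-bundle, a reduction of the frame bundle to which $\nabla$ reduces. **Lie superalgebras from quadratic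 forms.** If $Q$ is a quadratic form (with its polarization) on a real vector space $W$ and $\mathfrak{a}\subset\mathfrak{so}(W,Q)$ is a Lie subalgebra, then $\mathfrak{a}\oplus W\oplus\mathbb{R}$ is a Lie superalgebra (even part $\mathfrak a\oplus\mathbb R$, odd part $W$) with $[\phi+a,\psi+b]=\phi\psi-\psi\phi$, $[u,v]=-2Q(u,v)$, $[\phi+a,u]=\phi(u)$. **$E^{\mathfrak{su}}$.** For $A\in\mathrm{Mat}(2,\mathbb{K})$ let $\phi_A(u)=uA^\star$ on row vectors $u\in\mathbb{K}^2$, $A^\star=(\overline{A_{ij}})^T$. $\mathfrak{sl}(2,\mathbb{K})$ is the real Lie algebra of operators on $\mathbb{K}^2$ generated by $\{\phi_A:A_{11}+A_{22}=0\}$. $\mathbb{K}^{1,1}$ is $\mathbb{K}^2$ with $\check q(u,v)=\mathrm{Re}(\tfrac12(u_1\bar v_2+u_2\bar v_1))$, $\mathfrak{su}_\mathbb{K}(1,1)=\mathfrak{sl}(2,\mathbb{K})\cap\mathfrak{so}(\mathbb{K}^2,\check q)$, and $\mathfrak{su}_\mathbb{K}(1,1)_{sup}=\mathfrak{su}_\mathbb{K}(1,1)\oplus\mathbb{K}^{1,1}\oplus\mathbb{R}$ with the bracket above. $\phi\in G_\mathbb{K}$ acts (action $\Phi$) on $\mathbb{K}^{1,1}$ by $u\mapsto(\theta_\phi(u_1),\theta_\phi(u_2))$, on $\mathfrak{su}_\mathbb{K}(1,1)$ by conjugation with this map, and trivially on $\mathbb{R}$. $E_0^{\mathfrak{su}},E_1^{\mathfrak{su}},E_2^{\mathfrak{su}}$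 are the bundles associated to $P$ with fibers $\mathfrak{su}_\mathbb{K}(1,1),\mathbb{K}^{1,1},\mathbb{R}$, and $E^{\mathfrak{su}}$ is their direct sum; $\Gamma(E^{\mathfrak{su}})$ has the pointwise Lie superalgebra structure. **The map $\iota$.** $W=V\oplus V^*$ has $Q(X+\xi,Y+\eta)=\tfrac12(\eta(X)+\xi(Y))$. Identify $V^*$ with $V\cong\mathbb{K}^n$ by the metric, so $W\cong\mathbb{K}^n\oplus\mathbb{K}^n\cong\mathbb{K}^n\otimes_\mathbb{K}\mathbb{K}^{1,1}$ via $(\mathbf{x},\xi)\mapsto\mathbf{x}\otimes(1,0)+\xi\otimes(0,1)$. For $L\in\mathfrak{su}_\mathbb{K}(1,1)$, $\iota(L)=\mathrm{Id}\otimes L\in\mathfrak{so}(W,Q)$; for $u=(u_1,u_2)\in\mathbb{K}^{1,1}$, $\iota(u)\in\mathrm{Hom}(V^*,W)$ is $\xi\mapsto(\xi u_1,\xi u_2)$. These are $G_\mathbb{K}$-equivariant and induce $\iota:E_0^{\mathfrak{su}}\to\bigwedge^2(T\oplus T^* )=\mathfrak{so}(T\oplus T^*,Q)$ and $\iota:E_1^{\mathfrak{su}}\to\mathrm{Hom}(T^*,T\oplus T^* )$. **Operators.** $\mathcal{S}$ is a Clifford module for $Cl(T\oplus T^*,Q)$ via $(X+\xi)\cdot\varphi=\xi\wedge\varphi-i_X\varphi$ (so $w\cdot w=-Q(w,w)$). $\mathrm{ad}:\mathfrak{spin}(W,Q)\to\mathfrak{so}(W,Q)$ is the isomorphism $\mathrm{ad}(x)(w)=xw-wx$,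 with $\mathfrak{spin}(W,Q)\subset Cl(W,Q)$. For $x\in\Gamma(\mathfrak{so}(T\oplus T^*,Q))$, $\rho_x\varphi=\mathrm{ad}^{-1}(x)\cdot\varphi$. For $u\in\Gamma(\mathrm{Hom}(T^*,T\oplus T^* ))$, $D_u$ is the composition $\Gamma(\mathcal{S})\xrightarrow{\nabla}\Gamma(T^*\otimes\mathcal{S})\xrightarrow{u}\Gamma((T\oplus T^* )\otimes\mathcal{S})\to\Gamma(\mathcal{S})$, the last map being Clifford product. The elements $\epsilon_1=(1,0),\epsilon_2=(0,1)$ are fixed by $\Phi$ and give global sections of $E_1^{\mathfrak{su}}$; $\triangle=D_{\iota(\epsilon_1)}D_{\iota(\epsilon_2)}+D_{\iota(\epsilon_2)}D_{\iota(\epsilon_1)}$. Define $\Psi(x,u,f)=(\rho_{\iota(x)},D_{\iota(u)},-f\triangle)$ for $(x,u,f)\in\Gamma(E_0^{\mathfrak{su}})\oplus\Gamma(E_1^{\mathfrak{su}})\oplus\Gamma(E_2^{\mathfrak{su}})$, with values in $\bigoplus_{k=0}^2\mathrm{Diff}_k(\mathcal{S},\mathcal{S})$. **Symbols.** $\mathrm{Diff}_k(\mathcal{S},\mathcal{S})$ is the space of differential operators of order $k$ (i.e. at most $k$) on $\Gamma(\mathcal{S})$; $\mathrm{Symb}_k(\mathcal{S},\mathcal{S})$ is the space of smooth $\mathrm{End}(\mathcal{S})$-valued functions on $T^*M$ that are homogeneous polynomials of degree $k$ in the fibers; $\mathrm{Symb}=\bigoplus_k\mathrm{Symb}_k$.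 The $k$-symbol is $\sigma_k(D)(p,\xi)\varphi=D\big(\tfrac1{k!}(h-h(p))^ks\big)(p)$ for any function $h$ with $dh(p)=\xi$ and section $s$ with $s(p)=\varphi$; $\sigma=\bigoplus_k\sigma_k$ on the graded direct sum $\bigoplus_k\mathrm{Diff}_k$. The Lie superalgebra structure on $\mathrm{Symb}$ is the supercommutator $[a,b]=ab-(-1)^{kl}ba\in\mathrm{Symb}_{k+l}$ for $a\in\mathrm{Symb}_k,b\in\mathrm{Symb}_l$ (product: pointwise composition of endomorphisms). Thus $\sigma\circ\Psi(x,u,f)=(\sigma_0(\rho_{\iota(x)}),\sigma_1(D_{\iota(u)}),\sigma_2(-f\triangle))$. *)

(* Defs.v *)
From HB Require Import structures.
From mathcomp Require Import all_boot all_order all_algebra.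
From mathcomp Require Import all_classical all_reals all_analysis.

Set Implicit Arguments.
Unset Strict Implicit.
Unset Printing Implicit Defensive.

Import Order.TTheory GRing.Theory Num.Theory.
Import numFieldNormedType.Exports.
Local Open Scope classical_set_scope.
Local Open Scope ring_scope.

(* Cayley-Dickson doubling: [k = 0, 1, 2] gives R, C, H.  An element is the
   row of its real coordinates; the standard inner product of [K] is the
   standard inner product of these rows. *)
Fixpoint kdim (k : nat) : nat := if k is k'.+1 then (kdim k' + kdim k')%N else 1%N.

Section Algebra.
Variable R : realType.

Fixpoint kconj (k : nat) : 'rV[R]_(kdim k) -> 'rV[R]_(kdim k) :=
  match k with
  | 0 => fun x => x
  | k'.+1 => fun x : 'rV[R]_(kdim k' + kdim k') =>
      row_mx (kconj (lsubmx x)) (- rsubmx x)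
  end.

(* (a, b) (c, d) = (a c - conj(d) b, d a + b conj(c)) *)
Fixpoint kmul (k : nat) : 'rV[R]_(kdim k) -> 'rV[R]_(kdim k) -> 'rV[R]_(kdim k) :=
  match k with
  | 0 => fun x y => x *m y
  | k'.+1 => fun x y : 'rV[R]_(kdim k' + kdim k') =>
      row_mx (kmul (lsubmx x) (lsubmx y) - kmul (kconj (rsubmx y)) (rsubmx x))
             (kmul (rsubmx y) (lsubmx x) + kmul (rsubmx x) (kconj (lsubmx y)))
  end.

Fixpoint kone (k : nat) : 'rV[R]_(kdim k) :=
  match k with 0 => 1%:M | k'.+1 => row_mx (kone k') 0 end.

Fixpoint kre (k : nat) : 'rV[R]_(kdim k) -> R :=
  match k with
  | 0 => fun x => x 0 0
  | k'.+1 => fun x : 'rV[R]_(kdim k' + kdim k') => kre (lsubmx x)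
  end.

Variable k : nat.
Local Notation d := (kdim k).
Local Notation K := 'rV[R]_d.

(* A linear map [V -> W] between spaces of rows is the matrix [A] of
   [v |-> v *m A]; the composition "A, then B" is [A *m B].  The space
   [V = R^(n d)] is identified with [K^n] (the rows of an n x d matrix) by
   [vec_mx]. *)
Definition vmul n (x : 'rV[R]_(n * d)) (a : K) : 'rV[R]_(n * d) :=
  mxvec (\matrix_(i < n) kmul (row i (vec_mx x)) a).

Definition SO_K : set 'M[R]_d := [set t | t *m t^T = 1%:M /\ \det t = 1].

Definition is_theta n (phi : 'M[R]_(n * d)) (t : 'M[R]_d) : Prop :=
  SO_K t /\ forall x a, vmul x a *m phi = vmul (x *m phi) (a *m t).

Definition GK n : set 'M[R]_(n * d) :=
  [set phi | phi *m phi^T = 1%:M /\ exists t, is_theta phi t].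

Definition GK0 n : set 'M[R]_(n * d) := connected_component (GK (n := n)) 1%:M.

Definition phiA (A : 'M[K]_2) (u : K * K) : K * K :=
  (kmul u.1 (kconj (A 0 0)) + kmul u.2 (kconj (A 0 1)),
   kmul u.1 (kconj (A 1 0)) + kmul u.2 (kconj (A 1 1))).

Definition commutator (U : zmodType) (L L' : U -> U) : U -> U :=
  fun u => L (L' u) - L' (L u).

Definition lie_subalgebra (U : lmodType R) (g : set (U -> U)) : Prop :=
  [/\ g (fun=> 0),
      forall (a : R) L L', g L -> g L' -> g (fun u => a *: L u + L' u) &
      forall L L', g L -> g L' -> g (commutator L L')].

Definition sl2 : set (K * K -> K * K) :=
  [set L | forall g : set (K * K -> K * K), lie_subalgebra g ->
     (forall A : 'M[K]_2, A 0 0 + A 1 1 = 0 -> g (phiA A)) -> g L].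

Definition qcheck (u v : K * K) : R :=
  kre (2^-1 *: (kmul u.1 (kconj v.2) + kmul u.2 (kconj v.1))).

Definition so_form (U : lmodType R) (Q : U -> U -> R) : set (U -> U) :=
  [set L | linear L /\ forall u v, Q (L u) v + Q u (L v) = 0].

Definition su11 : set (K * K -> K * K) := sl2 `&` so_form qcheck.

Definition Phi (t : 'M[R]_d) (u : K * K) : K * K := (u.1 *m t, u.2 *m t).

End Algebra.

(* Normalised by [w * w = - Q w w]; [cl_univ] is the universal property. *)
Record clifford_algebra (R : realType) (W : lmodType R) (Q : W -> W -> R) := {
  cl_alg :> algType R;
  cl_gen : {linear W -> cl_alg};
  cl_sq : forall w, cl_gen w * cl_gen w = (- Q w w)%:A;
  cl_univ : forall (B : algType R) (f : {linear W -> B}),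
    (forall w, f w * f w = (- Q w w)%:A) ->
    exists F : {lrmorphism cl_alg -> B},
      (forall w, F (cl_gen w) = f w) /\
      (forall F' : {lrmorphism cl_alg -> B},
         (forall w, F' (cl_gen w) = f w) -> F' =1 F)
}.
Arguments cl_gen {R W Q} c.

Section Clifford.
Variables (R : realType) (W : lmodType R) (Q : W -> W -> R).
Variable Cl : clifford_algebra Q.
Local Notation gen := (cl_gen Cl).

Definition spin : set Cl :=
  [set y | exists s : seq (W * W),
     y = \sum_(w <- s) (gen w.1 * gen w.2 - gen w.2 * gen w.1)].

(* the inverse of [ad : spin(W,Q) -> so(W,Q)], [ad y w = y w - w y] *)
Definition ad_inv (x : W -> W) : Cl :=
  xget 0 [set y | spin y /\ forall w, y * gen w - gen w * y = gen (x w)].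

Definition clifford_module (S : lmodType R) (c : W -> S -> S)
    (act : Cl -> S -> S) : Prop :=
  [/\ forall y, linear (act y),
      forall s, linear (act^~ s),
      forall s, act 1 s = s,
      forall y z s, act (y * z) s = act y (act z s) &
      forall w s, act (gen w) s = c w s].

End Clifford.

Section Exterior.
Variables (R : realType) (m : nat).

(* Vectors are rows, covectors are columns, [xi (X) = (X *m xi) 0 0].
   [phi : ext] is [\sum_J phi J e_J] with [e_J = e_j1 /\ ... /\ e_jr] for
   [J = {j1 < ... < jr}]. *)
Definition ext := {ffun {set 'I_m} -> R}.

Definition wedge (xi : 'cV[R]_m) (phi : ext) : ext :=
  [ffun J : {set 'I_m} => \sum_(j in J)
     (-1) ^+ #|[set i in J | (i < j)%N]| * xi j 0 * phi (J :\ j)%SET].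

Definition contr (X : 'rV[R]_m) (phi : ext) : ext :=
  [ffun J : {set 'I_m} => \sum_(j | j \notin J)
     (-1) ^+ #|[set i in J | (i < j)%N]| * X 0 j * phi (j |: J)%SET].

Definition ext_basis (J : {set 'I_m}) : ext := [ffun I => (I == J)%:R].

(* the algebra morphism of [ext] extending [xi |-> A *m xi] *)
Definition ext_map (A : 'M[R]_m) (phi : ext) : ext :=
  \sum_(J : {set 'I_m})
    phi J *: foldr (fun j psi => wedge (col j A) psi) (ext_basis finset.set0) (enum J).

Definition TTd : lmodType R := ('rV[R]_m * 'cV[R]_m)%type.

Definition Qform (w w' : TTd) : R :=
  2^-1 * ((w.1 *m w'.2) 0 0 + (w'.1 *m w.2) 0 0).

Definition cl_prod (w : TTd) (phi : ext) : ext := wedge w.2 phi - contr w.1 phi.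

End Exterior.

Fixpoint Ck (R : realType) (E : normedModType R) (k : nat) (U : set E)
    (f : E -> R) : Prop :=
  if k is k'.+1 then
    (forall x, U x -> differentiable f x) /\
    (forall v : E, Ck k' U (fun x => 'D_v f x))
  else forall x, U x -> {for x, continuous f}.

(* intended for open [U] *)
Definition smooth_on (R : realType) (E : normedModType R) (U : set E)
    (f : E -> R) : Prop := forall k, Ck k U f.

(* Hausdorff and second countable, with a smooth atlas; [chart_at p] is a
   preferred chart around [p]. *)
Record manifold (R : realType) (m : nat) := {
  mpoint :> topologicalType;
  mchart : Type;
  dom : mchart -> set mpoint;
  crd : mchart -> mpoint -> 'rV[R]_m;
  par : mchart -> 'rV[R]_m -> mpoint;
  chart_at : mpoint -> mchart;
  man_hausdorff : hausdorff_space mpoint;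
  man_countable : @second_countable mpoint;
  dom_open : forall i, open (dom i);
  cod_open : forall i, open (crd i @` dom i);
  crdK : forall i p, dom i p -> par i (crd i p) = p;
  crd_continuous : forall i p, dom i p -> {for p, continuous (crd i)};
  par_continuous : forall i x, (crd i @` dom i) x -> {for x, continuous (par i)};
  chart_atP : forall p, dom (chart_at p) p;
  transition_smooth : forall i j (b : 'I_m),
    smooth_on (crd i @` (dom i `&` dom j)) (fun x => crd j (par i x) 0 b)
}.

Section Geometry.
Variables (R : realType) (m : nat) (M : manifold R m).
Implicit Types (p q : M) (i j : mchart M) (U : set M).

Definition evec (a : 'I_m) : 'rV[R]_m := delta_mx 0 a.
Definition ecov (a : 'I_m) : 'cV[R]_m := delta_mx a 0.

Definition smooth_fun U (h : M -> R) : Prop :=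
  forall i, smooth_on (crd i @` (dom i `&` U)) (fun x => h (par i x)).

(* derivative at [p] of [h] along the vector with coordinates [v] in chart [i] *)
Definition pd i (v : 'rV[R]_m) (h : M -> R) p : R :=
  'D_v (fun x => h (par i x)) (crd i p).

(* Jacobian of the change of coordinates from chart [i] to chart [j]: vectors
   change by [v_j = v_i *m jac i j p], covectors by [xi_i = jac i j p *m xi_j]. *)
Definition jac i j p : 'M[R]_m :=
  \matrix_(a, b) pd i (evec a) (fun q => crd j q 0 b) p.

(* [T_p M] and [T*_p M] are ['rV_m] and ['cV_m], through the coordinates of
   [chart_at p]; all tensors at [p] are given in these coordinates.
   [tov p i] goes from [chart_at p] to chart [i], [ofv p i] goes back. *)
Definition tov p i : 'M[R]_m := jac (chart_at p) i p.
Definition ofv p i : 'M[R]_m := jac i (chart_at p) p.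

Definition differential (h : M -> R) p : 'cV[R]_m :=
  \col_a pd (chart_at p) (evec a) h p.

Definition smooth_frame U (s : M -> 'M[R]_m) : Prop :=
  forall i a b, smooth_fun (dom i `&` U) (fun q => (s q *m tov q i) a b).

Record metric := {
  gram :> M -> 'M[R]_m;
  gram_sym : forall p, (gram p)^T = gram p;
  gram_pos : forall p (v : 'rV[R]_m), v != 0 -> 0 < (v *m gram p *m v^T) 0 0;
  gram_smooth : forall i a b,
    smooth_fun (dom i) (fun q => (ofv q i *m gram q *m (ofv q i)^T) a b)
}.

Definition gram_in (g : metric) i p : 'M[R]_m :=
  ofv p i *m g p *m (ofv p i)^T.

(* [pos p] tells whether the coordinate basis of [chart_at p] is positive;
   each chart has a locally constant sign. *)
Record orientation := {
  pos :> M -> bool;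
  pos_open : forall i (s : bool),
    open [set q | dom i q /\ pos q (+) (\det (ofv q i) < 0) = s]
}.

(* [chris i p a b c] is the Christoffel symbol Gamma^c_{ab} in chart [i]; the
   last field is the transformation law of a connection on the tangent bundle. *)
Definition conn_form (chris : mchart M -> M -> 'I_m -> 'M[R]_m) i p
    (v : 'rV[R]_m) : 'M[R]_m := \sum_a v 0 a *: chris i p a.

Record connection := {
  chris :> mchart M -> M -> 'I_m -> 'M[R]_m;
  chris_smooth : forall i a b c, smooth_fun (dom i) (fun q => chris i q a b c);
  chris_change : forall i j p a, dom i p -> dom j p ->
    chris i p a *m jac i j p =
      \matrix_(b, c) pd i (evec a) (fun q => jac i j q b c) p +
      jac i j p *m conn_form chris j p (row a (jac i j p))
}.

Definition levi_civita (g : metric) (D : connection) : Prop :=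
  (forall i p a b c, dom i p -> D i p a b c = D i p b a c) /\
  (forall i p a, dom i p ->
     \matrix_(b, c) pd i (evec a) (fun q => gram_in g i q b c) p =
       D i p a *m gram_in g i p + gram_in g i p *m (D i p a)^T).

Definition smooth_curve (gam : R -> M) : Prop :=
  continuous gam /\
  forall i (b : 'I_m),
    smooth_on (gam @^-1` dom i) (fun t : R => crd i (gam t) 0 b).

(* the rows of [W] are parallel vector fields along [gam] *)
Definition parallel (D : connection) (gam : R -> M) (W : R -> 'M[R]_m) : Prop :=
  forall i t, dom i (gam t) ->
  let Wi s := W s *m tov (gam s) i in
  let vel : 'rV[R]_m := \row_b derive1 (fun s : R => crd i (gam s) 0 b) t in
  forall a b, is_derive t (1 : R) (fun s : R => Wi s a b)
    ((- (Wi t *m conn_form D i (gam t) vel)) a b).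

(* [transport D p q A]: [v |-> v *m A] is the parallel transport from [T_p M]
   to [T_q M] along some piecewise smooth path. *)
Inductive transport (D : connection) : M -> M -> 'M[R]_m -> Prop :=
| transport_id p : transport D p p 1%:M
| transport_smooth gam W : smooth_curve gam -> parallel D gam W ->
    W 0 = 1%:M -> transport D (gam 0) (gam 1) (W 1)
| transport_cat p q r A B : transport D p q A -> transport D q r B ->
    transport D p r (A *m B).

Definition holonomy (D : connection) p : set 'M[R]_m :=
  [set A | transport D p p A].

(* [F : V -> T_p M], [v |-> v *m F], is a linear isometry *)
Definition orthonormal_frame (g : metric) p (F : 'M[R]_m) : Prop :=
  F *m g p *m F^T = 1%:M.

Definition form_in (phi : M -> ext R m) i q : ext R m :=
  ext_map (ofv q i) (phi q).

(* [Gamma(S)] *)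
Definition smooth_form : set (M -> ext R m) :=
  [set phi | forall i J, smooth_fun (dom i) (fun q => form_in phi i q J)].

(* In a chart, nabla_v dx^c = - \sum_b (conn_form v)_{b c} dx^b, extended to
   forms as a derivation. *)
Definition nabla (D : connection) (phi : M -> ext R m) p (v : 'rV[R]_m) : ext R m :=
  [ffun J => pd (chart_at p) v (fun q => form_in phi (chart_at p) q J) p]
  - \sum_b \sum_c conn_form D (chart_at p) p v b c *:
      wedge (ecov b) (contr (evec c) (phi p)).

Definition operator := (M -> ext R m) -> M -> ext R m.

Definition D_op (D : connection) (u : M -> 'cV[R]_m -> TTd R m) : operator :=
  fun phi p => \sum_a cl_prod (u p (ecov a)) (nabla D phi p (evec a)).

Definition rho (Cl : clifford_algebra (@Qform R m)) (act : Cl -> ext R m -> ext R m)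
    (x : M -> TTd R m -> TTd R m) : operator :=
  fun phi p => act (ad_inv Cl (x p)) (phi p).

(* Differential operators of order at most [k] (Grothendieck). *)
Fixpoint diffop (k : nat) (T : operator) : Prop :=
  (forall phi, smooth_form phi -> smooth_form (T phi)) /\
  (forall (a : R) phi psi, smooth_form phi -> smooth_form psi ->
     T (fun p => a *: phi p + psi p) = fun p => a *: T phi p + T psi p) /\
  let comm f : operator :=
    fun phi p => T (fun q => f q *: phi q) p - f p *: T phi p in
  forall f, smooth_fun setT f ->
    if k is k'.+1 then diffop k' (comm f)
    else forall phi, smooth_form phi -> comm f phi = fun=> 0.

Definition symb_fun : lmodType R := (M -> 'cV[R]_m -> ext R m -> ext R m)%type.

(* The value does not depend on the choice of [h] and [s] for a differential
   operator of order at most [k]. *)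
Definition symbol (k : nat) (T : operator) : symb_fun :=
  fun p xi phi => xget 0 [set y | exists (h : M -> R) (s : M -> ext R m),
    [/\ smooth_fun setT h, smooth_form s, differential h p = xi, s p = phi &
        y = T (fun q => ((k`!)%:R^-1 * (h q - h p) ^+ k) *: s q) p]].

(* smoothness on [T*M], in the coordinates (x, eta) induced by chart [i] *)
Definition smooth_symb (a : symb_fun) : Prop :=
  forall i (I J : {set 'I_m}),
    smooth_on [set z : 'rV[R]_(m + m) | (crd i @` dom i) (lsubmx z)]
      (fun z => let q := par i (lsubmx z) in
         ext_map (ofv q i)
           (a q (tov q i *m (rsubmx z)^T) (ext_map (tov q i) (ext_basis R J))) I).

Definition is_symb (k : nat) : set symb_fun :=
  [set a : symb_fun | [/\ forall p xi, linear (a p xi),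
      forall p, exists2 c : {ffun 'I_k -> 'I_m} -> ext R m -> ext R m,
        (forall t, linear (c t)) & forall xi phi, a p xi phi =
          \sum_(t : {ffun 'I_k -> 'I_m}) (\prod_l xi (t l) 0) *: c t phi &
      smooth_symb a]].

(* elements of the direct sum of the Symb_k *)
Definition Symb : set (nat -> symb_fun) :=
  [set a | (forall k, is_symb k (a k)) /\
           exists N, forall k, (N <= k)%N -> a k = 0].

Definition symb_bracket (a b : nat -> symb_fun) : nat -> symb_fun :=
  fun r p xi phi => \sum_(k < r.+1)
    (a k p xi (b (r - k)%N p xi phi)
     - (-1) ^+ (k * (r - k)) *: b (r - k)%N p xi (a k p xi phi)).

End Geometry.

(* A Lie superalgebra presented as the subspace [sa_dom] of a vector space,
   with its bracket and its homogeneous parts. *)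
Record superalgebra (R : realType) := Superalgebra {
  sa_space : lmodType R;
  sa_dom : set sa_space;
  sa_part : bool -> set sa_space; (* [false]: even, [true]: odd *)
  sa_bracket : sa_space -> sa_space -> sa_space
}.

Definition superalgebra_mono (R : realType) (A B : superalgebra R)
    (f : sa_space A -> sa_space B) : Prop :=
  [/\ forall x, sa_dom x -> sa_dom (f x),
      forall (a : R) x y, sa_dom x -> sa_dom y -> f (a *: x + y) = a *: f x + f y,
      forall e x, sa_dom x -> sa_part e x -> sa_part e (f x),
      forall x y, sa_dom x -> sa_dom y ->
        f (sa_bracket x y) = sa_bracket (f x) (f y) &
      forall x y, sa_dom x -> sa_dom y -> f x = f y -> x = y].

Section KManifold.
Variables (R : realType) (k n : nat).
Local Notation d := (kdim k).
Local Notation K := 'rV[R]_d.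
Local Notation m := (n * d)%N.
Variable M : manifold R m.

(* A linear isometry [F : V -> T_p M] turns parallel transport [A] on [T_p M]
   into the endomorphism [F *m A *m invmx F] of [V]. *)
Definition K_manifold (g : metric M) (D : connection M) : Prop :=
  forall p, exists2 F, orthonormal_frame g p F &
    forall A, holonomy D p A -> @GK R k n (F *m A *m invmx F).

(* Reduction of the orthonormal frame bundle to [G_K^o], to which the
   connection reduces; [phi] in [G_K^o] acts on frames by [F |-> phi *m F]. *)
Record reduction (g : metric M) (D : connection M) := {
  fr :> M -> set 'M[R]_m;
  fr_orthonormal : forall p F, fr p F -> orthonormal_frame g p F;
  fr_torsor : forall p F F', fr p F ->
    (fr p F' <-> exists2 phi, @GK0 R k n phi & F' = phi *m F);
  fr_local : forall p, exists U s, [/\ open U, U p, smooth_frame U s &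
    forall q, U q -> fr q (s q)];
  fr_parallel : forall p q A F, transport D p q A -> fr p F -> fr q (F *m A)
}.

Variables (g : metric M) (D : connection M) (P : reduction g D).

(* A section of [P x_G X] is a [G]-equivariant map [P -> X], extended by zero
   outside [P].  It is smooth when its composition with every smooth local
   section of [P] is. *)
Definition sec0 : lmodType R := (M -> 'M[R]_m -> K * K -> K * K)%type.
Definition sec1 : lmodType R := (M -> 'M[R]_m -> K * K)%type.
Definition sec2 : lmodType R := (M -> R)%type.

Definition smooth_K2 (U : set M) (u : M -> K * K) : Prop :=
  forall b, smooth_fun U (fun q => (u q).1 0 b) /\
            smooth_fun U (fun q => (u q).2 0 b).

Definition local_frame (U : set M) (s : M -> 'M[R]_m) : Prop :=
  [/\ open U, smooth_frame U s & forall q, U q -> P q (s q)].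

Definition Gamma0 : set sec0 :=
  [set x | [/\ forall p F, P p F -> su11 (x p F),
    forall p F, ~ P p F -> x p F = fun=> 0,
    forall p F phi t, P p F -> @GK0 R k n phi -> is_theta phi t ->
      forall u, x p F (Phi t u) = Phi t (x p (phi *m F) u) &
    forall U s, local_frame U s ->
      forall u, smooth_K2 U (fun q => x q (s q) u)]].

Definition Gamma1 : set sec1 :=
  [set u | [/\ forall p F, ~ P p F -> u p F = 0,
    forall p F phi t, P p F -> @GK0 R k n phi -> is_theta phi t ->
      u p F = Phi t (u p (phi *m F)) &
    forall U s, local_frame U s -> smooth_K2 U (fun q => u q (s q))]].

(* [G_K^o] acts trivially on the fibre R, so [E_2] is the trivial bundle *)
Definition Gamma2 : set sec2 := [set f | smooth_fun setT f].

Definition frame_at (p : M) : 'M[R]_m := xget 0 (P p).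

Definition sec : lmodType R := (sec0 * sec1 * sec2)%type.

Definition sec_bracket (a b : sec) : sec :=
  let: (x, u, f) := a in let: (y, v, h) := b in
  (fun p F => commutator (x p F) (y p F),
   fun p F => x p F (v p F) - y p F (u p F),
   fun p => - 2 * qcheck (u p (frame_at p)) (v p (frame_at p))).

Definition Gamma_su : superalgebra R := {|
  sa_space := sec;
  sa_dom := [set a | [/\ Gamma0 a.1.1, Gamma1 a.1.2 & Gamma2 a.2]];
  sa_part := fun e => if e then [set a | a.1.1 = 0 /\ a.2 = 0]
                      else [set a | a.1.2 = 0];
  sa_bracket := sec_bracket
|}.

Definition Symb_su : superalgebra R := {|
  sa_space := nat -> symb_fun M;
  sa_dom := @Symb R m M;
  sa_part := fun e => [set a | forall r, odd r != e -> a r = 0];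
  sa_bracket := @symb_bracket R m M
|}.

(* A vector [X] and a covector [xi] at [p] correspond, through a frame [F] and
   the metric identification of [V^*] with [V], to the elements
   [X *m invmx F] and [(F *m xi)^T] of [V]. *)
Definition to_V (F : 'M[R]_m) (w : TTd R m) : 'rV[R]_m * 'rV[R]_m :=
  (w.1 *m invmx F, (F *m w.2)^T).

Definition of_V (F : 'M[R]_m) (w : 'rV[R]_m * 'rV[R]_m) : TTd R m :=
  (w.1 *m F, invmx F *m w.2^T).

(* x (x) (1,0) + y (x) (0,1) |-> x (x) L(1,0) + y (x) L(0,1) *)
Definition iota0_V (L : K * K -> K * K) (w : 'rV[R]_m * 'rV[R]_m) :=
  let e1 := L (kone R k, 0) in let e2 := L (0, kone R k) in
  (vmul w.1 e1.1 + vmul w.2 e2.1, vmul w.1 e1.2 + vmul w.2 e2.2).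

Definition iota1_V (u : K * K) (y : 'rV[R]_m) : 'rV[R]_m * 'rV[R]_m :=
  (vmul y u.1, vmul y u.2).

Definition iota0 (x : sec0) (p : M) (w : TTd R m) : TTd R m :=
  let F := frame_at p in of_V F (iota0_V (x p F) (to_V F w)).

Definition iota1 (u : sec1) (p : M) (xi : 'cV[R]_m) : TTd R m :=
  let F := frame_at p in of_V F (iota1_V (u p F) (F *m xi)^T).

Definition const_sec1 (u : K * K) : sec1 :=
  fun p F => if `[< P p F >] then u else 0.

Definition eps1 : sec1 := const_sec1 (kone R k, 0).
Definition eps2 : sec1 := const_sec1 (0, kone R k).

Definition triangle : operator M :=
  let D1 := D_op D (iota1 eps1) in let D2 := D_op D (iota1 eps2) in
  fun phi p => D1 (D2 phi) p + D2 (D1 phi) p.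

Variables (Cl : clifford_algebra (@Qform R m)) (act : Cl -> ext R m -> ext R m).

(* the component of degree [r] *)
Definition Psi (a : sec) (r : nat) : operator M :=
  match r with
  | 0 => rho act (iota0 a.1.1)
  | 1 => D_op D (iota1 a.1.2)
  | 2 => fun phi p => - a.2 p *: triangle phi p
  | _ => fun _ _ => 0
  end.

Definition sigma (T : nat -> operator M) : nat -> symb_fun M :=
  fun r => symbol r (T r).

End KManifold.

(* Main.v *)
(* The symbols can be computed pointwise.  For [x] in [Gamma E_0] the symbol of [rho] is
   the spin action of [iota x], given by the explicit formula
   [1/4 \sum_i b_i * x (b^i)] in dual bases of [T + T*]; for [u] in [Gamma E_1] the Leibniz
   rule for [nabla] gives Clifford multiplication by [iota u xi]; and the symbol of
   [- f triangle] is [f |xi|^2].  In a frame of [P], [iota x] is a K-linear operator on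
   [V (x) K^(1,1)] with [iota x (iota u xi) = iota (x u) xi] (associativity of K) and
   [Q (iota u xi, iota v xi) = |xi|^2 q (u, v)], so the supercommutators of the symbols are
   the brackets of [su(1,1)_sup].  Injectivity holds since Clifford multiplication is
   faithful on forms and [K] has no zero divisors.

   That the symbols are well defined needs functions and forms with a prescribed
   differential or value at a point, hence bump functions; that the operators preserve
   smooth forms needs the covariance of [nabla] under changes of charts, and frames whose
   inverse [g *m F^T] is visibly smooth. *)

Require Import Defs.
From HB Require Import structures.
From mathcomp Require Import all_boot all_order all_algebra.
From mathcomp Require Import all_classical all_reals all_analysis.
From mathcomp Require Import ring lra.

Set Implicit Arguments.
Unset Strict Implicit.
Unset Printing Implicit Defensive.

Import Order.TTheory GRing.Theory Num.Theory.
Import numFieldNormedType.Exports.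
Local Open Scope classical_set_scope.
Local Open Scope ring_scope.

(** * Smooth functions on open sets *)

(** Two choices in the definitions are discontinuous in the point: the coordinates [chart_at p] in
    which tensors at [p] are expressed, and the frame [frame_at P p] through which [iota] is
    computed. Smoothness claims therefore begin by passing to a fixed chart and to a smooth local
    frame of [P]. The change of frame rests on theta(1) = 1: phi(x) = phi(x 1) = phi(x) theta(1),
    and a nonzero vector can be cancelled. What remains is built by sums and products, which
    [fun_alg] handles.

    The abstract Clifford algebra enters through one fact: an element of spin is determined by its
    adjoint action. This is shown by an explicit formula, not by counting dimensions; it identifies
    [ad_inv] and turns commutators in so(W,Q) into commutators of operators on forms. The symbols
    are then given by a closed formula [sym] that makes sense for arbitrary sections; the bracket
    identities are proved for [sym] and carried back by [sigmaE]. Symbols of degree at least 2 are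
    scalar, so only the pairs of degrees (0,0), (0,1), (1,0), (1,1) contribute to a bracket. *)

Section SmoothCalculus.
Variables (R : realType) (E : normedModType R).
Implicit Types (U V : set E) (f g : E -> R).

Lemma Ck_sub k U V f : U `<=` V -> Ck k V f -> Ck k U f.
Proof.
elim: k f => [|k IH] f UV /=; first by move=> h x /UV; exact: h.
by move=> [h1 h2]; split=> [x /UV /h1 //|v]; exact: IH (h2 v).
Qed.

(** All derivatives in [Ck] are taken in the ambient space, so the condition is pointwise and may be
    checked on any cover of [U]. *)
Lemma Ck_local k U f :
  (forall x, U x -> exists2 V : set E, V x & Ck k V f) -> Ck k U f.
Proof.
elim: k f => [|k IH] f h /=; first by move=> x /h[V Vx /(_ _ Vx)].
split=> [x /h[V Vx [h1 _]]|v]; first exact: h1.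
by apply: IH => x /h[V Vx [_ h2]]; exists V => //; exact: h2.
Qed.

Lemma Ck_pred k U f : Ck k.+1 U f -> Ck k U f.
Proof.
elim: k f => [|k IH] f.
  by move=> [h _] x /h; exact: differentiable_continuous.
by move=> [h1 h2]; split=> // v; exact: IH (h2 v).
Qed.

(** The difference [g - f] vanishes near [x], hence has an expansion with zero differential; adding
    it to [f] transfers differentiability. *)
Lemma near_eq_differentiable f g x :
  (\forall y \near x, f y = g y) -> differentiable f x -> differentiable g x.
Proof.
move=> fg df; have -> : g = f + (g - f) by rewrite addrC subrK.
apply: differentiableD => //; set z := g - f.
have zE : z \o shift x = cst (z x) + \0 +o_ 0 id.
  apply/eqaddoP => e e0 /=.
  have : \forall y \near (0:E), f (y + x) = g (y + x).
    rewrite (near_shift x) sub0r /=; near=> y; rewrite /= subrK; near: y.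
    exact: fg.
  apply: filterS => y fgy.
  have -> : (z \o shift x - (cst (z x) + \0)) y = 0.
    rewrite /z !fctE /= fgy (nbhs_singleton fg) !subrr.
    by rewrite addr0 subr0.
  by rewrite normr0 mulr_ge0 // ltW.
have c0 : continuous (\0 : E -> R) by exact: (@cst_continuous E R 0).
apply/diff_locallyP; have /= -> := diff_unique c0 zE.
by split.
Unshelve. all: by end_near. Qed.

(** Openness turns equality on [U] into equality near each point, so the directional derivatives
    agree on [U] as well and the induction goes on. *)
Lemma Ck_eq k U f g : open U -> (forall x, U x -> f x = g x) ->
  Ck k U f -> Ck k U g.
Proof.
move=> oU; elim: k f g => [|k IH] f g fg /=.
  move=> cf x Ux; have nfg : \forall y \near x, f y = g y.
    by apply: filterS (open_nbhs_nbhs (conj oU Ux)) => y /fg.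
  rewrite /prop_for /continuous_at -(fg x Ux).
  by apply: cvg_trans (cf x Ux); apply: near_eq_cvg.
move=> [df Df]; have nfg x : U x -> \forall y \near x, f y = g y.
  by move=> Ux; apply: filterS (open_nbhs_nbhs (conj oU Ux)) => y /fg.
split=> [x Ux|v]; first exact: near_eq_differentiable (nfg x Ux) (df x Ux).
by apply: (IH _ _ _ (Df v)) => x Ux; apply: near_eq_derive; exact: nfg.
Qed.

Lemma Ck_cst k U (c : R) : Ck k U (fun=> c).
Proof.
elim: k c => [|k IH] c /=; first by move=> x _; exact: cst_continuous.
split=> [x _|v]; first exact: differentiable_cst.
suff -> : 'D_v (fun=> c) = (fun=> 0) :> (E -> R) by exact: IH.
by apply/funext => x; exact: derive_cst.
Qed.

Lemma Ck_add k U f g : open U -> Ck k U f -> Ck k U g ->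
  Ck k U (fun x => f x + g x).
Proof.
move=> oU; elim: k f g => [|k IH] f g /=.
  by move=> cf cg x Ux; apply: continuousD; [exact: cf|exact: cg].
move=> [df Df] [dg Dg]; split=> [x Ux|v].
  by apply: differentiableD; [exact: df|exact: dg].
apply: (Ck_eq oU _ (IH _ _ (Df v) (Dg v))) => x Ux.
by rewrite -deriveD //; apply: diff_derivable; [exact: df|exact: dg].
Qed.

Lemma Ck_mul k U f g : open U -> Ck k U f -> Ck k U g ->
  Ck k U (fun x => f x * g x).
Proof.
move=> oU; elim: k f g => [|k IH] f g.
  by move=> cf cg x Ux; apply: continuousM; [exact: cf|exact: cg].
move=> cf cg; have [df Df] := cf; have [dg Dg] := cg; split=> [x Ux|v].
  by apply: differentiableM; [exact: df|exact: dg].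
(* The Leibniz rule pairs a derivative, of class [k], with a factor of class [k.+1], which [Ck_pred]
   lowers. *)
have C1 : Ck k U (fun x => f x * 'D_v g x) := IH _ _ (Ck_pred cf) (Dg v).
have C2 : Ck k U (fun x => g x * 'D_v f x) := IH _ _ (Ck_pred cg) (Df v).
apply: (Ck_eq oU _ (Ck_add oU C1 C2)) => x Ux.
by rewrite deriveM //; apply: diff_derivable; [exact: df|exact: dg].
Qed.

Lemma smooth_sub U V f : U `<=` V -> smooth_on V f -> smooth_on U f.
Proof. by move=> UV h k; exact: Ck_sub (h k). Qed.

Lemma smooth_local U f :
  (forall x, U x -> exists2 V : set E, V x & smooth_on V f) -> smooth_on U f.
Proof. by move=> h k; apply: Ck_local => x /h[V Vx /(_ k)]; exists V. Qed.

Lemma smooth_eq U f g : open U -> (forall x, U x -> f x = g x) ->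
  smooth_on U f -> smooth_on U g.
Proof. by move=> oU fg h k; exact: Ck_eq (h k). Qed.

Lemma smooth_differentiable U f x : smooth_on U f -> U x -> differentiable f x.
Proof. by move=> /(_ 1%N) [h _] /h. Qed.

Lemma smooth_derive U f v : smooth_on U f -> smooth_on U ('D_v f).
Proof. by move=> h k; have [_] := h k.+1; exact. Qed.

End SmoothCalculus.

(** * Algebras of functions *)

Section FunctionAlgebra.
Variables (R : realType) (X : Type).

(** A common interface for functions of class [Ck] or smooth on an open set of a normed space and
    for smooth functions on an open set of the manifold: formulas built by sums and products are
    treated once for all of them. *)
Definition fun_alg (S : set (X -> R)) :=
  [/\ forall c, S (fun=> c),
      forall f g, S f -> S g -> S (fun x => f x + g x) &
      forall f g, S f -> S g -> S (fun x => f x * g x)].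

Variables (S : set (X -> R)) (hS : fun_alg S).

Lemma alg_cst c : S (fun=> c). Proof. by case: hS. Qed.
Lemma alg_add f g : S f -> S g -> S (fun x => f x + g x).
Proof. by case: hS => _ + _; exact. Qed.
Lemma alg_mul f g : S f -> S g -> S (fun x => f x * g x).
Proof. by case: hS => _ _; exact. Qed.
Lemma alg_opp f : S f -> S (fun x => - f x).
Proof.
by move=> Sf; under eq_fun do rewrite -mulN1r; exact: alg_mul (alg_cst _) Sf.
Qed.
Lemma alg_sub f g : S f -> S g -> S (fun x => f x - g x).
Proof. by move=> Sf Sg; exact: alg_add Sf (alg_opp Sg). Qed.
Lemma alg_sum I (r : seq I) (P : pred I) (f : I -> X -> R) :
  (forall i, P i -> S (f i)) -> S (fun x => \sum_(i <- r | P i) f i x).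
Proof.
move=> Sf; elim: r => [|i r IH].
  by under eq_fun do rewrite big_nil; exact: alg_cst.
under eq_fun do rewrite big_cons.
by case: (boolP (P i)) => // /Sf Sfi; exact: alg_add.
Qed.
Lemma alg_prod I (r : seq I) (P : pred I) (f : I -> X -> R) :
  (forall i, P i -> S (f i)) -> S (fun x => \prod_(i <- r | P i) f i x).
Proof.
move=> Sf; elim: r => [|i r IH].
  by under eq_fun do rewrite big_nil; exact: alg_cst.
under eq_fun do rewrite big_cons.
by case: (boolP (P i)) => // /Sf Sfi; exact: alg_mul.
Qed.
Lemma alg_exp f k : S f -> S (fun x => f x ^+ k).
Proof.
move=> Sf; elim: k => [|k IH].
  by under eq_fun do rewrite expr0; exact: alg_cst.
by under eq_fun do rewrite exprS; exact: alg_mul.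
Qed.
Lemma alg_mulmx a b c (A : X -> 'M[R]_(a, b)) (B : X -> 'M[R]_(b, c)) :
  (forall i j, S (fun x => A x i j)) -> (forall i j, S (fun x => B x i j)) ->
  forall i j, S (fun x => (A x *m B x) i j).
Proof.
move=> SA SB i j; under eq_fun do rewrite mxE.
by apply: alg_sum => l _; exact: alg_mul.
Qed.
Lemma alg_tr a b (A : X -> 'M[R]_(a, b)) :
  (forall i j, S (fun x => A x i j)) -> forall i j, S (fun x => (A x)^T i j).
Proof. by move=> SA i j; under eq_fun do rewrite mxE. Qed.

End FunctionAlgebra.

Lemma smooth_fun_alg (R : realType) (E : normedModType R) (U : set E) :
  open U -> fun_alg (smooth_on U).
Proof.
move=> oU; split=> [c k|f g sf sg k|f g sf sg k]; first exact: Ck_cst.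
  exact: Ck_add.
exact: Ck_mul.
Qed.

Section Composition.
Variables (R : realType) (E : normedModType R) (n : nat).

Lemma differentiable_rV (g : E -> 'rV[R]_n) x :
  (forall b, differentiable (fun y => g y 0 b) x) -> differentiable g x.
Proof.
move=> dg.
have -> : g = \sum_b (fun y => g y 0 b *: (delta_mx 0 b : 'rV[R]_n)).
  by apply/funext => y; rewrite fct_sumE; exact: row_sum_delta.
by apply: differentiable_sum => b; exact: differentiableZl.
Qed.

Lemma derive_comp_rV (f : 'rV[R]_n -> R) (g : E -> 'rV[R]_n) x v :
  differentiable f (g x) -> (forall b, differentiable (fun y => g y 0 b) x) ->
  'D_v (f \o g) x = \sum_b 'D_v (fun y => g y 0 b) x * 'D_(delta_mx 0 b) f (g x).
Proof.
move=> df dg; have dG := differentiable_rV dg.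
rewrite deriveE; last exact: differentiable_comp.
rewrite diff_comp //= -[X in 'd f _ X]deriveE // derive_mx; last exact: diff_derivable.
set w := (X in 'd f _ X); rewrite [w]row_sum_delta linear_sum.
by apply: eq_bigr => b _; rewrite linearZ /= -deriveE // mxE.
Qed.

(** Induction on the order, for all smooth [f] at once: the chain rule gives a sum of products of
    derivatives of [g] with partial derivatives of [f] composed with [g], and these partial
    derivatives are again smooth. *)
Lemma smooth_comp (f : 'rV[R]_n -> R) (g : E -> 'rV[R]_n) U V :
  open U -> (forall b, smooth_on U (fun x => g x 0 b)) -> smooth_on V f ->
  (forall x, U x -> V (g x)) -> smooth_on U (f \o g).
Proof.
move=> oU sg sf UV k; elim: k f sf => [|k IH] f sf.
  move=> x Ux; apply: continuous_comp.
    apply: differentiable_continuous; apply: differentiable_rV => b.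
    exact: smooth_differentiable (sg b) Ux.
  exact: differentiable_continuous (smooth_differentiable sf (UV _ Ux)).
split=> [x Ux|v].
  apply: differentiable_comp; last exact: smooth_differentiable sf (UV _ Ux).
  by apply: differentiable_rV => b; exact: smooth_differentiable (sg b) Ux.
have hS : fun_alg (Ck (R:=R) (E:=E) k U).
  by split; [exact: Ck_cst|move=> *; exact: Ck_add|move=> *; exact: Ck_mul].
have : Ck k U (fun x => \sum_b 'D_v (fun y => g y 0 b) x
                 * ('D_(delta_mx 0 b) f \o g) x).
  apply: (alg_sum hS) => b _; apply: (alg_mul hS).
    exact: (smooth_derive v (sg b)) k.
  by apply: IH; exact: smooth_derive.
apply: Ck_eq => // x Ux; rewrite derive_comp_rV //.
  exact: smooth_differentiable sf (UV _ Ux).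
by move=> b; exact: smooth_differentiable (sg b) Ux.
Qed.

End Composition.

Section DirectionalDerivative.
Variables (R : realType) (E : normedModType R) (x v : E).

Lemma is_derive_bigsum I (r : seq I) (P : pred I) (h : I -> E -> R) (dh : I -> R) :
  (forall i, P i -> is_derive x v (h i) (dh i)) ->
  is_derive x v (fun y => \sum_(i <- r | P i) h i y) (\sum_(i <- r | P i) dh i).
Proof.
move=> dhP; elim: r => [|i r IH].
  by rewrite big_nil; under eq_fun do rewrite big_nil; exact: is_derive_cst.
rewrite big_cons; under eq_fun do rewrite big_cons.
by case: (boolP (P i)) => // /dhP di; exact: is_deriveD.
Qed.

Lemma is_derive_mul (f g : E -> R) df dg : is_derive x v f df -> is_derive x v g dg ->
  is_derive x v (fun y => f y * g y) (df * g x + f x * dg).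
Proof.
move=> hf hg; have -> : df * g x + f x * dg = f x *: dg + g x *: df.
  by rewrite addrC [df * _]mulrC.
exact: is_deriveM.
Qed.

End DirectionalDerivative.

(** * Functions flat at the origin *)

Section FlatFunctions.
Variable R : realType.
Implicit Types (p : {poly R}) (x : R).

(* This family of functions is closed under differentiation, also at 0, which
   is why its members are smooth. *)
Definition flat p x : R := if 0 < x then p.[x^-1] * expR (- x^-1) else 0.

(** With t = 1/x, the exponential series gives t^(i+1) <= (i+1)! exp(t), so each monomial satisfies
    t^i exp(-t) <= (i+1)! x. *)
Lemma flat_bound p : exists2 C, 0 <= C & forall x, `|flat p x| <= C * `|x|.
Proof.
exists (\sum_(i < size p) `|p`_i| * (i.+1)`!%:R).
  by apply: sumr_ge0 => i _; rewrite mulr_ge0.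
move=> x; rewrite /flat; case: ifPn => x0; last first.
  by rewrite normr0 mulr_ge0 // sumr_ge0 // => i _; rewrite mulr_ge0.
rewrite normrM (gtr0_norm (expR_gt0 _)) horner_coef.
apply: le_trans (ler_wpM2r (expR_ge0 _) (ler_norm_sum _ _ _)) _.
rewrite !mulr_suml; apply: ler_sum => i _.
rewrite normrM normrX -!mulrA; apply: ler_wpM2l => //.
rewrite normfV (gtr0_norm x0).
have xi0 : 0 <= x^-1 by rewrite invr_ge0 ltW.
have := expR_ge1Dxn i xi0; set t := x^-1 => Et.
have {}Et : t ^+ i.+1 <= (i.+1)`!%:R * expR t.
  rewrite mulrC -ler_pdivrMr ?ltr0n ?fact_gt0 //.
  by apply: le_trans Et; rewrite lerDr.
have -> : t ^+ i = t ^+ i.+1 * x.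
  by rewrite exprSr -mulrA mulVf ?mulr1 // gt_eqF.
rewrite mulrAC ler_pM2r // expRN ler_pdivrMr ?expR_gt0 //.
Qed.

(** For x > 0 the product and chain rules give x^-2 (p - p')(1/x) exp(-1/x), which explains the
    polynomial; the case x = 0 needs a separate limit. *)
Lemma flat_derive p x :
  is_derive x 1 (flat p) (flat ('X^2 * (p - p^`())) x).
Proof.
have [x0|x0|->] := ltgtP x 0.
- have h : \forall y \near x, 0 = flat p y.
    near=> y; rewrite /flat ltNge ltW //=; near: y; exact: lt_nbhsl.
  rewrite {2}/flat ltNge ltW //=.
  by apply: (near_eq_is_derive h); exact: is_derive_cst.
- have h : \forall y \near x, p.[y^-1] * expR (- y^-1) = flat p y.
    near=> y; rewrite /flat ifT //; near: y; exact: lt_nbhsr.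
  apply: (near_eq_is_derive h); rewrite /flat x0.
  have xn : x != 0 by rewrite gt_eqF.
  have dV : is_derive x 1 (fun y => y^-1) (- x ^- 2).
    by have := is_deriveV (f := id) xn (is_derive_id x 1); rewrite [_ *: _]mulr1.
  have dN : is_derive x 1 (fun y => - y^-1) (x ^- 2).
    by have := is_deriveN dV; rewrite opprK.
  have d1 : is_derive x 1 (fun y => p.[y^-1]) (p^`().[x^-1] * - x ^- 2).
    exact: (is_derive1_comp (is_derive_poly p x^-1) dV).
  have d2 : is_derive x 1 (fun y => expR (- y^-1)) (expR (- x^-1) * x ^- 2).
    exact: (@is_derive1_comp R expR (fun y => - y^-1) x _ _ (is_derive_expR (- x^-1)) dN).
  have := is_derive_mul d1 d2; congr is_derive.
  by rewrite !hornerE /= -!exprVn; ring.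
- rewrite {2}/flat ltxx.
  (* The difference quotient at 0 is [flat ('X * p) h], so the linear bound for ['X * p] makes it
     tend to 0. *)
  have [C C0 hC] := flat_bound ('X * p).
  have lim0 : (h^-1 *: (flat p (h *: 1 + 0) - flat p 0)) @[h --> 0^'] --> (0 : R).
    apply/cvgr0Pnorm_le => e e0; have Cp : 0 < C + 1 by rewrite ltr_wpDl.
    near=> h.
    have hn : h != 0 by near: h; exact: nbhs_dnbhs_neq.
    have -> : h^-1 *: (flat p (h *: 1 + 0) - flat p 0) = flat ('X * p) h.
      rewrite addr0 [h *: 1]mulr1 /flat ltxx subr0; case: ifP => _.
        by rewrite !hornerE [_ *: _]mulrA.
      by rewrite scaler0.
    apply: le_trans (hC h) _.
    apply: le_trans (_ : (C + 1) * `|h| <= e); first by rewrite ler_wpM2r ?lerDl.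
    rewrite mulrC -ler_pdivlMr //; near: h.
    by apply: dnbhs0_le; rewrite divr_gt0.
  by split; [apply/cvg_ex; exists 0|apply/cvg_lim].
Unshelve. all: by end_near. Qed.

(** The derivative is again flat, with another polynomial, times a derivative of [g]; hence the
    induction runs over all [p]. *)
Lemma smooth_flat (E : normedModType R) (U : set E) (g : E -> R) p : open U ->
  smooth_on U g -> smooth_on U (fun y : E => flat p (g y)).
Proof.
move=> oU sg k.
have df q x : differentiable (flat q) x.
  by apply/derivable1_diffP; have [] := flat_derive q x.
elim: k p => [|k IH] p.
  move=> x Ux; apply: continuous_comp; apply: differentiable_continuous => //.
  exact: smooth_differentiable sg Ux.
split=> [x Ux|v].
  by apply: differentiable_comp => //; exact: smooth_differentiable sg Ux.
have C1 := Ck_mul oU (smooth_derive v sg k) (IH ('X^2 * (p - p^`()))).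
apply: Ck_eq C1 => // x Ux; have dg := smooth_differentiable sg Ux.
rewrite [RHS]deriveE; last exact: differentiable_comp.
rewrite (_ : (fun y => flat p (g y)) = flat p \o g) // diff_comp //=.
have -> : 'd g x v = 'D_v g x *: (1 : R) by rewrite deriveE // [RHS]mulr1.
by rewrite linearZ /= -deriveE //; have [_ ->] := flat_derive p (g x).
Qed.

Lemma flat1_gt0 x : 0 < x -> 0 < flat 1 x.
Proof. by move=> x0; rewrite /flat x0 hornerE mul1r expR_gt0. Qed.

Lemma flat_le0 p x : x <= 0 -> flat p x = 0.
Proof. by move=> x0; rewrite /flat ltNge x0. Qed.

End FlatFunctions.

(** * Exterior algebra *)

Section ExteriorAlgebra.
Variables (R : realType) (m : nat).
Implicit Types (xi : 'cV[R]_m) (X : 'rV[R]_m) (phi : ext R m) (J : {set 'I_m}).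
Implicit Types (A B : 'M[R]_m).

Lemma wedge_is_linear xi : linear (wedge xi).
Proof.
move=> a f g; apply/ffunP => J; rewrite !ffunE scaler_sumr -big_split /=.
by apply: eq_bigr => j _; rewrite !ffunE mulrDr mulrCA.
Qed.
HB.instance Definition _ xi :=
  GRing.isLinear.Build R (ext R m) (ext R m) _ (wedge xi) (wedge_is_linear xi).

(** Swapping the arguments lets linearity in the other variable be registered too; [contrr],
    [cl_prodr], [kmulr] and [vmulr] serve the same purpose. *)
Definition wedger phi xi : ext R m := wedge xi phi.
Lemma wedger_is_linear phi : linear (wedger phi).
Proof.
move=> a f g; apply/ffunP => J; rewrite !ffunE scaler_sumr -big_split /=.
by apply: eq_bigr => j _; rewrite !mxE mulrDr mulrDl mulrCA -!mulrA.
Qed.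
HB.instance Definition _ phi :=
  GRing.isLinear.Build R 'cV[R]_m (ext R m) _ (wedger phi) (wedger_is_linear phi).

Lemma contr_is_linear X : linear (contr X).
Proof.
move=> a f g; apply/ffunP => J; rewrite !ffunE scaler_sumr -big_split /=.
by apply: eq_bigr => j _; rewrite !ffunE mulrDr mulrCA.
Qed.
HB.instance Definition _ X :=
  GRing.isLinear.Build R (ext R m) (ext R m) _ (contr X) (contr_is_linear X).

Definition contrr phi X : ext R m := contr X phi.
Lemma contrr_is_linear phi : linear (contrr phi).
Proof.
move=> a f g; apply/ffunP => J; rewrite !ffunE scaler_sumr -big_split /=.
by apply: eq_bigr => j _; rewrite !mxE mulrDr mulrDl mulrCA -!mulrA.
Qed.
HB.instance Definition _ phi :=
  GRing.isLinear.Build R 'rV[R]_m (ext R m) _ (contrr phi) (contrr_is_linear phi).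

Lemma cl_prod_is_linear (w : TTd R m) : linear (cl_prod w).
Proof.
by move=> a f g; rewrite /cl_prod !linearP /= addrACA -scalerDr.
Qed.
HB.instance Definition _ w :=
  GRing.isLinear.Build R (ext R m) (ext R m) _ (cl_prod w) (cl_prod_is_linear w).

Definition cl_prodr phi (w : TTd R m) : ext R m := cl_prod w phi.
Lemma cl_prodr_is_linear phi : linear (cl_prodr phi).
Proof.
move=> a v w; rewrite /cl_prodr /cl_prod.
have -> : wedge (a *: v + w).2 phi = a *: wedge v.2 phi + wedge w.2 phi.
  exact: (linearP (wedger phi)).
have -> : contr (a *: v + w).1 phi = a *: contr v.1 phi + contr w.1 phi.
  exact: (linearP (contrr phi)).
by rewrite scalerBr opprD addrACA.
Qed.
HB.instance Definition _ phi :=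
  GRing.isLinear.Build R (TTd R m) (ext R m) _ (cl_prodr phi) (cl_prodr_is_linear phi).

Lemma ext_map_is_linear A : linear (ext_map A).
Proof.
move=> a f g; rewrite /ext_map scaler_sumr -big_split /=.
by apply: eq_bigr => J _; rewrite !ffunE scalerDl scalerA.
Qed.
HB.instance Definition _ A :=
  GRing.isLinear.Build R (ext R m) (ext R m) _ (ext_map A) (ext_map_is_linear A).

Lemma cov_sum_delta xi : xi = \sum_j xi j 0 *: delta_mx j 0.
Proof.
rewrite [LHS]matrix_sum_delta; apply: eq_bigr => i _.
by rewrite big_ord1.
Qed.

Lemma wedge_sumE xi phi : wedge xi phi = \sum_j xi j 0 *: wedge (delta_mx j 0) phi.
Proof.
rewrite {1}(cov_sum_delta xi) -/(wedger phi _) linear_sum.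
by apply: eq_bigr => j _; rewrite linearZ.
Qed.

Lemma contr_sumE X phi : contr X phi = \sum_j X 0 j *: contr (delta_mx 0 j) phi.
Proof.
rewrite {1}(row_sum_delta X) -/(contrr phi _) linear_sum.
by apply: eq_bigr => j _; rewrite linearZ.
Qed.

Lemma ext_scaleE a phi J : (a *: phi) J = a * phi J.
Proof. by rewrite ffunE. Qed.

Lemma ext_addE phi psi J : (phi + psi) J = phi J + psi J.
Proof. by rewrite ffunE. Qed.

Lemma ext_subE phi psi J : (phi - psi) J = phi J - psi J.
Proof. by rewrite !ffunE. Qed.

Lemma ext_sumE phi : phi = \sum_J phi J *: ext_basis R J.
Proof.
apply/ffunP => I; rewrite sum_ffunE (bigD1 I) //= big1 => [|J JI].
  by rewrite addr0 ext_scaleE ffunE eqxx mulr1.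
by rewrite ext_scaleE ffunE eq_sym (negbTE JI) mulr0.
Qed.

Lemma ext_linear_eq (f g : {linear ext R m -> ext R m}) :
  (forall J, f (ext_basis R J) = g (ext_basis R J)) -> f =1 g.
Proof.
move=> fg phi; rewrite (ext_sumE phi) !linear_sum; apply: eq_bigr => J _.
by rewrite !linearZ /= fg.
Qed.

(** The sign of moving e_j to its sorted place among the factors of e_J. *)
Definition sgn_before (j : 'I_m) J : R := (-1) ^+ #|[set i in J | (i < j)%N]|.

Lemma sgn_beforeU i j J : i \notin J ->
  sgn_before j (i |: J) = (-1) ^+ (i < j)%N * sgn_before j J.
Proof.
move=> iJ; rewrite /sgn_before -exprD; congr (_ ^+ _).
case: (boolP (i < j)%N) => ij /=.
  rewrite -[RHS](_ : #|i |: [set i0 in J | (i0 < j)%N]| = _).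
    by apply: eq_card => l; rewrite !inE; case: eqP => // ->; rewrite ij.
  by rewrite cardsU1 inE (negbTE iJ).
by apply: eq_card => l; rewrite !inE; case: eqP => // ->; rewrite (negbTE ij) !andbF.
Qed.

Lemma sgn_beforeD i j J : i \in J ->
  sgn_before j (J :\ i) = (-1) ^+ (i < j)%N * sgn_before j J.
Proof.
move=> iJ; rewrite -{2}(finset.setD1K iJ) sgn_beforeU ?finset.setD11 //.
by rewrite mulrA -expr2 sqrr_sign mul1r.
Qed.

Lemma sgn_before_sq j J : sgn_before j J * sgn_before j J = 1.
Proof. by rewrite -expr2 sqrr_sign. Qed.

Lemma wedge_deltaE j phi J : wedge (delta_mx j 0) phi J =
  if j \in J then sgn_before j J * phi (J :\ j) else 0.
Proof.
rewrite ffunE; case: ifPn => jJ.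
  rewrite (bigD1 j) //= mxE !eqxx mulr1 big1 ?addr0 // => i /andP[_ ij].
  by rewrite mxE (negbTE ij) mulr0 mul0r.
rewrite big1 // => i iJ; rewrite mxE; case: eqP => [ij|_].
  by rewrite -ij iJ in jJ.
by rewrite mulr0 mul0r.
Qed.

Lemma contr_deltaE j phi J : contr (delta_mx 0 j) phi J =
  if j \in J then 0 else sgn_before j J * phi (j |: J).
Proof.
rewrite ffunE; case: ifPn => jJ.
  rewrite big1 // => i iJ; rewrite mxE eqxx /=; case: eqP => [ij|_].
    by rewrite -ij (negbTE iJ) in jJ.
  by rewrite mulr0 mul0r.
rewrite (bigD1 j) //= mxE !eqxx mulr1 big1 ?addr0 // => i /andP[_ ij].
by rewrite mxE eqxx (negbTE ij) mulr0 mul0r.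
Qed.

(** Removing an index flips the sign of the other exactly when the removed one is smaller. Of
    [i < j] and [j < i] exactly one holds when the indices differ, so the two orders differ by one
    sign. *)
Lemma wedge_delta_anti i j phi :
  wedge (delta_mx i 0) (wedge (delta_mx j 0) phi) =
  - wedge (delta_mx j 0) (wedge (delta_mx i 0) phi).
Proof.
apply/ffunP => J; rewrite [RHS]ffunE !wedge_deltaE !inE.
have [<-|ij] := eqVneq i j; first by case: ifP; rewrite ?eqxx ?mulr0 oppr0.
case: (boolP (i \in J)) => iJ; case: (boolP (j \in J)) => jJ;
  rewrite /= ?mulr0 ?oppr0 //.
rewrite !sgn_beforeD // [J :\ i :\ j]finset.setDDl finset.setUC -finset.setDDl.
have -> : (-1) ^+ (i < j)%N = - (-1) ^+ (j < i)%N :> R.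
  by case: ltngtP ij => [||/val_inj->]; rewrite ?opprK ?eqxx.
ring.
Qed.

Lemma contr_wedge_delta i j phi :
  contr (delta_mx 0 i) (wedge (delta_mx j 0) phi) =
  (i == j)%:R *: phi - wedge (delta_mx j 0) (contr (delta_mx 0 i) phi).
Proof.
apply/ffunP => J.
rewrite ext_subE ext_scaleE !(contr_deltaE, wedge_deltaE) !inE.
have [<-|ij] := eqVneq i j.
  rewrite mul1r; case: (boolP (i \in J)) => iJ /=.
    rewrite sgn_beforeD // ltnn mul1r mulrA sgn_before_sq finset.setD1K // !mul1r.
    by rewrite subrr.
  by rewrite sgn_beforeU // ltnn mul1r mulrA sgn_before_sq finset.setU1K // !mul1r subr0.
rewrite mul0r sub0r /=.
case: (boolP (i \in J)) => iJ; case: (boolP (j \in J)) => jJ;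
  rewrite /= ?mulr0 ?oppr0 //.
rewrite sgn_beforeD // sgn_beforeU //.
have -> : (i |: J) :\ j = i |: J :\ j.
  apply/finset.setP => l; rewrite !inE; case: (eqVneq l i) => // ->.
  by rewrite ij.
have -> : (-1) ^+ (i < j)%N = - (-1) ^+ (j < i)%N :> R.
  by case: ltngtP ij => [||/val_inj->]; rewrite ?opprK ?eqxx.
ring.
Qed.

Lemma wedge_anti xi eta phi : wedge xi (wedge eta phi) = - wedge eta (wedge xi phi).
Proof.
rewrite !(wedge_sumE xi) [wedge eta (\sum_j _)]linear_sum -sumrN.
apply: eq_bigr => i _; rewrite linearZ /= -scalerN; congr (_ *: _).
rewrite !(wedge_sumE eta) linear_sum -sumrN; apply: eq_bigr => j _.
by rewrite linearZ /= wedge_delta_anti scalerN.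
Qed.

Lemma wedge_sq xi phi : wedge xi (wedge xi phi) = 0.
Proof.
have /eqP := wedge_anti xi xi phi.
rewrite -addr_eq0 -mulr2n -scaler_nat scaler_eq0 pnatr_eq0 /=.
by move=> /eqP.
Qed.

Lemma contr_wedge X xi phi :
  contr X (wedge xi phi) = (X *m xi) 0 0 *: phi - wedge xi (contr X phi).
Proof.
rewrite mxE scaler_suml (contr_sumE X (wedge xi phi)) (contr_sumE X phi) linear_sum.
rewrite -sumrB; apply: eq_bigr => i _; rewrite linearZ /= -scalerA -scalerBr.
congr (_ *: _); rewrite !(wedge_sumE xi) linear_sum.
rewrite (eq_bigr (fun j => xi j 0 *: ((i == j)%:R *: phi)
    - xi j 0 *: wedge (delta_mx j 0) (contr (delta_mx 0 i) phi))); last first.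
  by move=> j _; rewrite linearZ /= contr_wedge_delta scalerBr.
rewrite sumrB; congr (_ - _).
rewrite (bigD1 i) //= eqxx scale1r big1 ?addr0 // => j ji.
by rewrite eq_sym (negbTE ji) scale0r scaler0.
Qed.

Definition ext_one : ext R m := ext_basis R finset.set0.

Lemma contr_one X : contr X ext_one = 0.
Proof.
apply/ffunP => J; rewrite !ffunE big1 // => j _; rewrite ffunE.
case: eqP => [/finset.setP /(_ j)|]; last by rewrite mulr0.
by rewrite !inE eqxx.
Qed.

Definition wedges (v : 'I_m -> 'cV[R]_m) s : ext R m :=
  foldr (fun j psi => wedge (v j) psi) ext_one s.

Lemma ext_mapE A phi : ext_map A phi = \sum_J phi J *: wedges (fun j => col j A) (enum J).
Proof. by []. Qed.

Lemma ext_map_basis A J : ext_map A (ext_basis R J) = wedges (fun j => col j A) (enum J).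
Proof.
rewrite ext_mapE (bigD1 J) //= ffunE eqxx scale1r big1 ?addr0 // => I IJ.
by rewrite ffunE (negbTE IJ) scale0r.
Qed.

Lemma wedges_in v s j : j \in s -> wedge (v j) (wedges v s) = 0.
Proof.
elim: s => // a s IH; rewrite inE => /orP[/eqP<-|js] /=; first exact: wedge_sq.
by rewrite wedge_anti IH // linear0 oppr0.
Qed.

(** Both index sets are filters of one sorted list, so the induction follows that list: each element
    of [J] below [j] is passed at the cost of one sign, until [j] itself is met. *)
Lemma wedges_insert v s J j : sorted (fun a b : 'I_m => (a < b)%N) s ->
  j \in s -> j \notin J ->
  wedge (v j) (wedges v [seq i <- s | i \in J]) =
  (-1) ^+ count (fun i => (i \in J) && (i < j)%N) s
    *: wedges v [seq i <- s | i \in j |: J].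
Proof.
move=> + + jJ; elim: s => // a s IH; rewrite /= path_sortedE; last first.
  by move=> x y z; exact: ltn_trans.
move=> /andP[/allP sa ss]; rewrite inE => /orP[/eqP ja|js].
  rewrite -ja (negbTE jJ) !inE eqxx /=.
  have -> : count (fun i => (i \in J) && (i < j)%N) s = 0%N.
    apply/eqP; rewrite eqn0Ngt -has_count; apply/hasPn => i /sa.
    by rewrite -ja => /ltnW; rewrite leqNgt => /negbTE ->; rewrite andbF.
  rewrite scale1r; congr (wedge _ (wedges _ _)).
  apply: eq_in_filter => i /sa; rewrite -ja !inE.
  by case: eqP => // ->; rewrite ltnn.
have aj := sa _ js; rewrite !inE.
have -> /= : (a == j) = false by apply/negbTE; apply: contraTneq aj => ->; rewrite ltnn.
have := IH ss js; rewrite aj andbT; case: ifP => aJ //= E.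
by rewrite wedge_anti E linearZ /= exprD expr1 mulN1r scaleNr.
Qed.

Lemma enum_sorted : sorted (fun a b : 'I_m => (a < b)%N) (enum 'I_m).
Proof. by have := iota_ltn_sorted 0 m; rewrite -val_enum_ord sorted_map. Qed.

Lemma count_card J j :
  count (fun i => (i \in J) && (i < j)%N) (enum 'I_m) = #|[set i in J | (i < j)%N]|.
Proof.
rewrite cardE -size_filter; congr size; rewrite enumT.
by apply: eq_filter => i; rewrite !inE.
Qed.

Lemma wedge_basis j J : wedge (delta_mx j 0) (ext_basis R J) =
  if j \in J then 0 else sgn_before j J *: ext_basis R (j |: J).
Proof.
apply/ffunP => I; rewrite wedge_deltaE [in RHS]fun_if !ffunE.
case: (boolP (j \in J)) => jJ.
  rewrite ffunE; case: ifP => // jI; case: eqP; rewrite ?mulr0 // => /finset.setP/(_ j).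
  by rewrite !inE eqxx jJ.
rewrite ext_scaleE ffunE; case: (eqVneq I (j |: J)) => [->|IJ].
  rewrite !inE eqxx /= finset.setU1K // eqxx; congr (_ * _).
  by rewrite sgn_beforeU // ltnn mul1r.
rewrite mulr0; case: ifP => // jI; case: eqP => [E|]; last by rewrite mulr0.
by rewrite -E finset.setD1K // eqxx in IJ.
Qed.

Lemma enum_filter J : enum J = [seq i <- enum 'I_m | i \in J].
Proof. by rewrite enumT. Qed.

(** By linearity only basis covectors and basis forms matter; there the sign of [wedges_insert] for
    the columns of [A] is the one in [wedge_basis]. Functoriality of [ext_map] then follows by
    [ext_ind]. *)
Lemma ext_map_wedge A xi phi : ext_map A (wedge xi phi) = wedge (A *m xi) (ext_map A phi).
Proof.
have E0 j J : ext_map A (wedge (delta_mx j 0) (ext_basis R J)) =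
    wedge (col j A) (ext_map A (ext_basis R J)).
  rewrite wedge_basis ext_map_basis; case: ifPn => jJ.
    rewrite (@wedges_in (fun j => col j A)) ?mem_enum //; exact: linear0.
  rewrite linearZ /= ext_map_basis !enum_filter.
  rewrite (@wedges_insert (fun j => col j A)) ?enum_sorted ?mem_enum //.
  by rewrite count_card.
rewrite wedge_sumE linear_sum /= [A *m xi](_ : _ = \sum_j xi j 0 *: col j A); last first.
  rewrite {1}(cov_sum_delta xi) linear_sum; apply: eq_bigr => j _.
  by rewrite linearZ /= colE.
rewrite -/(wedger _ _) linear_sum; apply: eq_bigr => j _; rewrite !linearZ /=.
congr (_ *: _).
exact: (@ext_linear_eq (ext_map A \o wedge (delta_mx j 0)) (wedge (col j A) \o ext_map A) (E0 j)).

Qed.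

Lemma ext_map_one A : ext_map A ext_one = ext_one.
Proof. by rewrite ext_map_basis enum_set0. Qed.

Lemma wedges_delta s : sorted (fun a b : 'I_m => (a < b)%N) s ->
  wedges (fun j => delta_mx j 0) s = ext_basis R [set i in s].
Proof.
elim: s => [_|a s IH]; first by congr ext_basis; apply/finset.setP => i; rewrite !inE.
rewrite /= path_sortedE; last by move=> x y z; exact: ltn_trans.
move=> /andP[/allP sa ss]; rewrite IH // wedge_basis inE.
have -> : (a \in s) = false by apply/negP => /sa; rewrite ltnn.
rewrite /sgn_before (_ : #|_| = 0%N) ?scale1r.
  by congr ext_basis; apply/finset.setP => i; rewrite !inE.
apply/eqP; rewrite cards_eq0; apply/eqP/finset.setP => i; rewrite !inE.
by apply/negP => /andP[/sa ai /(ltn_trans ai)]; rewrite ltnn.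
Qed.

(** Forms are generated from 1 by linear combinations and wedge products with basis covectors, so an
    identity between linear operators reduces to how they commute with [wedge]. *)
Lemma ext_ind (P : ext R m -> Prop) :
  (forall a phi psi, P phi -> P psi -> P (a *: phi + psi)) -> P ext_one ->
  (forall j phi, P phi -> P (wedge (delta_mx j 0) phi)) -> forall phi, P phi.
Proof.
move=> PD P1 Pw phi; have P0 : P 0 by rewrite -(subrr ext_one) addrC -scaleN1r; exact: PD.
rewrite (ext_sumE phi); elim/big_ind: _ => // [x y Px Py|J _].
  by rewrite -[x]scale1r; exact: PD.
rewrite -[_ *: _]addr0; apply: PD => //.
have -> : J = [set i in enum J] by apply/finset.setP => i; rewrite inE mem_enum.
rewrite -wedges_delta; last first.
  by rewrite enum_filter sorted_filter ?enum_sorted // => x y z; exact: ltn_trans.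
by elim: (enum J) => //= j s IH; exact: Pw.
Qed.

Lemma ext_map1 phi : ext_map 1%:M phi = phi.
Proof.
elim/ext_ind: phi => [a f g Ef Eg||j f Ef].
- by rewrite linearP /= Ef Eg.
- exact: ext_map_one.
- by rewrite ext_map_wedge mul1mx Ef.
Qed.

Lemma ext_mapM A B phi : ext_map A (ext_map B phi) = ext_map (A *m B) phi.
Proof.
elim/ext_ind: phi => [a f g Ef Eg||j f Ef].
- by rewrite !linearP /= Ef Eg.
- by rewrite !ext_map_one.
- by rewrite !ext_map_wedge Ef mulmxA.
Qed.

Lemma contr_ext_map A X phi : contr X (ext_map A phi) = ext_map A (contr (X *m A) phi).
Proof.
elim/ext_ind: phi => [a f g Ef Eg||j f Ef].
- by rewrite !linearP /= Ef Eg.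
- by rewrite ext_map_one !contr_one linear0.
- by rewrite ext_map_wedge !contr_wedge Ef linearB linearZ /= ext_map_wedge mulmxA.
Qed.

Lemma ext_map_cl_prod A A' (w : TTd R m) phi : A' *m A = 1%:M ->
  ext_map A (cl_prod w phi) = cl_prod (w.1 *m A', A *m w.2) (ext_map A phi).
Proof.
move=> A'A; rewrite /cl_prod linearB /= ext_map_wedge; congr (_ - _).
by rewrite contr_ext_map -mulmxA A'A mulmx1.
Qed.

(* the derivation of the exterior algebra extending [xi |-> B *m xi] *)
Definition ext_der B phi : ext R m :=
  \sum_b \sum_c B b c *: wedge (delta_mx b 0) (contr (delta_mx 0 c) phi).

Lemma ext_der_is_linear B : linear (ext_der B).
Proof.
move=> a f g; rewrite /ext_der scaler_sumr -big_split; apply: eq_bigr => b _ /=.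
rewrite scaler_sumr -big_split; apply: eq_bigr => c _ /=.
by rewrite !linearP.
Qed.
HB.instance Definition _ B :=
  GRing.isLinear.Build R (ext R m) (ext R m) _ (ext_der B) (ext_der_is_linear B).

Lemma ext_derD B C phi : ext_der (B + C) phi = ext_der B phi + ext_der C phi.
Proof.
rewrite /ext_der -big_split; apply: eq_bigr => b _ /=.
rewrite -big_split; apply: eq_bigr => c _ /=.
by rewrite mxE scalerDl.
Qed.

(** Two signs cancel: the contraction obeys an antiderivation rule, and [xi] anticommutes with the
    basis covector wedged on afterwards. *)
Lemma ext_der_wedge B xi phi :
  ext_der B (wedge xi phi) = wedge (B *m xi) phi + wedge xi (ext_der B phi).
Proof.
have -> : wedge (B *m xi) phi =
    \sum_b \sum_c B b c *: (xi c 0 *: wedge (delta_mx b 0) phi).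
  rewrite wedge_sumE; apply: eq_bigr => b _; rewrite mxE scaler_suml.
  by apply: eq_bigr => c _; rewrite scalerA.
rewrite linear_sum -big_split; apply: eq_bigr => b _ /=.
rewrite linear_sum -big_split; apply: eq_bigr => c _ /=.
rewrite contr_wedge linearB linearZ /= linearZ /= wedge_anti opprK scalerDr.
have -> : ((delta_mx 0 c : 'rV[R]_m) *m xi) 0 0 = xi c 0 by rewrite -rowE mxE.
by rewrite [X in _ = _ + X]linearZ /= !scalerA [_ * xi c 0]mulrC.
Qed.

Lemma ext_der_one B : ext_der B ext_one = 0.
Proof.
rewrite /ext_der big1 // => b _; rewrite big1 // => c _.
by rewrite contr_one linear0 scaler0.
Qed.

Lemma ext_map_der A A' B phi : A' *m A = 1%:M ->
  ext_map A (ext_der B phi) = ext_der (A *m B *m A') (ext_map A phi).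
Proof.
move=> A'A; elim/ext_ind: phi => [a f g Ef Eg||j f Ef].
- by rewrite !linearP /= Ef Eg.
- by rewrite ext_map_one !ext_der_one linear0.
- rewrite !(ext_map_wedge, ext_der_wedge) linearD /= !ext_map_wedge Ef.
  by rewrite !mulmxA -[_ *m A' *m A]mulmxA A'A mulmx1.
Qed.

Section Smoothness.
Variables (T : Type) (S : set (T -> R)) (hS : fun_alg S).

Lemma alg_wedge (xi : T -> 'cV[R]_m) (f : T -> ext R m) :
  (forall j, S (fun x => xi x j 0)) -> (forall J, S (fun x => f x J)) ->
  forall J, S (fun x => wedge (xi x) (f x) J).
Proof.
move=> Sxi Sf J; under eq_fun do rewrite ffunE.
apply: (alg_sum hS) => j _; apply: (alg_mul hS) => //.
by apply: (alg_mul hS) => //; exact: alg_cst.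
Qed.

Lemma alg_contr (X : T -> 'rV[R]_m) (f : T -> ext R m) :
  (forall j, S (fun x => X x 0 j)) -> (forall J, S (fun x => f x J)) ->
  forall J, S (fun x => contr (X x) (f x) J).
Proof.
move=> SX Sf J; under eq_fun do rewrite ffunE.
apply: (alg_sum hS) => j _; apply: (alg_mul hS) => //.
by apply: (alg_mul hS) => //; exact: alg_cst.
Qed.

Lemma alg_cl_prod (w : T -> TTd R m) (f : T -> ext R m) :
  (forall j, S (fun x => (w x).1 0 j)) -> (forall j, S (fun x => (w x).2 j 0)) ->
  (forall J, S (fun x => f x J)) -> forall J, S (fun x => cl_prod (w x) (f x) J).
Proof.
move=> Sw1 Sw2 Sf J; under eq_fun do rewrite /cl_prod ext_subE.
by apply: (alg_sub hS); [exact: alg_wedge|exact: alg_contr].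
Qed.

Lemma alg_scale (a : T -> R) (f : T -> ext R m) :
  S a -> (forall J, S (fun x => f x J)) -> forall J, S (fun x => (a x *: f x) J).
Proof. by move=> Sa Sf J; under eq_fun do rewrite ffunE; exact: alg_mul. Qed.

Lemma alg_ext_sum (I : Type) (r : seq I) (P : pred I) (f : I -> T -> ext R m) :
  (forall i, P i -> forall J, S (fun x => f i x J)) ->
  forall J, S (fun x => (\sum_(i <- r | P i) f i x) J).
Proof.
move=> Sf J; under eq_fun do rewrite sum_ffunE.
by apply: (alg_sum hS) => i Pi; exact: Sf.
Qed.

Lemma alg_ext_map (A : T -> 'M[R]_m) (f : T -> ext R m) :
  (forall i j, S (fun x => A x i j)) -> (forall J, S (fun x => f x J)) ->
  forall J, S (fun x => ext_map (A x) (f x) J).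
Proof.
move=> SA Sf; apply: alg_ext_sum => K _; apply: alg_scale => //.
elim: (enum K) => [|j s IH] J /=; first exact: alg_cst.
by apply: alg_wedge => // i; under eq_fun do rewrite mxE.
Qed.

Lemma alg_ext_der (B : T -> 'M[R]_m) (f : T -> ext R m) :
  (forall i j, S (fun x => B x i j)) -> (forall J, S (fun x => f x J)) ->
  forall J, S (fun x => ext_der (B x) (f x) J).
Proof.
move=> SB Sf; apply: alg_ext_sum => b _; apply: alg_ext_sum => c _.
apply: alg_scale => //; apply: alg_wedge; first by move=> j; exact: alg_cst.
by apply: alg_contr => // j; exact: alg_cst.
Qed.

End Smoothness.

Section Derivative.
Variables (E : normedModType R) (x v : E).

Definition ext_is_derive (f : E -> ext R m) (f' : ext R m) :=
  forall J, is_derive x v (fun y => f y J) (f' J).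

Lemma ext_is_derive_wedge (xi : E -> 'cV[R]_m) xi' f f' :
  (forall j, is_derive x v (fun y => xi y j 0) (xi' j 0)) -> ext_is_derive f f' ->
  ext_is_derive (fun y => wedge (xi y) (f y)) (wedge xi' (f x) + wedge (xi x) f').
Proof.
move=> dxi df J.
have -> : (fun y => wedge (xi y) (f y) J) = (fun y => \sum_(j in J)
    sgn_before j J * (xi y j 0 * f y (J :\ j))).
  by apply/funext => y; rewrite ffunE; apply: eq_bigr => j _; rewrite mulrA.
have -> : (wedge xi' (f x) + wedge (xi x) f') J =
    \sum_(j in J) (0 * (xi x j 0 * f x (J :\ j)) +
      sgn_before j J * (xi' j 0 * f x (J :\ j) + xi x j 0 * f' (J :\ j))).
  rewrite !ffunE -big_split; apply: eq_bigr => j _ /=.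
  by rewrite mul0r add0r mulrDr !mulrA.
apply: is_derive_bigsum => j _; apply: (is_derive_mul (is_derive_cst _ _ _)).
exact: is_derive_mul.
Qed.

Lemma ext_is_derive_scale (a : E -> R) a' f f' : is_derive x v a a' ->
  ext_is_derive f f' ->
  ext_is_derive (fun y => a y *: f y) (a' *: f x + a x *: f').
Proof.
move=> da df J; under eq_fun do rewrite ext_scaleE.
by rewrite ffunE !ext_scaleE; exact: is_derive_mul.
Qed.

Lemma ext_is_derive_sum I (r : seq I) (P : pred I) (f : I -> E -> ext R m)
    (f' : I -> ext R m) :
  (forall i, P i -> ext_is_derive (f i) (f' i)) ->
  ext_is_derive (fun y => \sum_(i <- r | P i) f i y) (\sum_(i <- r | P i) f' i).
Proof.
move=> df J; under eq_fun do rewrite sum_ffunE.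
by rewrite sum_ffunE; apply: is_derive_bigsum => i Pi; exact: df.
Qed.

(** Writing the derivative of [A] as [B *m A] makes the derivative of the algebra morphism
    [ext_map A] equal to the derivation [ext_der B] applied after it. In [nabla_change] this yields
    the inhomogeneous term of the connection. *)
Lemma ext_is_derive_map (A : E -> 'M[R]_m) B f f' :
  (forall i j, is_derive x v (fun y => A y i j) ((B *m A x) i j)) ->
  ext_is_derive f f' ->
  ext_is_derive (fun y => ext_map (A y) (f y))
    (ext_map (A x) f' + ext_der B (ext_map (A x) (f x))).
Proof.
move=> dA df.
have dW J : ext_is_derive (fun y => wedges (fun j => col j (A y)) (enum J))
    (ext_der B (wedges (fun j => col j (A x)) (enum J))).
  elim: (enum J) => [|j s IH] /=.
    move=> K; rewrite ext_der_one.
    have -> : (0 : ext R m) K = 0 by rewrite ffunE.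
    exact: (is_derive_cst (ext_one K)).
  rewrite ext_der_wedge; apply: ext_is_derive_wedge => // i.
  under eq_fun do rewrite mxE.
  have -> // : (B *m col j (A x)) i 0 = (B *m A x) i j.
  by rewrite !colE mulmxA -colE mxE.
have := ext_is_derive_sum (index_enum _) (P := xpredT)
  (fun J _ => ext_is_derive_scale (df J) (dW J)).
rewrite big_split /=; congr (ext_is_derive _ (_ + _)).
rewrite [ext_map (A x) (f x)]ext_mapE linear_sum.
by apply: eq_bigr => J _; rewrite linearZ.
Qed.

End Derivative.
End ExteriorAlgebra.

(** * Normed algebras and the action of su(1,1) *)

Section CayleyDickson.
Variable R : realType.

Lemma kconj_is_linear k : linear (@kconj R k).
Proof.
elim: k => [|k IH] //= a x y; rewrite !linearP /= IH scale_row_mx add_row_mx.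
by congr (row_mx _ _); rewrite scalerN opprD.
Qed.
HB.instance Definition _ k :=
  GRing.isLinear.Build R 'rV[R]_(kdim k) 'rV[R]_(kdim k) _ (@kconj R k) (@kconj_is_linear k).

(** Both sides are proved jointly, because the doubling formula puts the halves of each factor on
    either side of a product. *)
Lemma kmul_linear2 k :
  (forall z : 'rV[R]_(kdim k), linear ((@kmul R k)^~ z)) /\
  (forall z : 'rV[R]_(kdim k), linear (kmul z)).
Proof.
elim: k => [|k [IHl IHr]]; split=> z a x y /=.
- by rewrite mulmxDl -scalemxAl.
- by rewrite mulmxDr -scalemxAr.
- rewrite !linearP /= !IHl !IHr scale_row_mx add_row_mx; congr (row_mx _ _).
    by rewrite scalerBr opprD addrACA.
  by rewrite scalerDr addrACA.
- rewrite !linearP /= !IHl !IHr scale_row_mx add_row_mx; congr (row_mx _ _).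
    by rewrite scalerBr opprD addrACA.
  by rewrite scalerDr addrACA.
Qed.

Lemma kmul_is_linear k (z : 'rV[R]_(kdim k)) : linear (kmul z).
Proof. exact: (kmul_linear2 k).2. Qed.
HB.instance Definition _ k (z : 'rV[R]_(kdim k)) :=
  GRing.isLinear.Build R 'rV[R]_(kdim k) 'rV[R]_(kdim k) _ (kmul z) (kmul_is_linear z).

Definition kmulr k (z x : 'rV[R]_(kdim k)) := kmul x z.
Lemma kmulr_is_linear k (z : 'rV[R]_(kdim k)) : linear (kmulr z).
Proof. exact: (kmul_linear2 k).1. Qed.
HB.instance Definition _ k (z : 'rV[R]_(kdim k)) :=
  GRing.isLinear.Build R 'rV[R]_(kdim k) 'rV[R]_(kdim k) _ (kmulr z) (kmulr_is_linear z).

Lemma kmulDl k (x y z : 'rV[R]_(kdim k)) : kmul (x + y) z = kmul x z + kmul y z.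
Proof. exact: (linearD (kmulr z)). Qed.
Lemma kmulBl k (x y z : 'rV[R]_(kdim k)) : kmul (x - y) z = kmul x z - kmul y z.
Proof. exact: (linearB (kmulr z)). Qed.
Lemma kmulNl k (x z : 'rV[R]_(kdim k)) : kmul (- x) z = - kmul x z.
Proof. exact: (linearN (kmulr z)). Qed.
Lemma kmul0l k (z : 'rV[R]_(kdim k)) : kmul 0 z = 0.
Proof. exact: (linear0 (kmulr z)). Qed.
Lemma kmulDr k (x y z : 'rV[R]_(kdim k)) : kmul z (x + y) = kmul z x + kmul z y.
Proof. exact: linearD. Qed.
Lemma kmulBr k (x y z : 'rV[R]_(kdim k)) : kmul z (x - y) = kmul z x - kmul z y.
Proof. exact: linearB. Qed.
Lemma kconjD k (x y : 'rV[R]_(kdim k)) : kconj (x + y) = kconj x + kconj y.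
Proof. exact: linearD. Qed.
Lemma kconjB k (x y : 'rV[R]_(kdim k)) : kconj (x - y) = kconj x - kconj y.
Proof. exact: linearB. Qed.

Lemma kre_is_linear k : linear (@kre R k : 'rV[R]_(kdim k) -> R^o).
Proof. by elim: k => [|k IH] a x y /=; rewrite ?mxE // linearP /= IH. Qed.
HB.instance Definition _ k :=
  GRing.isLinear.Build R 'rV[R]_(kdim k) R^o _ (@kre R k) (@kre_is_linear k).

Lemma kconjK k : involutive (@kconj R k).
Proof.
elim: k => [|k IH] x //=.
by rewrite row_mxKl row_mxKr IH opprK hsubmxK.
Qed.

Lemma kconj1 k : kconj (kone R k) = kone R k.
Proof. by elim: k => [|k IH] //=; rewrite row_mxKl row_mxKr IH oppr0. Qed.

Lemma kmul1 k (x : 'rV[R]_(kdim k)) : kmul (kone R k) x = x /\ kmul x (kone R k) = x.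
Proof.
elim: k x => [|k IH] x /=; first by rewrite mul1mx mulmx1.
rewrite !row_mxKl !row_mxKr !linear0 !kmul0l !subr0 !addr0 !kconj1 add0r ?subr0.
by rewrite (IH _).1 !(IH _).2 hsubmxK.
Qed.

Lemma kmul1l k (x : 'rV[R]_(kdim k)) : kmul (kone R k) x = x.
Proof. exact: (kmul1 x).1. Qed.
Lemma kmul1r k (x : 'rV[R]_(kdim k)) : kmul x (kone R k) = x.
Proof. exact: (kmul1 x).2. Qed.
Lemma kmul0r k (x : 'rV[R]_(kdim k)) : kmul x 0 = 0.
Proof. exact: linear0. Qed.
Lemma kconj0 k : kconj 0 = 0 :> 'rV[R]_(kdim k).
Proof. exact: linear0. Qed.

Lemma kconjM k (x y : 'rV[R]_(kdim k)) : kconj (kmul x y) = kmul (kconj y) (kconj x).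
Proof.
elim: k x y => [|k IH] x y /=.
  by apply/matrixP => i j; rewrite !mxE; apply: eq_bigr => l _; rewrite !ord1 mulrC.
rewrite !row_mxKl !row_mxKr linearB /= !IH !kconjK; congr (row_mx _ _).
  by rewrite [kconj (- _)]linearN kmulNl [kmul _ (- _)]linearN opprK.
by rewrite !kmulNl opprD addrC.
Qed.

Definition dot l (x y : 'rV[R]_l) : R := (x *m y^T) 0 0.

Lemma dotC l (x y : 'rV[R]_l) : dot x y = dot y x.
Proof. by rewrite /dot -[in LHS](trmxK (_ *m _)) mxE trmx_mul trmxK. Qed.

Lemma dot_is_linear l (x : 'rV[R]_l) : linear (dot x : 'rV[R]_l -> R^o).
Proof. by move=> a y z; rewrite /dot linearP /= linearP !mxE. Qed.
HB.instance Definition _ l (x : 'rV[R]_l) :=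
  GRing.isLinear.Build R 'rV[R]_l R^o _ (dot x) (dot_is_linear x).

Lemma dotDr l (x y z : 'rV[R]_l) : dot x (y + z) = dot x y + dot x z.
Proof. exact: (linearD (dot x)). Qed.
Lemma dotNr l (x y : 'rV[R]_l) : dot x (- y) = - dot x y.
Proof. exact: (linearN (dot x)). Qed.
Lemma dotDl l (x y z : 'rV[R]_l) : dot (x + y) z = dot x z + dot y z.
Proof. by rewrite dotC dotDr !(dotC z). Qed.
Lemma dotNl l (x y : 'rV[R]_l) : dot (- x) y = - dot x y.
Proof. by rewrite dotC dotNr dotC. Qed.
Lemma dot_row l1 l2 (x y : 'rV[R]_(l1 + l2)) :
  dot x y = dot (lsubmx x) (lsubmx y) + dot (rsubmx x) (rsubmx y).
Proof.
by rewrite /dot -{1}(hsubmxK x) -{1}(hsubmxK y) tr_row_mx mul_row_col mxE.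
Qed.

Lemma dot_eq0 l (x : 'rV[R]_l) : (dot x x == 0) = (x == 0).
Proof.
apply/eqP/eqP => [|->]; last by rewrite /dot mul0mx mxE.
rewrite /dot mxE => /psumr_eq0P h; apply/rowP => i; rewrite !mxE.
have := h _ i isT; rewrite mxE => /(_ _)/eqP; rewrite mulf_eq0 orbb => H.
by apply/eqP/H => j _; rewrite mxE -expr2 sqr_ge0.
Qed.

Lemma dot_conj k (x y : 'rV[R]_(kdim k)) : dot (kconj x) (kconj y) = dot x y.
Proof.
elim: k x y => [|k IH] x y //=.
rewrite dot_row [RHS]dot_row !row_mxKl !row_mxKr IH; congr (_ + _).
by rewrite dotNl dotNr opprK.
Qed.

(** This identity ties the product to the metric; through it right multiplication by [kconj a]
    becomes the adjoint of right multiplication by [a] ([dot_kmulr]). *)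
Lemma kre_mul_conj k (x y : 'rV[R]_(kdim k)) : kre (kmul x (kconj y)) = dot x y.
Proof.
elim: k x y => [|k IH] x y /=.
  by rewrite /dot mxE [RHS]mxE; apply: eq_bigr => l _; rewrite mxE !ord1.
rewrite dot_row !row_mxKl !row_mxKr linearB /= IH.
rewrite [kconj (- _)]linearN kmulNl linearN opprK; congr (_ + _).
by rewrite /= -[X in kmul _ X]kconjK IH dot_conj dotC.
Qed.

(** The real part is a trace, which makes up for the missing commutativity of H. It follows from the
    symmetry of [dot] and its invariance under conjugation. *)
Lemma kre_mulC k (x y : 'rV[R]_(kdim k)) : kre (kmul x y) = kre (kmul y x).
Proof.
by rewrite -[y in LHS]kconjK -[x in RHS]kconjK !kre_mul_conj -[in RHS]dot_conj kconjK dotC.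
Qed.

Lemma kmul_comm k (x y : 'rV[R]_(kdim k)) : (k <= 1)%N -> kmul x y = kmul y x.
Proof.
have C0 (a b : 'rV[R]_(kdim 0)) : kmul a b = kmul b a.
  by apply/matrixP => i j; rewrite !mxE; apply: eq_bigr => l _; rewrite !ord1 mulrC.
case: k x y => [|[|//]] x y _; first exact: C0.
rewrite /=; congr (row_mx (_ - _) _); [exact: C0|exact: C0|].
by rewrite addrC; congr (_ + _); exact: C0.
Qed.

(** A double is associative when the algebra it is built from is associative and commutative;
    [k <= 2] gives both for the halves. *)
Lemma kmulA k (x y z : 'rV[R]_(kdim k)) : (k <= 2)%N ->
  kmul (kmul x y) z = kmul x (kmul y z).
Proof.
elim: k x y z => [|k IH] x y z k2 /=; first by rewrite mulmxA.
have A (a b c : 'rV[R]_(kdim k)) : kmul (kmul a b) c = kmul a (kmul b c).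
  by apply: IH; exact: ltnW.
have C (a b : 'rV[R]_(kdim k)) : kmul a b = kmul b a by exact: kmul_comm.
rewrite !row_mxKl !row_mxKr; move: (lsubmx x) (rsubmx x) (lsubmx y) (rsubmx y)
  (lsubmx z) (rsubmx z) => a b c d e f.
rewrite !(kconjB, kconjD) !(kmulBl, kmulDl) !(kmulBr, kmulDr) !kconjM !kconjK !A !opprD.
congr (row_mx _ _).
  have -> : kmul (kconj d) (kmul b e) = kmul e (kmul (kconj d) b) by rewrite -A C.
  have -> : kmul (kconj f) (kmul d a) = kmul a (kmul (kconj f) d) by rewrite -A C.
  have -> : kmul (kconj f) (kmul b (kconj c)) = kmul (kconj c) (kmul (kconj f) b).
    by rewrite -A C.
  by rewrite -!addrA; congr (_ + _); rewrite addrC -addrA.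
rewrite (C c a) (C (kconj e) a) (C (kconj e) (kconj c)).
have -> : kmul b (kmul (kconj d) f) = kmul f (kmul (kconj d) b).
  by rewrite C (C (kconj d)) A.
by rewrite -!addrA; congr (_ + _); rewrite addrC -addrA.
Qed.

Lemma kmul_conj_self k (x : 'rV[R]_(kdim k)) : kmul (kconj x) x = dot x x *: kone R k.
Proof.
elim: k x => [|k IH] x /=.
  by rewrite [x]mx11_scalar /dot tr_scalar_mx -scalar_mxM scale_scalar_mx mulr1
    [in RHS]mxE eqxx mulr1n.
rewrite dot_row !row_mxKl !row_mxKr IH [kmul _ (- _)]linearN /= scale_row_mx.
by rewrite opprK IH kmulNl subrr scaler0 scalerDl.
Qed.

(** Cyclicity of the real part brings conj(x) x together, and this is the scalar |x|^2. *)
Lemma dot_kmul k (x a b : 'rV[R]_(kdim k)) : (k <= 2)%N ->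
  dot (kmul x a) (kmul x b) = dot x x * kre (kmul a (kconj b)).
Proof.
move=> k2; rewrite -kre_mul_conj kconjM kmulA // kre_mulC !kmulA // kmul_conj_self.
by rewrite !linearZ /= kmul1r.
Qed.

Lemma dot_kmulr k (x y a : 'rV[R]_(kdim k)) : (k <= 2)%N ->
  dot (kmul x a) y = dot x (kmul y (kconj a)).
Proof. by move=> k2; rewrite -!kre_mul_conj kconjM kconjK kmulA. Qed.

End CayleyDickson.

(** * The module K^n and the maps iota on it *)

Section KModule.
Variables (R : realType) (k n : nat) (hk : (k <= 2)%N).
Local Notation K := 'rV[R]_(kdim k).
Local Notation V := 'rV[R]_(n * kdim k).
Implicit Types (x y z : V) (a b c : K).

Definition krow i x : K := row i (vec_mx x).

Lemma krow_inj x y : (forall i, krow i x = krow i y) -> x = y.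
Proof. by move=> h; rewrite -[x]vec_mxK -[y]vec_mxK; congr mxvec; exact/row_matrixP. Qed.

Lemma krow_vmul x a i : krow i (vmul x a) = kmul (krow i x) a.
Proof. by rewrite /krow /vmul mxvecK rowK. Qed.

Lemma krow_is_linear i : linear (krow i).
Proof. by move=> a x y; rewrite /krow !linearP. Qed.
HB.instance Definition _ i := GRing.isLinear.Build R V K _ (krow i) (krow_is_linear i).

Lemma vmul_is_linear x : linear (vmul x).
Proof.
move=> a b c; apply: krow_inj => i; rewrite (linearP (krow i)) /= !krow_vmul.
exact: (linearP (kmul _)).
Qed.
HB.instance Definition _ x := GRing.isLinear.Build R K V _ (vmul x) (vmul_is_linear x).

Definition vmulr a x := vmul x a.
Lemma vmulr_is_linear a : linear (vmulr a).
Proof.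
move=> b x y; apply: krow_inj => i; rewrite (linearP (krow i)) /= !krow_vmul.
by rewrite (linearP (krow i)); exact: (linearP (kmulr a)).
Qed.
HB.instance Definition _ a := GRing.isLinear.Build R V V _ (vmulr a) (vmulr_is_linear a).

Lemma vmulDl x y a : vmul (x + y) a = vmul x a + vmul y a.
Proof. exact: (linearD (vmulr a)). Qed.
Lemma vmulZl (e : R) x a : vmul (e *: x) a = e *: vmul x a.
Proof. exact: (linearZZ (vmulr a)). Qed.

Lemma vmulDr x a b : vmul x (a + b) = vmul x a + vmul x b.
Proof. exact: (linearD (vmul x)). Qed.
Lemma vmulBr x a b : vmul x (a - b) = vmul x a - vmul x b.
Proof. exact: (linearB (vmul x)). Qed.
Lemma vmulNr x a : vmul x (- a) = - vmul x a.
Proof. exact: (linearN (vmul x)). Qed.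

Lemma vmul1 x : vmul x (kone R k) = x.
Proof. by apply: krow_inj => i; rewrite krow_vmul kmul1r. Qed.

Lemma vmulA x a b : vmul (vmul x a) b = vmul x (kmul a b).
Proof. by apply: krow_inj => i; rewrite !krow_vmul kmulA. Qed.

Lemma dot_krow x y : dot x y = \sum_i dot (krow i x) (krow i y).
Proof.
rewrite /dot mxE (reindex _ (curry_mxvec_bij _ _)) /=.
rewrite [RHS](eq_bigr (fun i => \sum_j krow i x 0 j * krow i y 0 j)); last first.
  by move=> i _; rewrite mxE; apply: eq_bigr => j _; congr (_ * _); exact: mxE.
rewrite pair_bigA; apply: eq_bigr => -[i j] _ /=.
by rewrite !mxE.
Qed.

Lemma dot_vmulr x y a : dot (vmul x a) y = dot x (vmul y (kconj a)).
Proof.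
by rewrite !dot_krow; apply: eq_bigr => i _; rewrite !krow_vmul dot_kmulr.
Qed.

Lemma dot_vmul x a b : dot (vmul x a) (vmul x b) = dot x x * kre (kmul a (kconj b)).
Proof.
rewrite !dot_krow mulr_suml; apply: eq_bigr => i _.
by rewrite !krow_vmul dot_kmul.
Qed.

(** By [dot_vmul] the map a -> x a scales norms by |x|, so it has no kernel. *)
Lemma vmul_inj x a b : x != 0 -> vmul x a = vmul x b -> a = b.
Proof.
move=> x0 /eqP; rewrite -subr_eq0 -linearB -dot_eq0 /= dot_vmul kre_mul_conj.
by rewrite mulf_eq0 !dot_eq0 (negbTE x0) subr_eq0 => /eqP.
Qed.

(** The condition [0 < n] supplies a nonzero vector, orthogonality keeps its image nonzero, and
    [vmul_inj] cancels it. Hence [Phi t] fixes (1,0) and (0,1). *)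
Lemma is_theta_one (phi : 'M[R]_(n * kdim k)) t :
  (0 < n)%N -> phi *m phi^T = 1%:M -> is_theta phi t -> kone R k *m t = kone R k.
Proof.
move=> n0 phiT [_ h].
have kd : (0 < kdim k)%N by elim: (k) => //= l IH; rewrite addn_gt0 IH.
have nk : (0 < n * kdim k)%N by rewrite muln_gt0 n0.
pose x : V := delta_mx 0 (Ordinal nk).
have x0 : x *m phi != 0.
  apply/eqP => E; have /rowP/(_ (Ordinal nk)) : x = 0.
    by rewrite -[x]mulmx1 -phiT mulmxA E mul0mx.
  by rewrite !mxE !eqxx => /eqP; rewrite oner_eq0.
by apply: (vmul_inj x0); rewrite -h !vmul1.
Qed.

Definition kleft a (u : K * K) : K * K := (kmul a u.1, kmul a u.2).

(** The operators commuting with a left multiplication form a Lie subalgebra, which contains every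
    [phiA A] because that multiplies on the right; minimality of [sl2] concludes. *)
Lemma sl2_kleft (L : K * K -> K * K) a u : sl2 L -> L (kleft a u) = kleft a (L u).
Proof.
have kleftP (c : R) (v w : K * K) : kleft a (c *: v + w) = c *: kleft a v + kleft a w.
  by congr pair; rewrite /= linearP.
have kleft0 : kleft a 0 = 0 by congr pair; rewrite /= linear0.
move=> hL; have := hL [set L | forall u, L (kleft a u) = kleft a (L u)]; apply.
  split.
  - by move=> v; rewrite kleft0.
  - by move=> c L1 L2 h1 h2 v; rewrite h1 h2 kleftP.
  - move=> L1 L2 h1 h2 v; rewrite /commutator h2 !h1 h2.
    by rewrite addrC -scaleN1r -kleftP scaleN1r addrC.
move=> A _ v; rewrite /phiA /kleft /=.
by rewrite !kmulDr !kmulA.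
Qed.

Definition ku1 : K * K := (kone R k, 0).
Definition ku2 : K * K := (0, kone R k).

Lemma su11E (L : K * K -> K * K) u : su11 L ->
  L u = (kmul u.1 (L ku1).1 + kmul u.2 (L ku2).1, kmul u.1 (L ku1).2 + kmul u.2 (L ku2).2).
Proof.
move=> [hL [linL _]].
have {1}-> : u = 1 *: kleft u.1 ku1 + kleft u.2 ku2.
  rewrite scale1r; case: u => u1 u2; congr pair; rewrite /= ?linear0 ?kmul1r.
    by rewrite addr0.
  by rewrite add0r.
by rewrite linL !(sl2_kleft _ _ hL) scale1r.
Qed.

(** Skewness is tested on left multiples of the basis by an arbitrary [c]; since Re(c a) is a
    nondegenerate pairing, each test yields an identity in K. *)
Lemma su11_coef (L : K * K -> K * K) : su11 L ->
  [/\ kconj (L ku1).2 = - (L ku1).2, kconj (L ku2).1 = - (L ku2).1 &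
      kconj (L ku2).2 = - (L ku1).1].
Proof.
move=> sL; have [_ [_ skL]] := sL.
have eq_conj (a b : K) : (forall c, kre (kmul c (a + kconj b)) = 0) -> kconj b = - a.
  move=> h; apply/eqP; rewrite -addr_eq0 addrC -dot_eq0 -kre_mul_conj.
  by rewrite kre_mulC h.
have half (a b : R) : 2^-1 * a + 2^-1 * b = 0 -> a + b = 0.
  by rewrite -mulrDr => /eqP; rewrite mulf_eq0 invr_eq0 pnatr_eq0 /= => /eqP.
have L1 c : L (kleft c ku1) = kleft c (L ku1) by apply: sl2_kleft; case: sL.
have L2 c : L (kleft c ku2) = kleft c (L ku2) by apply: sl2_kleft; case: sL.
have simpl := (kconj0, kconj1, kmul1l, kmul1r, kmul0l, kmul0r, addr0, add0r).
have kreE (c a b : K) : kre (kmul c (a + b)) = kre (kmul c a) + kre (kmul c b).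
  by rewrite !linearD.
have kreZ (e : R) (a : K) : kre (e *: a) = e * kre a by exact: (linearZZ (@kre R k)).
split; apply: eq_conj => c; rewrite kreE; apply: half.
- by have := skL (kleft c ku1) ku1; rewrite L1 /qcheck /kleft /= !kreZ !simpl.
- by have := skL (kleft c ku2) ku2; rewrite L2 /qcheck /kleft /= !kreZ !simpl.
- by have := skL (kleft c ku1) ku2; rewrite L1 /qcheck /kleft /= !kreZ !simpl.
Qed.

Definition QV (w w' : V * V) : R := 2^-1 * (dot w.1 w'.2 + dot w.2 w'.1).

Lemma iota0_V_skew (L : K * K -> K * K) w w' : su11 L ->
  QV (iota0_V L w) w' + QV w (iota0_V L w') = 0.
Proof.
move=> /su11_coef; rewrite /QV /iota0_V -/ku1 -/ku2.
move: (L ku1).1 (L ku1).2 (L ku2).1 (L ku2).2 => a b c e [hb hc he] /=.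
have ha : kconj a = - e by rewrite -[e]kconjK he linearN opprK.
by rewrite !(dotDl, dotDr) !dot_vmulr ha hb hc he !vmulNr !dotNr; ring.
Qed.

(** The coefficients of a composite are products in reversed order, as [L] is left linear, and right
    multiplications on [V] compose in that same order. *)
Lemma iota0_VM (L L' : K * K -> K * K) (w : V * V) : su11 L -> su11 L' ->
  iota0_V (commutator L L') w = iota0_V L (iota0_V L' w) - iota0_V L' (iota0_V L w).
Proof.
move=> sL sL'; rewrite /iota0_V /commutator -/ku1 -/ku2.
rewrite (su11E (L' ku1) sL) (su11E (L' ku2) sL) (su11E (L ku1) sL') (su11E (L ku2) sL').
congr pair; rewrite /= !vmulBr !vmulDr -!vmulA !vmulDl.
  by do 8!move: (vmul (vmul _ _) _) => ?; apply/rowP => j; rewrite !mxE; ring.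
by do 8!move: (vmul (vmul _ _) _) => ?; apply/rowP => j; rewrite !mxE; ring.
Qed.

Lemma iota0_iota1_V (L : K * K -> K * K) u y : su11 L ->
  iota0_V L (iota1_V u y) = iota1_V (L u) y.
Proof.
move=> sL; rewrite (su11E u sL) /iota0_V /iota1_V -/ku1 -/ku2 /=.
by rewrite !vmulDr !vmulA.
Qed.

(** All entries are right multiples of one vector [y], so [dot_vmul] extracts [dot y y] from each
    term. *)
Lemma QV_iota1 (u v : K * K) y :
  QV (iota1_V u y) (iota1_V v y) = dot y y * qcheck u v.
Proof.
rewrite /QV /iota1_V /qcheck /= !dot_vmul.
have -> (e : R) (a : K) : kre (e *: a) = e * kre a by exact: (linearZZ (@kre R k)).
by rewrite linearD /=; ring.
Qed.

Definition phiV (phi : 'M[R]_(n * kdim k)) (w : V * V) : V * V := (w.1 *m phi, w.2 *m phi).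

Lemma iota1_V_phi phi t u y : is_theta phi t ->
  iota1_V (Phi t u) (y *m phi) = phiV phi (iota1_V u y).
Proof. by move=> [_ h]; rewrite /iota1_V /phiV /= !h. Qed.

(** The coefficients are the values on [ku1] and [ku2]; as [t] fixes 1, [Phi t] fixes this basis and
    the coefficients of [L] are the images under [t] of those of [L']. *)
Lemma iota0_V_phi phi t (L L' : K * K -> K * K) w :
  kone R k *m t = kone R k -> is_theta phi t ->
  (forall u, L (Phi t u) = Phi t (L' u)) ->
  iota0_V L (phiV phi w) = phiV phi (iota0_V L' w).
Proof.
move=> t1 [_ h] LL'; rewrite /iota0_V /phiV -/ku1 -/ku2.
have := LL' ku1; have := LL' ku2; rewrite {1 3}/Phi /= !t1 !mul0mx -/ku1 -/ku2 => -> ->.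
by rewrite /Phi /= -!h !mulmxDl.
Qed.


End KModule.

(** * Charts and bump functions *)

Section ManifoldCalculus.
Variables (R : realType) (m : nat) (M : manifold R m).
Implicit Types (p q : M) (i j l : mchart M) (U V : set M) (f h : M -> R).

Lemma dom_par i x : (crd i @` dom i) x -> dom i (par i x).
Proof. by move=> [p pi <-]; rewrite crdK. Qed.

Lemma parK i x : (crd i @` dom i) x -> crd i (par i x) = x.
Proof. by move=> [p pi <-]; rewrite crdK. Qed.

Lemma crd_image i U : crd i @` (dom i `&` U) = [set x | (crd i @` dom i) x /\ U (par i x)].
Proof.
apply/seteqP; split=> [_ [p [pi Up] <-]|x [[p pi <-] Up]] /=.
  by rewrite crdK //; split => //; exists p.
by exists p => //; split => //; rewrite crdK in Up.
Qed.

Lemma near_par i U p : open U -> U p -> dom i p ->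
  \forall x \near crd i p, (crd i @` dom i) x /\ U (par i x).
Proof.
move=> oU Up pi; have cp : (crd i @` dom i) (crd i p) by exists p.
have h1 : \forall x \near crd i p, (crd i @` dom i) x.
  by apply: open_nbhs_nbhs; split => //; exact: cod_open.
have h2 : \forall x \near crd i p, U (par i x).
  have := par_continuous cp; rewrite /prop_for /continuous_at crdK // => /(_ U).
  by apply; apply: open_nbhs_nbhs.
by apply: filterS2 h1 h2 => x; split.
Qed.

Lemma open_crd i U : open U -> open (crd i @` (dom i `&` U)).
Proof.
move=> oU; rewrite openE => _ [p [pi Up] <-].
by rewrite crd_image; exact: near_par.
Qed.

Lemma smooth_fun_fun_alg U : open U -> fun_alg (smooth_fun U).
Proof.
move=> oU; split=> [c i|f h sf sh i|f h sf sh i].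
- exact: (alg_cst (smooth_fun_alg (@open_crd i _ oU)) c).
- exact: (alg_add (smooth_fun_alg (@open_crd i _ oU)) (sf i) (sh i)).
- exact: (alg_mul (smooth_fun_alg (@open_crd i _ oU)) (sf i) (sh i)).
Qed.

Lemma smooth_fun_sub U V f : U `<=` V -> smooth_fun V f -> smooth_fun U f.
Proof.
move=> UV sf i; apply: smooth_sub (sf i) => _ [p [pi Up] <-].
by exists p => //; split => //; exact: UV.
Qed.

Lemma smooth_fun_local U f :
  (forall p, U p -> exists2 V, V p & smooth_fun V f) -> smooth_fun U f.
Proof.
move=> h i; apply: smooth_local => _ [p [pi /h[V Vp sf]] <-].
by exists (crd i @` (dom i `&` V)); [exists p|exact: sf].
Qed.

Lemma smooth_fun_eq U f h : open U -> (forall p, U p -> f p = h p) ->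
  smooth_fun U f -> smooth_fun U h.
Proof.
move=> oU fh sf i; apply: smooth_eq (sf i); first exact: open_crd.
by move=> _ [p [pi Up] <-]; rewrite crdK // fh.
Qed.

(** Smooth transition maps carry smoothness from one chart to all the others. *)
Lemma smooth_fun_chart i U f : open U -> U `<=` dom i ->
  smooth_on (crd i @` U) (fun x => f (par i x)) -> smooth_fun U f.
Proof.
move=> oU Ui sf j.
apply: (@smooth_eq _ _ _ ((fun x => f (par i x)) \o (fun x => crd i (par j x)))).
- exact: open_crd.
- by move=> _ [p [pj Up] <-] /=; rewrite !crdK //; exact: Ui.
- apply: (smooth_comp _ _ sf); first exact: open_crd.
    move=> b; apply: smooth_sub (transition_smooth j i b) => _ [p [pj Up] <-].
    by exists p => //; split => //; exact: Ui.
  by move=> _ [p [pj Up] <-] /=; rewrite crdK //; exists p.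
Qed.

Lemma smooth_crd i (b : 'I_m) : smooth_fun (dom i) (fun q => crd i q 0 b).
Proof. move=> j; exact: transition_smooth. Qed.

Lemma differentiable_par i U f p : smooth_fun U f -> U p -> dom i p ->
  differentiable (fun x => f (par i x)) (crd i p).
Proof. by move=> sf Up pi; apply: smooth_differentiable (sf i) _; exists p. Qed.

Lemma pd_is_derive i U f p v : smooth_fun U f -> U p -> dom i p ->
  is_derive (crd i p) v (fun x => f (par i x)) (pd i v f p).
Proof.
move=> sf Up pi; apply: derivableP; apply: diff_derivable.
exact: differentiable_par sf Up pi.
Qed.

Lemma smooth_pd i v U f : open U -> smooth_fun U f -> smooth_fun (dom i `&` U) (pd i v f).
Proof.
move=> oU sf; apply: (@smooth_fun_chart i).
- by apply: openI => //; exact: dom_open.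
- by move=> ? [].
- apply: smooth_eq (smooth_derive v (sf i)); first exact: open_crd.
  by move=> _ [p [pi Up] <-]; rewrite /pd crdK.
Qed.

Lemma pd_eq i v U f h p : open U -> U p -> dom i p -> (forall q, U q -> f q = h q) ->
  pd i v f p = pd i v h p.
Proof.
move=> oU Up pi fh; apply: near_eq_derive.
by apply: filterS (near_par oU Up pi) => x [_ /fh].
Qed.

Lemma pdE i v U f p : smooth_fun U f -> U p -> dom i p ->
  pd i v f p = \sum_a v 0 a * pd i (evec R a) f p.
Proof.
move=> sf Up pi; have df := differentiable_par sf Up pi.
rewrite /pd deriveE // {1}(row_sum_delta v) linear_sum; apply: eq_bigr => a _.
by rewrite linearZ /= deriveE.
Qed.

Lemma pd_chain i j v U f p : open U -> smooth_fun U f -> U p -> dom i p -> dom j p ->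
  pd i v f p = pd j (v *m jac i j p) f p.
Proof.
move=> oU sf Up pi pj; have df := differentiable_par sf Up pj.
have oUj : open (U `&` dom j) by apply: openI => //; exact: dom_open.
have sc b := smooth_crd j b.
rewrite (pdE _ sf Up pj) /pd.
rewrite (@near_eq_derive _ _ _ _
  ((fun x => f (par j x)) \o (fun x => crd j (par i x)))); last first.
  by apply: filterS (near_par oUj (conj Up pj) pi) => x [_ [_ xj]] /=; rewrite crdK.
rewrite derive_comp_rV /= ?crdK //; last first.
  by move=> b; exact: differentiable_par (sc b) pj pi.
apply: eq_bigr => b _; congr (_ * _).
rewrite [LHS](pdE _ (sc b) pj pi) mxE; apply: eq_bigr => a _.
by rewrite mxE.
Qed.

Lemma derive_coord (x v : 'rV[R]_m) (b : 'I_m) : 'D_v (fun y : 'rV[R]_m => y 0 b) x = v 0 b.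
Proof.
have := derive_mx (@derivable_id R 'rV[R]_m x v).
by rewrite derive_id => /rowP/(_ b); rewrite mxE.
Qed.

Lemma smooth_coord (E : set 'rV[R]_m) (b : 'I_m) : open E ->
  smooth_on E (fun y : 'rV[R]_m => y 0 b).
Proof.
move=> oE [|k]; first by move=> x _; exact: coord_continuous.
split=> [x _|v]; first exact: differentiable_coord.
apply: (@Ck_eq _ _ _ _ (fun=> v 0 b)) => //; first by move=> x _; rewrite derive_coord.
exact: Ck_cst.
Qed.

Lemma jacii i p : dom i p -> jac i i p = 1%:M.
Proof.
move=> pi; apply/matrixP => a b; rewrite mxE /pd.
rewrite (@near_eq_derive _ _ _ _ (fun y : 'rV[R]_m => y 0 b)); last first.
  by apply: filterS (near_par openT I pi) => x [xi _]; rewrite parK.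
by rewrite derive_coord !mxE eqxx eq_sym.
Qed.

Lemma jac_chain i j l p : dom i p -> dom j p -> dom l p ->
  jac i j p *m jac j l p = jac i l p.
Proof.
move=> pi pj pl; apply/matrixP => a c; rewrite mxE [RHS]mxE.
rewrite (pd_chain _ (dom_open l) (smooth_crd l c) pl pi pj).
rewrite (pdE _ (smooth_crd l c) pl pj); apply: eq_bigr => b _.
by rewrite -rowE !mxE.
Qed.

Lemma jacK i j p : dom i p -> dom j p -> jac i j p *m jac j i p = 1%:M.
Proof. by move=> pi pj; rewrite jac_chain // jacii. Qed.

Lemma smooth_jac i j a b : smooth_fun (dom i `&` dom j) (fun q => jac i j q a b).
Proof.
under eq_fun do rewrite mxE.
by apply: smooth_pd; [exact: dom_open|exact: smooth_crd].
Qed.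

Lemma tovK p i : dom i p -> tov p i *m ofv p i = 1%:M.
Proof. by move=> pi; apply: jacK => //; exact: chart_atP. Qed.

Lemma ofvK p i : dom i p -> ofv p i *m tov p i = 1%:M.
Proof. by move=> pi; apply: jacK => //; exact: chart_atP. Qed.

Lemma ofv_jac p i j : dom i p -> dom j p -> ofv p i = jac i j p *m ofv p j.
Proof. by move=> pi pj; rewrite jac_chain //; exact: chart_atP. Qed.

Lemma ofv_chart p : ofv p (chart_at p) = 1%:M.
Proof. by apply: jacii; exact: chart_atP. Qed.

Lemma tov_chart p : tov p (chart_at p) = 1%:M.
Proof. by apply: jacii; exact: chart_atP. Qed.

Section Bump.
Variables (i : mchart M) (p : M) (pi : dom i p).

(** The closed set [C] is part of the result because it allows extension by zero: a product of the
    bump with something smooth on the chart is smooth on [dom i] and on the complement of [C], two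
    open sets that cover the manifold. *)
Lemma bump_exists : exists (b : M -> R) (C : set M),
  [/\ smooth_fun setT b, b p = 1, closed C, C `<=` dom i & forall q, ~ C q -> b q = 0].
Proof.
have cp : (crd i @` dom i) (crd i p) by exists p.
have : nbhs (crd i p) (crd i @` dom i) by apply: open_nbhs_nbhs; split => //; exact: cod_open.
move=> /nbhs_ballP[e /= e0 be].
(* In the sup norm the cube of half-side [e / 2] lies in the ball of radius [e], hence inside the
   chart. *)
pose x0 := crd i p; pose r := e / 2; have r0 : 0 < r by rewrite divr_gt0.
pose K : set 'rV[R]_m := [set v | forall j : 'I_m, `[x0 0 j - r, x0 0 j + r]%classic (v 0 j)].
have cK : compact K.
  apply: (rV_compact (A := fun j : 'I_m => `[x0 0 j - r, x0 0 j + r]%classic)) => j.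
  exact: segment_compact.
have Kc : K `<=` crd i @` dom i.
  move=> v Kv; apply: be; split=> // a j; rewrite [a]ord1 /ball /=.
  have := Kv j; rewrite /= in_itv /= -ler_distlC => h.
  apply: le_lt_trans (_ : r < e); last by rewrite /r ltr_pdivrMr // ltr_pMr // ltr1n.
  by [].
(* The image of the compact cube is compact, hence closed in a Hausdorff space; it will serve as
   [C]. *)
have cC : closed (par i @` K).
  apply: compact_closed; first exact: man_hausdorff.
  apply: continuous_compact => //; apply: continuous_in_subspaceT => v.
  by rewrite inE => /Kc; exact: par_continuous.
(* Each factor is positive when its coordinate is at distance less than [r] from the centre and 0
   otherwise, so the product is supported in the cube. *)
pose w q := \prod_(j < m) flat 1 (r ^+ 2 - (crd i q 0 j - x0 0 j) ^+ 2).
pose b q := if `[< dom i q >] then w q else 0.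
have bi q : dom i q -> b q = w q by move=> qi; rewrite /b asboolT.
have bC q : ~ (par i @` K) q -> b q = 0.
  move=> nC; rewrite /b; case: asboolP => // qi.
  have : ~ K (crd i q) by move=> Kq; apply: nC; exists (crd i q) => //; rewrite crdK.
  move=> /existsNP[j nj]; rewrite /w (bigD1 j) //= flat_le0 ?mul0r //.
  rewrite subr_le0 -(ger0_norm (ltW r0)) -[X in _ <= X]real_normK ?num_real //.
  rewrite lerXn2r ?nnegrE // leNgt; apply/negP => h; apply: nj.
  rewrite /= in_itv /= -ler_distlC distrC; apply: ltW.
  by rewrite (ger0_norm (ltW r0)) in h.
have wp : 0 < b p.
  rewrite bi // prodr_gt0 // => j _; rewrite subrr expr0n subr0 flat1_gt0 //.
  by rewrite exprn_gt0.
have sb : smooth_fun setT b.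
  apply: smooth_fun_local => q _; have [qi|nqi] := pselect (dom i q).
    exists (dom i) => //; apply: (smooth_fun_eq (dom_open i) (f := w)).
      by move=> q' qi'; rewrite bi.
    have hA := smooth_fun_fun_alg (dom_open i).
    apply: (alg_prod hA) => j _.
    have sg : smooth_fun (dom i) (fun q => r ^+ 2 - (crd i q 0 j - x0 0 j) ^+ 2).
      apply: (alg_sub hA); first exact: alg_cst.
      apply: (alg_exp hA); apply: (alg_sub hA); first exact: smooth_crd.
      exact: alg_cst.
    move=> l; have := sg l; apply: smooth_flat.
    exact: open_crd (dom_open i).
  exists (~` (par i @` K)); first by move=> [v Kv vq]; apply: nqi; rewrite -vq; exact/dom_par/Kc.
  apply: (smooth_fun_eq (f := fun=> 0)); first exact: closed_openC.
    by move=> q' /bC ->.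
  exact: (alg_cst (smooth_fun_fun_alg (closed_openC cC))).
exists (fun q => (b p)^-1 * b q), (par i @` K); split.
- by apply: (alg_mul (smooth_fun_fun_alg openT)) => //; exact: (alg_cst (smooth_fun_fun_alg openT)).
- by rewrite mulVf // gt_eqF.
- exact: cC.
- by move=> _ [v Kv <-]; exact/dom_par/Kc.
- by move=> q /bC ->; rewrite mulr0.
Qed.

End Bump.

End ManifoldCalculus.

(** * Differential forms *)

Section LinearFacts.
Variables (R : realType) (U V : lmodType R) (f : U -> V).

(** These lemmas take linearity as a proposition, the form in which [clifford_module] and the maps
    [iota] provide it. *)
Lemma lin0 : linear f -> f 0 = 0.
Proof.
move=> lf; have E : f 0 = f 0 + f 0 by rewrite -{1}[0]addr0 -{1}[0](scale1r 0) lf scale1r.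
by apply: (addrI (f 0)); rewrite -E addr0.
Qed.

Lemma linZ (a : R) x : linear f -> f (a *: x) = a *: f x.
Proof. by move=> lf; rewrite -[a *: x]addr0 lf lin0 // addr0. Qed.

Lemma linD x y : linear f -> f (x + y) = f x + f y.
Proof. by move=> lf; rewrite -[x]scale1r lf !scale1r. Qed.

Lemma lin_sumZ (I : Type) (r : seq I) (c : I -> R) (w : I -> U) : linear f ->
  f (\sum_(i <- r) c i *: w i) = \sum_(i <- r) c i *: f (w i).
Proof.
move=> lf; elim: r => [|i r IH]; last by rewrite !big_cons lf IH.
by rewrite !big_nil lin0.
Qed.

End LinearFacts.

Section BilinearTrace.
Variables (R : realType) (m : nat) (V : lmodType R).

(* the contraction [\sum_a F (e^a, e_a)] does not depend on the basis *)
Lemma trace_change (F : 'cV[R]_m -> 'rV[R]_m -> V) (A A' : 'M[R]_m) :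
  (forall X, linear (F^~ X)) -> (forall xi, linear (F xi)) -> A *m A' = 1%:M ->
  \sum_a F (A *m delta_mx a 0) (delta_mx 0 a *m A') =
  \sum_a F (delta_mx a 0) (delta_mx 0 a).
Proof.
move=> Fl Fr AA'.
have suml X (x : 'cV[R]_m) : F x X = \sum_b x b 0 *: F (delta_mx b 0) X.
  by rewrite {1}(cov_sum_delta x) (lin_sumZ _ _ _ (Fl X)).
have sumr x (X : 'rV[R]_m) : F x X = \sum_c X 0 c *: F x (delta_mx 0 c).
  by rewrite {1}(row_sum_delta X) (lin_sumZ _ _ _ (Fr x)).
transitivity (\sum_a \sum_b \sum_c
    (A b a * A' a c) *: F (delta_mx b 0) (delta_mx 0 c)).
  apply: eq_bigr => a _; rewrite suml; apply: eq_bigr => b _.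
  rewrite sumr scaler_sumr; apply: eq_bigr => c _.
  by rewrite scalerA -rowE -colE !mxE.
rewrite exchange_big; apply: eq_bigr => b _ /=; rewrite exchange_big /=.
have E c : \sum_a (A b a * A' a c) *: F (delta_mx b 0) (delta_mx 0 c) =
    (b == c)%:R *: F (delta_mx b 0) (delta_mx 0 c).
  by rewrite -scaler_suml; move/matrixP/(_ b c): AA'; rewrite !mxE => ->.
rewrite (eq_bigr _ (fun c _ => E c)) (bigD1 b) //= eqxx scale1r big1 ?addr0 //.
by move=> c cb; rewrite eq_sym (negbTE cb) scale0r.
Qed.

End BilinearTrace.

Section Forms.
Variables (R : realType) (m : nat) (M : manifold R m).
Implicit Types (p q : M) (i j l : mchart M) (U V : set M) (f h : M -> R).
Implicit Types (phi psi : M -> ext R m).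

Lemma form_in_jac phi i j q : dom i q -> dom j q ->
  form_in phi i q = ext_map (jac i j q) (form_in phi j q).
Proof. by move=> qi qj; rewrite /form_in ext_mapM -ofv_jac. Qed.

Lemma form_in_chart phi p : form_in phi (chart_at p) p = phi p.
Proof. by rewrite /form_in ofv_chart ext_map1. Qed.

Definition smooth_form_on U phi :=
  forall i J, smooth_fun (dom i `&` U) (fun q => form_in phi i q J).

Lemma smooth_form_chart i U phi : open U -> U `<=` dom i ->
  (forall J, smooth_fun U (fun q => form_in phi i q J)) -> smooth_form_on U phi.
Proof.
move=> oU Ui sphi j J.
have oV : open (dom j `&` U) by apply: openI => //; exact: dom_open.
apply: (smooth_fun_eq oV (f := fun q => ext_map (jac j i q) (form_in phi i q) J)).
  by move=> q [qj qU]; rewrite -(form_in_jac phi qj (Ui _ qU)).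
apply: (alg_ext_map (smooth_fun_fun_alg oV)).
  move=> a b; apply: smooth_fun_sub (smooth_jac j i a b) => q [qj qU].
  by split=> //; exact: Ui.
by move=> I; apply: smooth_fun_sub (sphi I) => q [].
Qed.

Lemma smooth_form_local phi :
  (forall p, exists2 U, U p & smooth_form_on U phi) -> smooth_form phi.
Proof.
move=> sphi i J; apply: smooth_fun_local => p pi; have [U Up sU] := sphi p.
by exists (dom i `&` U).
Qed.

Lemma smooth_formP (a : R) phi psi : smooth_form phi -> smooth_form psi ->
  smooth_form (fun q => a *: phi q + psi q).
Proof.
move=> sphi spsi i J; have hA := smooth_fun_fun_alg (dom_open i).
have -> : (fun q => form_in (fun q => a *: phi q + psi q) i q J) =
    (fun q => a * form_in phi i q J + form_in psi i q J).
  by apply/funext => q; rewrite /form_in linearP ffunE ext_scaleE.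
by apply: (alg_add hA) => //; apply: (alg_mul hA) => //; exact: alg_cst.
Qed.

Lemma form_in_scale f phi i q : form_in (fun q => f q *: phi q) i q = f q *: form_in phi i q.
Proof. by rewrite /form_in linearZ. Qed.

Lemma smooth_form_scale f phi : smooth_fun setT f -> smooth_form phi ->
  smooth_form (fun q => f q *: phi q).
Proof.
move=> sf sphi i J; have hA := smooth_fun_fun_alg (dom_open i).
under eq_fun do rewrite form_in_scale.
apply: (alg_scale hA) => //; exact: smooth_fun_sub sf.
Qed.

(** A bump times a function affine in a chart: the affine function vanishes at [p] and the bump is 1
    there, so the product has the differential of the affine function. *)
Lemma function_exists p (xi : 'cV[R]_m) : exists h : M -> R,
  [/\ smooth_fun setT h, h p = 0 & differential h p = xi].
Proof.
set i := chart_at p; have pi : dom i p by exact: chart_atP.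
have [b [C [sb bp cC Ci bC]]] := bump_exists pi.
have hA := smooth_fun_fun_alg (dom_open i).
pose l q : R := \sum_a xi a 0 * (crd i q 0 a - crd i p 0 a).
have sl : smooth_fun (dom i) l.
  apply: (alg_sum hA) => a _; apply: (alg_mul hA); first exact: alg_cst.
  by apply: (alg_sub hA); [exact: smooth_crd|exact: alg_cst].
have lp : l p = 0 by rewrite /l big1 // => a _; rewrite subrr mulr0.
exists (fun q => b q * l q); split.
- apply: smooth_fun_local => q _; have [Cq|nCq] := pselect (C q).
    exists (dom i); first exact: Ci.
    by apply: (alg_mul hA) => //; exact: smooth_fun_sub sb.
  exists (~` C) => //; have oC := closed_openC cC.
  apply: (smooth_fun_eq (f := fun=> 0)) => //; first by move=> q' /bC ->; rewrite mul0r.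
  exact: (alg_cst (smooth_fun_fun_alg oC)).
- by rewrite lp mulr0.
apply/matrixP => a z; rewrite [z]ord1 !mxE -/i.
have db : is_derive (crd i p) (evec R a) (fun x => b (par i x)) (pd i (evec R a) b p).
  by apply: (pd_is_derive _ sb).
have dl := pd_is_derive (evec R a) sl pi pi.
have [_ E] := is_derive_mul db dl.
rewrite /pd E crdK // lp mulr0 add0r bp mul1r -/(pd i _ l p).
suff dl' : is_derive (crd i p) (evec R a) (fun x => l (par i x)) (\sum_c xi c 0 * (a == c)%:R).
  rewrite /pd; have [_ ->] := dl'; rewrite (bigD1 a) //= eqxx mulr1 big1 ?addr0 //.
  by move=> c ca; rewrite eq_sym (negbTE ca) mulr0.
apply: is_derive_bigsum => c _.
have dc := pd_is_derive (evec R a) (smooth_crd i c) pi pi.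
have -> : xi c 0 * (a == c)%:R =
    0 * (crd i (par i (crd i p)) 0 c - crd i p 0 c) +
    xi c 0 * (pd i (evec R a) (fun q => crd i q 0 c) p - 0).
  have := jacii pi => /matrixP/(_ a c); rewrite !mxE => ->.
  by rewrite mul0r add0r subr0.
by apply: (is_derive_mul (is_derive_cst _ _ _)); exact: is_deriveB.
Qed.

(** A bump times a form with constant coefficients in the chart [i]. Values at [q] are expressed in
    [chart_at q], which jumps with [q]; hence the factor [ext_map (tov q i)]. *)
Lemma form_exists p (w : ext R m) : exists s : M -> ext R m, smooth_form s /\ s p = w.
Proof.
set i := chart_at p; have pi : dom i p by exact: chart_atP.
have [b [C [sb bp cC Ci bC]]] := bump_exists pi.
exists (fun q => b q *: ext_map (tov q i) w); split; last first.
  by rewrite bp scale1r tov_chart ext_map1.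
apply: smooth_form_local => q; have [Cq|nCq] := pselect (C q).
  exists (dom i); first exact: Ci.
  apply: (@smooth_form_chart i) => //; first exact: dom_open.
  move=> J; have hA := smooth_fun_fun_alg (dom_open i).
  apply: (smooth_fun_eq (f := fun q => b q * w J)); first exact: dom_open.
    move=> q' qi'; rewrite form_in_scale ext_scaleE /form_in ext_mapM ofvK //.
    by rewrite ext_map1.
  apply: (alg_mul hA); first exact: smooth_fun_sub sb.
  exact: alg_cst.
exists (~` C) => // j J; have oC := closed_openC cC.
have oD : open (dom j `&` ~` C) by apply: openI => //; exact: dom_open.
apply: (smooth_fun_eq (f := fun=> 0)) => //.
  by move=> q' [_ /bC bq]; rewrite form_in_scale bq scale0r ffunE.
exact: (alg_cst (smooth_fun_fun_alg oD)).
Qed.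

End Forms.

(** * Covariant derivative *)

Section Connection.
Variables (R : realType) (m : nat) (M : manifold R m) (D : connection M).
Implicit Types (p q : M) (i j l : mchart M) (U V : set M) (f h : M -> R).
Implicit Types (phi psi : M -> ext R m) (v : 'rV[R]_m).

Lemma conn_form_is_linear i p : linear (conn_form D i p).
Proof.
move=> a v w; rewrite /conn_form scaler_sumr -big_split; apply: eq_bigr => b _ /=.
by rewrite !mxE scalerDl scalerA.
Qed.

Lemma conn_change i j p v : dom i p -> dom j p ->
  conn_form D i p v *m jac i j p =
    \matrix_(b, c) pd i v (fun q => jac i j q b c) p +
    jac i j p *m conn_form D j p (v *m jac i j p).
Proof.
move=> pi pj; have -> : conn_form D i p v *m jac i j p =
    \sum_a v 0 a *: (chris D i p a *m jac i j p).
  rewrite mulmx_suml; apply: eq_bigr => a _; exact: esym (scalemxAl _ _ _).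
rewrite (eq_bigr (fun a => v 0 a *: \matrix_(b, c) pd i (evec R a) (fun q => jac i j q b c) p +
    v 0 a *: (jac i j p *m conn_form D j p (row a (jac i j p))))); last first.
  by move=> a _; rewrite chris_change // scalerDr.
rewrite big_split; congr (_ + _).
  apply/matrixP => b c; rewrite summxE mxE (pdE _ (@smooth_jac _ _ M i j b c) (conj pi pj) pi).
  by apply: eq_bigr => a _; rewrite !mxE.
have -> : v *m jac i j p = \sum_a v 0 a *: row a (jac i j p) by exact: mulmx_sum_row.
rewrite (lin_sumZ _ _ _ (conn_form_is_linear j p)) mulmx_sumr; apply: eq_bigr => a _.
exact: scalemxAr.
Qed.

Definition fcoef phi i J q : R := form_in phi i q J.

(** Locked so that [ffunE] does not expand it; coefficients are read through [form_pdE]. *)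
Definition form_pd i v phi p : ext R m :=
  locked [ffun J => pd i v (fun q => form_in phi i q J) p].

Lemma form_pdE i v phi p J : form_pd i v phi p J = pd i v (fcoef phi i J) p.
Proof. by rewrite /form_pd -lock ffunE. Qed.

Definition nabla_in i phi p v : ext R m :=
  form_pd i v phi p - ext_der (conn_form D i p v) (form_in phi i p).

Lemma nablaE phi p v : nabla D phi p v = nabla_in (chart_at p) phi p v.
Proof. by rewrite /nabla_in /form_pd -lock form_in_chart. Qed.

Lemma ext_derZ a B (w : ext R m) : ext_der (a *: B) w = a *: ext_der B w.
Proof.
rewrite /ext_der scaler_sumr; apply: eq_bigr => b _; rewrite scaler_sumr.
by apply: eq_bigr => c _; rewrite mxE scalerA.
Qed.

Lemma nabla_in_linear i phi p : smooth_form phi -> dom i p -> linear (nabla_in i phi p).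
Proof.
move=> sphi pi a v w; rewrite /nabla_in conn_form_is_linear ext_derD ext_derZ.
have -> : form_pd i (a *: v + w) phi p = a *: form_pd i v phi p + form_pd i w phi p.
  apply/ffunP => J; rewrite form_pdE [RHS]ext_addE [X in _ = X + _]ext_scaleE
    [X in _ = _ * X + _]form_pdE [X in _ = _ + X]form_pdE.
  rewrite !(pdE _ (sphi i J) pi pi) mulr_sumr -big_split; apply: eq_bigr => b _ /=.
  by rewrite !mxE mulrDl mulrA.
by rewrite opprD addrACA scalerBr.
Qed.

(* The derivative of the Jacobian in [conn_change] cancels the one coming from
   [ext_map (jac i j)], by [ext_is_derive_map]. *)
Lemma nabla_change i j phi p v : smooth_form phi -> dom i p -> dom j p ->
  nabla_in i phi p v = ext_map (jac i j p) (nabla_in j phi p (v *m jac i j p)).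
Proof.
move=> sphi pi pj; set J := jac i j p; set J' := jac j i p.
have JJ' : J *m J' = 1%:M by exact: jacK.
have J'J : J' *m J = 1%:M by exact: jacK.
set dJ : 'M[R]_m := \matrix_(b, c) pd i v (fun q => jac i j q b c) p.
have oij : open (dom i `&` dom j) by apply: openI; exact: dom_open.
have dE : form_pd i v phi p = ext_map J (form_pd j (v *m J) phi p) +
    ext_der (dJ *m J') (ext_map J (form_in phi j p)).
  apply/ffunP => I; rewrite form_pdE.
  have fE q : (dom i `&` dom j) q ->
      fcoef phi i I q = ext_map (jac i j q) (form_in phi j q) I.
    by move=> [qi qj]; rewrite -(form_in_jac phi qi qj).
  rewrite (pd_eq v oij (conj pi pj) pi fE).
  have dA a b : is_derive (crd i p) v (fun x => jac i j (par i x) a b)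
      ((dJ *m J' *m jac i j (par i (crd i p))) a b).
    rewrite crdK // -mulmxA J'J mulmx1 mxE.
    by apply: (pd_is_derive _ (smooth_jac i j a b)).
  have df : ext_is_derive (crd i p) v (fun x => form_in phi j (par i x))
      (form_pd j (v *m J) phi p).
    move=> K; rewrite form_pdE -(pd_chain _ (dom_open j) (sphi j K)) //.
    by apply: (pd_is_derive _ (sphi j K)).
  have := ext_is_derive_map dA df I; rewrite !crdK // => dI.
  by rewrite /pd; have [_ ->] := dI.
rewrite /nabla_in dE linearB /= (ext_map_der _ _ J'J) (form_in_jac phi pi pj) -/J.
rewrite -addrA; congr (_ + _).
have -> : conn_form D i p v = dJ *m J' + J *m conn_form D j p (v *m J) *m J'.
  by rewrite -[LHS]mulmx1 -JJ' mulmxA conn_change // mulmxDl.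
by rewrite ext_derD opprD addrA subrr add0r.
Qed.

Lemma nabla_in_nabla i phi p v : smooth_form phi -> dom i p ->
  nabla_in i phi p (v *m tov p i) = ext_map (ofv p i) (nabla D phi p v).
Proof.
move=> sphi pi; rewrite (nabla_change _ sphi pi (chart_atP p)) nablaE.
by rewrite -mulmxA [X in v *m X](tovK pi) mulmx1.
Qed.

Lemma nabla_scale f phi p v : smooth_fun setT f -> smooth_form phi ->
  nabla D (fun q => f q *: phi q) p v =
    pd (chart_at p) v f p *: phi p + f p *: nabla D phi p v.
Proof.
move=> sf sphi; rewrite !nablaE /nabla_in form_in_scale linearZ /= scalerBr addrA.
congr (_ - _); set i := chart_at p; have pi : dom i p by exact: chart_atP.
apply/ffunP => J; rewrite form_pdE [RHS]ext_addE [X in _ = X + _]ext_scaleE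
  [X in _ = _ + X]ext_scaleE form_pdE.
have -> : fcoef (fun q => f q *: phi q) i J = (fun q => f q * form_in phi i q J).
  by apply/funext => q; rewrite /fcoef form_in_scale ext_scaleE.
have d1 := pd_is_derive v sf I pi; have d2 := pd_is_derive v (sphi i J) pi pi.
have [_ E] := is_derive_mul d1 d2.
by rewrite /pd E crdK // form_in_chart.
Qed.

(* [u q] in the coordinates of the chart [i] *)
Definition hom_in (u : M -> 'cV[R]_m -> TTd R m) i q (xi : 'cV[R]_m) : TTd R m :=
  let w := u q (tov q i *m xi) in (w.1 *m tov q i, ofv q i *m w.2).

Definition smooth_hom (u : M -> 'cV[R]_m -> TTd R m) : Prop :=
  (forall p, linear (u p)) /\
  forall i a b, smooth_fun (dom i) (fun q => (hom_in u i q (ecov R a)).1 0 b) /\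
                smooth_fun (dom i) (fun q => (hom_in u i q (ecov R a)).2 b 0).

(** The operator sums over the basis of [chart_at q]. The sum is a contraction, so by [trace_change]
    it takes the same form in a fixed chart, where smoothness in [q] is visible. *)
Lemma form_in_D_op u phi i q : (forall p, linear (u p)) -> smooth_form phi -> dom i q ->
  form_in (D_op D u phi) i q =
    \sum_a cl_prod (hom_in u i q (ecov R a)) (nabla_in i phi q (evec R a)).
Proof.
move=> lu sphi qi.
pose F (xi : 'cV[R]_m) (X : 'rV[R]_m) := cl_prod (hom_in u i q xi) (nabla_in i phi q X).
have Fl X : linear (F^~ X).
  move=> a x y; rewrite /F -!/(cl_prodr _ _) -linearP; congr cl_prodr.
  rewrite /hom_in linearP lu; congr pair; rewrite /= ?mulmxDl ?mulmxDr.
    by rewrite scalemxAl.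
  by rewrite scalemxAr.
have Fr xi : linear (F xi).
  by move=> a X Y; rewrite /F (nabla_in_linear sphi qi) linearP.
rewrite -(trace_change Fl Fr (ofvK qi)) /form_in /D_op linear_sum.
apply: eq_bigr => a _; rewrite /= (ext_map_cl_prod _ _ (tovK qi)).
by rewrite /F nabla_in_nabla // /hom_in mulmxA tovK // mul1mx.
Qed.

Lemma D_op_smooth u phi : smooth_hom u -> smooth_form phi -> smooth_form (D_op D u phi).
Proof.
move=> [lu su] sphi i J; have oi := dom_open i; have hA := smooth_fun_fun_alg oi.
apply: (smooth_fun_eq (f := fun q =>
   (\sum_a cl_prod (hom_in u i q (ecov R a)) (nabla_in i phi q (evec R a))) J)) => //.
  by move=> q qi; rewrite form_in_D_op.
apply: (alg_ext_sum hA) => a _; apply: (alg_cl_prod hA).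
- by move=> b; have [] := su i a b.
- by move=> b; have [] := su i a b.
move=> K; have -> : (fun q => nabla_in i phi q (evec R a) K) = (fun q =>
    pd i (evec R a) (fcoef phi i K) q -
    ext_der (conn_form D i q (evec R a)) (form_in phi i q) K).
  by apply/funext => q; rewrite [LHS]ext_subE [X in X - _]form_pdE.
apply: (alg_sub hA).
  by have := smooth_pd i (evec R a) oi (sphi i K); rewrite setIid.
apply: (alg_ext_der hA) => [b c|]; last exact: sphi.
have -> : (fun q => conn_form D i q (evec R a) b c) =
    (fun q => \sum_l evec R a 0 l * chris D i q l b c).
  by apply/funext => q; rewrite summxE; apply: eq_bigr => l _; rewrite mxE.
apply: (alg_sum hA) => l _.
by apply: (alg_mul hA); [exact: alg_cst|exact: chris_smooth].
Qed.

Lemma D_op_scale u f phi p : (forall p, linear (u p)) -> smooth_fun setT f ->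
  smooth_form phi ->
  D_op D u (fun q => f q *: phi q) p =
    cl_prod (u p (differential f p)) (phi p) + f p *: D_op D u phi p.
Proof.
move=> lu sf sphi; rewrite /D_op scaler_sumr.
have -> : cl_prod (u p (differential f p)) (phi p) =
   \sum_a pd (chart_at p) (evec R a) f p *: cl_prod (u p (ecov R a)) (phi p).
  rewrite (cov_sum_delta (differential f p)) (lin_sumZ _ _ _ (lu p)).
  rewrite -/(cl_prodr _ _) (lin_sumZ _ _ _ (cl_prodr_is_linear (phi p))).
  by apply: eq_bigr => a _; rewrite mxE.
rewrite -big_split; apply: eq_bigr => a _.
by rewrite nabla_scale // linearD !linearZ.
Qed.

Lemma D_op_linear u (a : R) phi psi : smooth_form phi -> smooth_form psi ->
  D_op D u (fun q => a *: phi q + psi q) = fun q => a *: D_op D u phi q + D_op D u psi q.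
Proof.
move=> sphi spsi; apply/funext => p; rewrite /D_op scaler_sumr -big_split.
apply: eq_bigr => b _ /=; rewrite -cl_prod_is_linear; congr (cl_prod _ _).
set i := chart_at p; have pi : dom i p by exact: chart_atP.
rewrite !nablaE /nabla_in -/i.
have E q : form_in (fun q => a *: phi q + psi q) i q = a *: form_in phi i q + form_in psi i q.
  by rewrite /form_in linearP.
rewrite E linearP /= scalerBr addrACA -opprD; congr (_ - _).
apply/ffunP => J; rewrite form_pdE [RHS]ext_addE [X in _ = X + _]ext_scaleE
    [X in _ = _ * X + _]form_pdE [X in _ = _ + X]form_pdE.
have -> : fcoef (fun q => a *: phi q + psi q) i J =
    (fun q => a * form_in phi i q J + form_in psi i q J).
  by apply/funext => q; rewrite /fcoef E ext_addE ext_scaleE.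
have d1 := pd_is_derive (evec R b) (sphi i J) pi pi.
have d2 := pd_is_derive (evec R b) (spsi i J) pi pi.
have [_] := is_deriveD (is_derive_mul (is_derive_cst a (crd i p) (evec R b)) d1) d2.
by rewrite mul0r add0r.
Qed.

End Connection.

(** * Differential operators and their symbols *)

Section DifferentialOperators.
Variables (R : realType) (m : nat) (M : manifold R m).
Implicit Types (p q : M) (f h : M -> R) (phi psi : M -> ext R m) (A B T : operator M).

Definition comm_op T f : operator M :=
  fun phi p => T (fun q => f q *: phi q) p - f p *: T phi p.

Definition form_op T :=
  (forall phi, smooth_form phi -> smooth_form (T phi)) /\
  (forall (a : R) phi psi, smooth_form phi -> smooth_form psi ->
     T (fun p => a *: phi p + psi p) = fun p => a *: T phi p + T psi p).

Lemma diffop0E T : diffop 0 T <-> form_op T /\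
  forall f, smooth_fun setT f -> forall phi, smooth_form phi -> comm_op T f phi = fun=> 0.
Proof. by split=> [[h1 [h2 h3]]|[[h1 h2] h3]]. Qed.

Lemma diffopSE k T : diffop k.+1 T <-> form_op T /\
  forall f, smooth_fun setT f -> diffop k (comm_op T f).
Proof. by split=> [[h1 [h2 h3]]|[[h1 h2] h3]]. Qed.

Lemma diffop_form_op k T : diffop k T -> form_op T.
Proof. by case: k => [/diffop0E[]|k /diffopSE[]]. Qed.

Lemma form_op_sub (T T' : operator M) : form_op T -> form_op T' ->
  form_op (fun phi p => T phi p - T' phi p).
Proof.
move=> [sT lT] [sT' lT']; split=> [phi sphi|a phi psi sphi spsi].
  have := smooth_formP (-1) (sT' _ sphi) (sT _ sphi).
  by congr smooth_form; apply/funext => p; rewrite scaleN1r addrC.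
apply/funext => p; rewrite lT // lT' //=.
by rewrite scalerBr opprD addrACA.
Qed.

Lemma form_op_scale f T : smooth_fun setT f -> form_op T ->
  form_op (fun phi p => f p *: T phi p).
Proof.
move=> sf [sT lT]; split=> [phi sphi|a phi psi sphi spsi].
  by apply: smooth_form_scale => //; exact: sT.
by apply/funext => p; rewrite lT // scalerDr !scalerA mulrC.
Qed.

Lemma form_op_comp A B : form_op A -> form_op B -> form_op (fun phi => A (B phi)).
Proof.
move=> [sA lA] [sB lB]; split=> [phi /sB/sA //|a phi psi sphi spsi].
by rewrite lB // lA //; exact: sB.
Qed.

Lemma form_op_mul f : smooth_fun setT f -> form_op (fun phi p => f p *: phi p).
Proof. by move=> sf; apply: (form_op_scale sf); split. Qed.

Lemma form_op_comm T f : smooth_fun setT f -> form_op T -> form_op (comm_op T f).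
Proof.
move=> sf oT; apply: form_op_sub; last exact: form_op_scale.
exact: (form_op_comp oT (form_op_mul sf)).
Qed.

Lemma form_op_eq T T' : (forall phi, smooth_form phi -> T phi = T' phi) ->
  form_op T -> form_op T'.
Proof.
move=> TT' [sT lT]; split=> [phi sphi|a phi psi sphi spsi].
  by rewrite -TT' //; exact: sT.
by rewrite -!TT' ?lT //; exact: smooth_formP.
Qed.

Lemma form_op0 T : form_op T -> T (fun=> 0) = fun=> 0.
Proof.
move=> [_ lT]; have s0 : smooth_form (fun _ : M => 0 : ext R m).
  move=> i J; have -> : (fun q : M => form_in (fun=> 0) i q J) = fun=> 0.
    by apply/funext => q; rewrite /form_in linear0 ffunE.
  exact: (alg_cst (smooth_fun_fun_alg (dom_open i))).
have := lT (-1) _ _ s0 s0.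
have -> : (fun _ : M => -1 *: 0 + 0 : ext R m) = fun=> 0.
  by apply/funext => q; rewrite scaler0 addr0.
by move=> E; rewrite {1}E; apply/funext => p; rewrite scaleN1r addNr.
Qed.

(** Linearity and the Leibniz rule hold only on smooth forms, so operators have to be compared there
    alone. *)
Lemma diffop_eq k T T' : (forall phi, smooth_form phi -> T phi = T' phi) ->
  diffop k T -> diffop k T'.
Proof.
elim: k T T' => [|k IH] T T' TT'.
  move=> /diffop0E[oT cT]; apply/diffop0E; split; first exact: form_op_eq oT.
  move=> f sf phi sphi; rewrite -(cT f sf phi sphi) /comm_op -!TT' //.
  exact: smooth_form_scale.
move=> /diffopSE[oT cT]; apply/diffopSE; split; first exact: form_op_eq oT.
move=> f sf; apply: IH (cT f sf) => phi sphi; rewrite /comm_op !TT' //.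
exact: smooth_form_scale.
Qed.

Lemma diffop_zero k : diffop k (fun (_ : M -> ext R m) (_ : M) => 0 : ext R m).
Proof.
have s0 : form_op (fun (_ : M -> ext R m) (_ : M) => 0 : ext R m).
  have := form_op_scale (alg_cst (smooth_fun_fun_alg openT) 0)
    (form_op_mul (alg_cst (smooth_fun_fun_alg openT) 0)).
  by apply: form_op_eq => phi _; apply/funext => p; rewrite scale0r.
elim: k => [|k IH].
  by apply/diffop0E; split=> // f _ phi _; apply/funext => p; rewrite /comm_op scaler0 subr0.
apply/diffopSE; split=> // f _; apply: diffop_eq IH => phi _.
by apply/funext => p; rewrite /comm_op scaler0 subr0.
Qed.

Lemma form_op_add (T T' : operator M) : form_op T -> form_op T' ->
  form_op (fun phi p => T phi p + T' phi p).
Proof.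
move=> [sT lT] [sT' lT']; split=> [phi sphi|a phi psi sphi spsi].
  have := smooth_formP 1 (sT _ sphi) (sT' _ sphi).
  by congr smooth_form; apply/funext => p; rewrite scale1r.
by apply/funext => p; rewrite lT // lT' //= scalerDr addrACA.
Qed.

Lemma diffop_add k A B : diffop k A -> diffop k B ->
  diffop k (fun phi p => A phi p + B phi p).
Proof.
elim: k A B => [|k IH] A B.
  move=> /diffop0E[oA cA] /diffop0E[oB cB]; apply/diffop0E; split.
    exact: form_op_add.
  move=> f sf phi sphi; apply/funext => p; rewrite /comm_op scalerDr opprD addrACA.
  have := congr1 (@^~ p) (cA f sf phi sphi); rewrite /comm_op => ->.
  by have := congr1 (@^~ p) (cB f sf phi sphi); rewrite /comm_op => ->; rewrite addr0.
move=> /diffopSE[oA cA] /diffopSE[oB cB]; apply/diffopSE; split.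
  exact: form_op_add.
move=> f sf; apply: diffop_eq (IH _ _ (cA f sf) (cB f sf)) => phi sphi.
by apply/funext => p; rewrite /comm_op scalerDr opprD addrACA.
Qed.

Lemma comm_op_comp A B f phi : form_op A -> form_op B -> smooth_fun setT f ->
  smooth_form phi ->
  comm_op (fun phi => A (B phi)) f phi =
  fun p => A (comm_op B f phi) p + comm_op A f (B phi) p.
Proof.
move=> [sA lA] oB sf sphi; apply/funext => p; rewrite [LHS]/comm_op.
(* The factor 1 brings the sum into the shape in which [form_op] states linearity. *)
have -> : B (fun q => f q *: phi q) = fun q => 1 *: comm_op B f phi q + f q *: B phi q.
  by apply/funext => q; rewrite scale1r /comm_op subrK.
rewrite lA; last 2 first.
- exact: (form_op_comm sf oB).1.
- by apply: smooth_form_scale => //; exact: oB.1.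
by rewrite scale1r -addrA.
Qed.

(** Induction on the total order: in [AB, f] = A [B, f] + [A, f] B each term has total order one
    less, or is zero when the factor commuted with [f] has order 0. *)
Lemma diffop_comp k l A B : diffop k A -> diffop l B ->
  diffop (k + l) (fun phi => A (B phi)).
Proof.
move: (erefl (k + l)%N); move: {2 3}(k + l)%N => r; elim: r k l A B => [|r IH] k l A B.
  move=> /eqP; rewrite addn_eq0 => /andP[/eqP-> /eqP->] hA hB.
  have oA := diffop_form_op hA; have oB := diffop_form_op hB.
  move: hA hB => /diffop0E[_ cA] /diffop0E[_ cB]; apply/diffop0E; split.
    exact: form_op_comp.
  move=> f sf phi sphi; rewrite comm_op_comp // (cB f sf) // (cA f sf); last exact: oB.1.
  by rewrite form_op0 //; apply/funext => p; rewrite addr0.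
move=> klr hA hB; have oA := diffop_form_op hA; have oB := diffop_form_op hB.
apply/diffopSE; split; first exact: form_op_comp.
move=> f sf; have h1 : diffop r (fun phi => A (comm_op B f phi)).
  case: l klr hB => [|l] klr hB; last first.
    move: klr; rewrite addnS => -[klr].
    by apply: (IH _ _ _ _ klr) => //; have [_ cB] := (diffopSE _ _).1 hB; exact: cB.
  have [_ cB] := (diffop0E _).1 hB.
  apply: diffop_eq (diffop_zero r) => phi sphi; rewrite cB //.
  by rewrite form_op0.
have h2 : diffop r (fun phi => comm_op A f (B phi)).
  case: k klr hA {h1} => [|k] klr hA; last first.
    move: klr; rewrite addSn => -[klr].
    by apply: (IH _ _ _ _ klr) => //; have [_ cA] := (diffopSE _ _).1 hA; exact: cA.
  have [_ cA] := (diffop0E _).1 hA.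
  by apply: diffop_eq (diffop_zero r) => phi sphi; rewrite cA //; exact: oB.1.
by apply: diffop_eq (diffop_add h1 h2) => phi sphi; rewrite [RHS]comm_op_comp //.
Qed.

Lemma diffop_scale k f A : smooth_fun setT f -> diffop k A ->
  diffop k (fun phi p => f p *: A phi p).
Proof.
move=> sf hA; have m0 : diffop 0 (fun phi p => f p *: phi p).
  apply/diffop0E; split; first exact: form_op_mul.
  move=> h sh phi sphi; apply/funext => p.
  by rewrite /comm_op !scalerA mulrC subrr.
exact: (diffop_comp m0 hA).
Qed.

Lemma diffop_D_op (D : connection M) u : smooth_hom u -> diffop 1 (D_op D u).
Proof.
move=> su; have oD : form_op (D_op D u).
  by split=> [phi|a phi psi]; [exact: D_op_smooth|exact: D_op_linear].
apply/diffopSE; split=> // f sf; apply/diffop0E; split; first exact: form_op_comm.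
have E phi p : smooth_form phi ->
    comm_op (D_op D u) f phi p = cl_prod (u p (differential f p)) (phi p).
  by move=> sphi; rewrite /comm_op D_op_scale // ?addrK //; case: su.
move=> h sh phi sphi; apply/funext => p.
rewrite -[LHS]/(comm_op (D_op D u) f (fun q => h q *: phi q) p -
  h p *: comm_op (D_op D u) f phi p).
rewrite (E _ _ sphi) (E _ _ (smooth_form_scale sh sphi)).
by rewrite linearZ subrr.
Qed.

(** The set from which [xget] chooses is inhabited, as some [h] and [s] have the prescribed data at
    [p], and by hypothesis it contains no value but [y]. *)
Lemma symbolE k T p xi w (y : ext R m) :
  (forall h s, smooth_fun setT h -> smooth_form s -> differential h p = xi -> s p = w ->
     T (fun q => ((k`!)%:R^-1 * (h q - h p) ^+ k) *: s q) p = y) ->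
  symbol k T p xi w = y.
Proof.
move=> Ty; rewrite /symbol; have [h [sh _ dh]] := function_exists p xi.
have [s [ss sp]] := form_exists p w.
case: xgetP => [z _ [h' [s' [sh' ss' dh' sp' ->]]]|/(_ y)]; first exact: Ty.
by case; exists h, s; split=> //; rewrite (Ty h s).
Qed.

Lemma symbol0E (T : M -> ext R m -> ext R m) p xi w :
  symbol 0 (fun phi p => T p (phi p)) p xi w = T p w.
Proof.
apply: symbolE => h s _ _ _ <-.
by rewrite fact0 invr1 expr0 mulr1 scale1r.
Qed.

Lemma differential_sub h (c : R) p : smooth_fun setT h ->
  differential (fun q => h q - c) p = differential h p.
Proof.
move=> sh; apply/matrixP => a b; rewrite !mxE.
have d1 := pd_is_derive (evec R a) sh I (chart_atP p).
have [_] := is_deriveB d1 (is_derive_cst c (crd (chart_at p) p) (evec R a)).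
by rewrite subr0.
Qed.

Lemma differential_mul f h p : smooth_fun setT f -> smooth_fun setT h ->
  differential (fun q => f q * h q) p = h p *: differential f p + f p *: differential h p.
Proof.
move=> sf sh; apply/matrixP => a b; rewrite !mxE.
have d1 := pd_is_derive (evec R a) sf I (chart_atP p).
have d2 := pd_is_derive (evec R a) sh I (chart_atP p).
have [_] := is_derive_mul d1 d2; rewrite crdK; last exact: chart_atP.
by rewrite [h p * _]mulrC.
Qed.

Section SymbolD.
Variables (D : connection M).

Lemma symbol1E u p xi w : (forall p, linear (u p)) ->
  symbol 1 (D_op D u) p xi w = cl_prod (u p xi) w.
Proof.
move=> lu; apply: symbolE => h s sh ss dh sp.
have hA := smooth_fun_fun_alg (M := M) openT.
have -> : (fun q => ((1`!)%:R^-1 * (h q - h p) ^+ 1) *: s q) = (fun q => (h q - h p) *: s q).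
  by apply/funext => q; rewrite invr1 mul1r expr1.
rewrite D_op_scale //; last by apply: (alg_sub hA) => //; exact: alg_cst.
by rewrite subrr scale0r addr0 differential_sub // dh sp.
Qed.

(** With g = h - h(p) and f = g^2/2 one has df = g dh, so the inner operator gives g times a
    Clifford product plus f times a form. At [p] both g and f, and also df, vanish, so the outer
    operator only sees dg = dh. *)
Lemma D_op2_square u1 u2 h s p : (forall p, linear (u1 p)) -> smooth_hom u2 ->
  smooth_fun setT h -> smooth_form s ->
  D_op D u1 (D_op D u2 (fun q => ((2`!)%:R^-1 * (h q - h p) ^+ 2) *: s q)) p =
  cl_prod (u1 p (differential h p)) (cl_prod (u2 p (differential h p)) (s p)).
Proof.
move=> lu1 su2 sh ss; have [lu2 _] := su2.
have hA := smooth_fun_fun_alg (M := M) openT.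
pose g q := h q - h p.
have sg : smooth_fun setT g by apply: (alg_sub hA) => //; exact: alg_cst.
pose f q := (2`!)%:R^-1 * g q ^+ 2.
have sf : smooth_fun setT f by exact: (alg_mul hA (alg_cst hA _) (alg_exp hA 2 sg)).
have oD2 : form_op (D_op D u2) by apply: diffop_form_op (diffop_D_op D su2).
(* The Clifford product by the image of [dh], introduced as a commutator because its smoothness is
   then known. *)
pose N := comm_op (D_op D u2) h s.
have NE q : N q = cl_prod (u2 q (differential h q)) (s q).
  by rewrite /N /comm_op D_op_scale // addrK.
have sN : smooth_form N by apply: (form_op_comm sh oD2).1.
have sD2s : smooth_form (D_op D u2 s) by exact: oD2.1.
have df q : differential f q = g q *: differential h q.
  have -> : f = fun q => (2`!)%:R^-1 * (g q * g q) by apply/funext => x; rewrite /f expr2.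
  rewrite differential_mul; [|exact: (alg_cst hA _)|exact: (alg_mul hA sg sg)].
  rewrite differential_mul // differential_sub //.
  have -> : differential (fun=> (2`!)%:R^-1) q = 0 :> 'cV[R]_m.
    apply/matrixP => a b; rewrite !mxE.
    by have [_] := is_derive_cst ((2`!)%:R^-1 : R) (crd (chart_at q) q) (evec R a).
  rewrite scaler0 add0r -mulr2n scalerMnr -scaler_nat !scalerA.
  by rewrite mulrAC mulVf ?mul1r ?pnatr_eq0.
have -> : D_op D u2 (fun q => f q *: s q) =
    fun q => 1 *: (g q *: N q) + f q *: D_op D u2 s q.
  apply/funext => q; rewrite scale1r D_op_scale // df NE.
  have -> : u2 q (g q *: differential h q) = g q *: u2 q (differential h q).
    exact: linZ.
  by rewrite -/(cl_prodr _ _) linearZ.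
rewrite D_op_linear; last 2 first.
- exact: smooth_form_scale.
- exact: smooth_form_scale.
rewrite scale1r !D_op_scale // df /f /g subrr expr0n mulr0 !scale0r !addr0.
rewrite differential_sub // NE.
by rewrite (lin0 (lu1 p)) -[X in _ + X]/(cl_prodr _ 0) linear0 addr0.
Qed.

End SymbolD.
End DifferentialOperators.

(** * The spin action on forms *)

Lemma half_double (R : realType) (V : lmodType R) (z : V) : 2^-1 *: (z + z) = z.
Proof. by rewrite -[z]scale1r -scalerDl scalerA; congr (_ *: _); field. Qed.

(** The Jacobi identity: bracketing with [c] is a derivation of the commutator. *)
Lemma commutator_derivation (A : pzRingType) (c a b : A) :
  c * (a * b - b * a) - (a * b - b * a) * c =
  ((c * a - a * c) * b - b * (c * a - a * c)) +
  (a * (c * b - b * c) - (c * b - b * c) * a).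
Proof.
rewrite !mulrBl !mulrBr !mulrA !opprB [RHS]addrACA !subrKA addrACA [RHS]addrACA.
by congr (_ + _); rewrite addrC.
Qed.

Section CliffordAction.
Variables (R : realType) (m : nat).
Local Notation W := (TTd R m).
Implicit Types (v w : W) (x y : W -> W) (phi : ext R m).

(** Applied to the form 1, a Clifford product returns its covector part; once that is zero, applying
    it to e_j returns the components of the vector part. *)
Lemma cl_prod_inj v w : (forall phi, cl_prod v phi = cl_prod w phi) -> v = w.
Proof.
move=> vw; apply/eqP; rewrite -subr_eq0.
have cz0 phi : cl_prod (v - w) phi = 0.
  rewrite -[LHS]/(cl_prodr phi (v - w)) linearB /= /cl_prodr.
  by apply/eqP; rewrite subr_eq0 vw.
move: (v - w) cz0 => z cz.
have z2 : z.2 = 0.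
  apply/matrixP => j a; rewrite [a]ord1 [RHS]mxE.
  have := cz (ext_one R m); rewrite /cl_prod contr_one subr0 => /ffunP/(_ [set j]%SET).
  rewrite wedge_sumE sum_ffunE (bigD1 j) //= big1 => [|i ij].
    rewrite ext_scaleE wedge_deltaE !inE eqxx ffunE finset.setDv eqxx mulr1 addr0 ffunE.
    by move=> /eqP; rewrite mulf_eq0 signr_eq0 orbF => /eqP.
  by rewrite ext_scaleE wedge_deltaE !inE (negbTE ij) mulr0.
have z1 : z.1 = 0.
  apply/rowP => j; rewrite [RHS]mxE.
  have := cz (wedge (delta_mx j 0) (ext_one R m)); rewrite /cl_prod z2.
  rewrite -[wedge 0 _]/(wedger _ 0) linear0 contr_wedge contr_one linear0 subr0 sub0r.
  rewrite -colE mxE => /ffunP/(_ finset.set0); rewrite ffunE ext_scaleE !ffunE eqxx mulr1.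
  by move=> /eqP; rewrite oppr_eq0 => /eqP.
by apply/eqP; rewrite [z]surjective_pairing z1 z2.
Qed.

Lemma Qform_sym v w : Qform v w = Qform w v.
Proof. by rewrite /Qform addrC. Qed.

Lemma QformP v (a : R) w z : Qform v (a *: w + z) = a * Qform v w + Qform v z.
Proof.
rewrite /Qform.
have -> : (a *: w + z).1 = a *: w.1 + z.1 by [].
have -> : (a *: w + z).2 = a *: w.2 + z.2 by [].
by rewrite mulmxDr mulmxDl -scalemxAr -scalemxAl !mxE; ring.
Qed.

Lemma QformDr v w z : Qform v (w + z) = Qform v w + Qform v z.
Proof. by rewrite -[w]scale1r QformP scale1r mul1r. Qed.

Lemma QformDl v w z : Qform (v + w) z = Qform v z + Qform w z.
Proof. by rewrite !(Qform_sym _ z) QformDr. Qed.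

Definition ev a : W := (delta_mx 0 a, 0).
Definition ec a : W := (0, delta_mx a 0).

Lemma Qform_ev w a : Qform (ev a) w = 2^-1 * w.2 a 0.
Proof. by rewrite /Qform /ev /= mulmx0 [X in _ + X]mxE addr0 -rowE mxE. Qed.

Lemma Qform_ec w a : Qform (ec a) w = 2^-1 * w.1 0 a.
Proof. by rewrite /Qform /ec /= mul0mx [X in X + _]mxE add0r -colE mxE. Qed.

Lemma W_sumE w : w = \sum_a (w.1 0 a *: ev a + w.2 a 0 *: ec a).
Proof.
rewrite big_split /=; case: w => X xi.
have l1 : linear (fun Y : 'rV[R]_m => (Y, 0) : W).
  by move=> c Y Z; congr pair => /=; rewrite ?scaler0 ?addr0.
have l2 : linear (fun eta : 'cV[R]_m => (0, eta) : W).
  by move=> c Y Z; congr pair => /=; rewrite ?scaler0 ?addr0.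
rewrite -(lin_sumZ _ _ _ l1) -(lin_sumZ _ _ _ l2) /= -row_sum_delta -cov_sum_delta.
by congr pair; rewrite /= ?addr0 ?add0r.
Qed.

(** The action of [casg x] on forms, expressed by [cl_prod] alone, so that smoothness and changes of
    chart can be studied without the Clifford algebra. *)
Definition cas x phi : ext R m :=
  2^-1 *: \sum_a (cl_prod (ev a) (cl_prod (x (ec a)) phi) +
                  cl_prod (ec a) (cl_prod (x (ev a)) phi)).

Variables (Cl : clifford_algebra (@Qform R m)) (act : Cl -> ext R m -> ext R m).
Hypothesis hact : clifford_module (@cl_prod R m) act.
Local Notation gen := (cl_gen Cl).
Local Notation br y z := (y * z - z * y).

Lemma gen_anti v w : gen v * gen w + gen w * gen v = (- 2 * Qform v w)%:A.
Proof.
have := cl_sq Cl (v + w).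
rewrite linearD mulrDl !mulrDr !cl_sq => E.
apply: (addrI ((- Qform v v)%:A)); apply: (addIr ((- Qform w w)%:A)).
rewrite [LHS](_ : _ = (- Qform (v + w) (v + w))%:A); last by rewrite -E !addrA.
rewrite -!scalerDl; congr (_%:A); rewrite QformDr !QformDl.
by rewrite (Qform_sym w v); ring.
Qed.

Lemma gen_br v w u : br (gen v * gen w) (gen u) =
  (2 * Qform v u) *: gen w - (2 * Qform w u) *: gen v.
Proof.
have -> : br (gen v * gen w) (gen u) =
    gen v * (gen w * gen u + gen u * gen w) - (gen v * gen u + gen u * gen v) * gen w.
  by rewrite mulrDl mulrDr !mulrA opprD addrA addrK.
rewrite !gen_anti -scalerAl mul1r -scalerAr mulr1 addrC !mulNr !scaleNr opprK.
by [].
Qed.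

(** Injectivity of [W] into the Clifford algebra is read off from its module of forms. *)
Lemma gen_inj v w : gen v = gen w -> v = w.
Proof.
have [_ _ _ _ gE] := hact; move=> vw; apply: cl_prod_inj => phi.
by rewrite -!gE vw.
Qed.

(* The inverse image of [x] under [ad] is [1/4 \sum_i b_i * x (b^i)] for dual bases
   [b_i], [b^i] of [W]; the bases [ev], [ec] have the dual bases [2 ec], [2 ev]. *)
Definition casg x : Cl :=
  2^-1 *: \sum_a (gen (ev a) * gen (x (ec a)) + gen (ec a) * gen (x (ev a))).

Lemma act_casg x phi : act (casg x) phi = cas x phi.
Proof.
have [ly ls a1 aM gE] := hact; rewrite /casg /cas.
rewrite (linZ _ _ (ls phi)); congr (_ *: _).
elim/big_rec2: _ => [|a c e _ <-]; first exact: (lin0 (ls phi)).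
by rewrite !(linD _ _ (ls phi)) !aM !gE.
Qed.

(** A product is half a commutator minus the scalar Q(v,w); skewness of [x] makes the scalars cancel
    in pairs. *)
Lemma casg_spin x : so_form (@Qform R m) x -> spin (casg x).
Proof.
move=> [_ sk].
(* The coefficient 1/4 is the 1/2 of [casg] times the 1/2 relating a product to its commutator. *)
exists (flatten [seq [:: (4^-1 *: ev a, x (ec a)); (4^-1 *: ec a, x (ev a))] | a <- enum 'I_m]).
rewrite big_flatten big_map /casg scaler_sumr big_enum /=; apply: eq_bigr => a _.
rewrite !big_cons big_nil addr0 /= !linearZ /= -!scalerAl -!scalerAr -!scalerBr.
have half v w : gen v * gen w = 2^-1 *: br (gen v) (gen w) + (- Qform v w)%:A.
  have -> : (- Qform v w)%:A = 2^-1 *: (gen v * gen w + gen w * gen v).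
    by rewrite gen_anti scalerA mulrA mulrN mulVf ?pnatr_eq0 // mulN1r.
  by rewrite -scalerDr addrACA [- _ + _]addrC subrr addr0 half_double.
rewrite [X in _ *: (X + _)]half [X in _ *: (_ + X)]half addrACA -scalerDl -opprD.
have -> : Qform (ev a) (x (ec a)) + Qform (ec a) (x (ev a)) = 0.
  by rewrite addrC (Qform_sym (ec a)); exact: sk.
rewrite oppr0 scale0r addr0 -!scalerDr scalerA; congr (_ *: _).
by rewrite -invfM -natrM.
Qed.

(** By [gen_br] and skewness the sum splits into [x] applied to the basis expansion of [w] and the
    basis expansion of [x w]: two copies of [x w], which the factor 1/2 compensates. *)
Lemma casg_br x w : so_form (@Qform R m) x -> br (casg x) (gen w) = gen (x w).
Proof.
move=> [lx sk]; have skE v u : Qform (x v) u = - Qform v (x u).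
  by apply/eqP; rewrite -addr_eq0 sk.
pose F (c : Cl) := br c (gen w).
have lF : linear F.
  by move=> a c e; rewrite /F mulrDl mulrDr -scalerAl -scalerAr scalerBr opprD addrACA.
rewrite -[LHS]/(F (casg x)) /casg (linZ _ _ lF).
have -> : F (\sum_a (gen (ev a) * gen (x (ec a)) + gen (ec a) * gen (x (ev a)))) =
    \sum_a (F (gen (ev a) * gen (x (ec a))) + F (gen (ec a) * gen (x (ev a)))).
  elim/big_rec2: _ => [|a c e _ <-]; first exact: lin0.
  by rewrite !(linD _ _ lF).
rewrite (eq_bigr (fun a => (gen (w.1 0 a *: x (ev a) + w.2 a 0 *: x (ec a))) +
    gen ((x w).1 0 a *: ev a + (x w).2 a 0 *: ec a))); last first.
  move=> a _; rewrite /F !gen_br !skE !Qform_ev !Qform_ec.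
  rewrite ![gen (_ + _)]linearD ![gen (_ *: _)]linearZ /= !mulrN !mulVKf ?pnatr_eq0 //.
  by rewrite !scaleNr !opprK addrACA [X in X + _]addrC.
rewrite big_split /= -!linear_sum /= -W_sumE.
have -> : \sum_a (w.1 0 a *: x (ev a) + w.2 a 0 *: x (ec a)) = x w.
  rewrite {3}(W_sumE w); elim/big_rec2: _ => [|a y z _ ->]; first by rewrite lin0.
  by rewrite (linD _ _ lx) lx (linZ _ _ lx).
by rewrite half_double.
Qed.

(** The operator [x] is computed from the commutators that make up [c], and [casg] of it gives back
    the same commutators. Thus [ad] is injective on [spin]. *)
Lemma spin_casg (c : Cl) x : spin c -> (forall w, br c (gen w) = gen (x w)) -> c = casg x.
Proof.
move=> [s ->] sx.
(* The bracket of [w] with a commutator of generators: each of its two products contributes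
   coefficients 2 Q, hence the 4. *)
pose X u w : W := (4 * Qform u.1 w) *: u.2 - (4 * Qform u.2 w) *: u.1.
have xE w : x w = \sum_(u <- s) X u w.
  apply: gen_inj; rewrite -sx linear_sum mulr_suml mulr_sumr -sumrB.
  apply: eq_bigr => u _; rewrite /X [gen (_ - _)]linearB ![gen (_ *: _)]linearZ /=.
  have -> : br (br (gen u.1) (gen u.2)) (gen w) =
      br (gen u.1 * gen u.2) (gen w) - br (gen u.2 * gen u.1) (gen w).
    by rewrite mulrBl mulrBr !opprD !opprK addrACA.
  have dbl (q : R) (z : Cl) : (4 * q) *: z = (2 * q) *: z + (2 * q) *: z.
    by rewrite -scalerDl; congr (_ *: _); ring.
  by rewrite !gen_br opprB !dbl opprD addrACA.
have -> : casg x = 2^-1 *: \sum_(u <- s) \sum_a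
    (gen (ev a) * gen (X u (ec a)) + gen (ec a) * gen (X u (ev a))).
  rewrite exchange_big /=; congr (_ *: _); apply: eq_bigr => a _.
  by rewrite !xE !linear_sum !mulr_sumr -big_split.
rewrite scaler_sumr; apply: eq_bigr => u _.
rewrite (eq_bigr (fun a => 2 *: (gen (u.1.1 0 a *: ev a + u.1.2 a 0 *: ec a) * gen u.2) -
   2 *: (gen (u.2.1 0 a *: ev a + u.2.2 a 0 *: ec a) * gen u.1))); last first.
  move=> a _; rewrite /X !(Qform_sym _ (ec a)) !(Qform_sym _ (ev a)) !Qform_ev !Qform_ec.
  have quad (e : R) : 4 * (2^-1 * e) = 2 * e by field.
  rewrite !quad ![gen (_ - _)]linearB ![gen (_ + _)]linearD ![gen (_ *: _)]linearZ /=.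
  rewrite !mulrBr ![(_ + _) * gen _]mulrDl -!scalerAr -!scalerAl !scalerDr !scalerA opprD.
  by rewrite addrACA.
rewrite sumrB -!scaler_sumr -!mulr_suml -!linear_sum /= -!W_sumE -scalerBr scalerA.
by rewrite mulVf ?pnatr_eq0 // scale1r.
Qed.

Lemma ad_invE x : so_form (@Qform R m) x -> ad_inv Cl x = casg x.
Proof.
move=> sx; rewrite /ad_inv; case: xgetP => [y _ [sy hy]|/(_ (casg x))].
  exact: spin_casg.
by case; split; [exact: casg_spin|move=> w; exact: casg_br].
Qed.

Lemma act_br x w phi : so_form (@Qform R m) x ->
  cas x (cl_prod w phi) - cl_prod w (cas x phi) = cl_prod (x w) phi.
Proof.
have [ly ls a1 aM gE] := hact; move=> sx; rewrite -!act_casg -!gE -!aM -(casg_br _ sx).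
have -> : br (casg x) (gen w) = (-1) *: (gen w * casg x) + casg x * gen w.
  by rewrite scaleN1r addrC.
by rewrite ls scaleN1r addrC.
Qed.

(** The commutator of [casg x] and [casg y] lies in [spin] and its adjoint action is
    [commutator x y], so [spin_casg] identifies it. *)
Lemma cas_commutator x y phi : so_form (@Qform R m) x -> so_form (@Qform R m) y ->
  cas (commutator x y) phi = cas x (cas y phi) - cas y (cas x phi).
Proof.
have [ly ls a1 aM gE] := hact; move=> sx sy.
have -> : cas (commutator x y) phi = act (br (casg x) (casg y)) phi.
  rewrite -act_casg; congr act; apply/esym; apply: spin_casg.
    have [s ->] := casg_spin sy.
    (* Bracketing with [casg x] acts on a commutator of generators as a derivation, applying [x] to
       one generator at a time. *)
    exists (flatten [seq [:: (x u.1, u.2); (u.1, x u.2)] | u <- s]).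
    rewrite big_flatten big_map mulr_suml mulr_sumr -sumrB /=; apply: eq_bigr => u _.
    rewrite !big_cons big_nil addr0 /= -!(casg_br _ sx).
    exact: commutator_derivation.
  move=> w; rewrite /commutator [gen (_ - _)]linearB /= -(casg_br (y w) sx) -(casg_br (x w) sy).
  by rewrite -(casg_br w sx) -(casg_br w sy) commutator_derivation addrK.
have -> : br (casg x) (casg y) = (-1) *: (casg y * casg x) + casg x * casg y.
  by rewrite scaleN1r addrC.
by rewrite ls scaleN1r addrC !aM !act_casg.
Qed.

Lemma cl_prod_anti v w phi :
  cl_prod v (cl_prod w phi) + cl_prod w (cl_prod v phi) = (- 2 * Qform v w) *: phi.
Proof.
have [ly ls a1 aM gE] := hact; rewrite -!gE -!aM -(linD _ _ (ls phi)) gen_anti.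
by rewrite (linZ _ _ (ls phi)) a1.
Qed.

End CliffordAction.

(** * The map iota in a frame *)

Section FrameAlgebra.
Variables (R : realType) (k n : nat) (hk : (k <= 2)%N).
Local Notation K := 'rV[R]_(kdim k).
Local Notation m := (n * kdim k)%N.
Local Notation V := 'rV[R]_m.
Local Notation W := (TTd R m).
Implicit Types (F G A B : 'M[R]_m) (L : K * K -> K * K) (u v : K * K).

(* [G] is the inverse of the frame [F]; it is a separate argument because
   smoothness is easier to see on the formula [G = g *m F^T] than on [invmx F]. *)
Definition from_frame F G (w : V * V) : W := (w.1 *m F, G *m w.2^T).
Definition to_frame F G (w : W) : V * V := (w.1 *m G, (F *m w.2)^T).

Definition frame_iota0 F G L (w : W) : W := from_frame F G (iota0_V L (to_frame F G w)).
Definition frame_iota1 F G u (xi : 'cV[R]_m) : W := from_frame F G (iota1_V u (F *m xi)^T).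

Lemma Qform_from_frame F G a b : F *m G = 1%:M ->
  Qform (from_frame F G a) (from_frame F G b) = QV a b.
Proof.
move=> FG; rewrite /Qform /QV /from_frame /=.
have E (x y : V) : x *m F *m (G *m y^T) = x *m y^T.
  by rewrite mulmxA -(mulmxA x) FG mulmx1.
by rewrite !E; congr (_ * (_ + _)); exact: dotC.
Qed.

Lemma to_frameK F G w : G *m F = 1%:M -> from_frame F G (to_frame F G w) = w.
Proof.
move=> GF; rewrite /from_frame /to_frame /= trmxK mulmxA GF mul1mx -mulmxA GF mulmx1.
by case: w.
Qed.

Lemma from_frameK F G w : F *m G = 1%:M -> to_frame F G (from_frame F G w) = w.
Proof.
move=> FG; rewrite /from_frame /to_frame /= -mulmxA FG mulmx1 mulmxA FG mul1mx trmxK.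
by case: w.
Qed.

Lemma from_frame_linear F G : linear (from_frame F G).
Proof.
move=> a w z; rewrite /from_frame; congr pair => /=; first by rewrite mulmxDl -scalemxAl.
by rewrite linearD linearZ mulmxDr -scalemxAr.
Qed.

Lemma to_frame_linear F G : linear (to_frame F G).
Proof.
move=> a w z; rewrite /to_frame; congr pair => /=; first by rewrite mulmxDl -scalemxAl.
by rewrite mulmxDr -scalemxAr linearD linearZ.
Qed.

Lemma iota0_V_linear L : linear (iota0_V L : V * V -> V * V).
Proof.
move=> a w z; rewrite /iota0_V; congr pair => /=;
  by rewrite !vmulDl !vmulZl addrACA -scalerDr.
Qed.

Lemma iota1_V_linear u : linear (iota1_V u : V -> V * V).
Proof. by move=> a w z; rewrite /iota1_V; congr pair => /=; rewrite vmulDl vmulZl. Qed.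

Lemma frame_iota0_linear F G L : linear (frame_iota0 F G L).
Proof.
move=> a w z.
by rewrite /frame_iota0 to_frame_linear iota0_V_linear from_frame_linear.
Qed.

Lemma frame_iota1_linear F G u : linear (frame_iota1 F G u).
Proof.
move=> a w z; rewrite /frame_iota1 mulmxDr -scalemxAr linearD linearZ /=.
by rewrite iota1_V_linear from_frame_linear.
Qed.

Lemma frame_iota0_so F G L : F *m G = 1%:M -> G *m F = 1%:M -> su11 L ->
  so_form (@Qform R m) (frame_iota0 F G L).
Proof.
move=> FG GF sL; split; first exact: frame_iota0_linear.
move=> w z; rewrite -{2}(to_frameK w GF) -{1}(to_frameK z GF) !Qform_from_frame //.
exact: iota0_V_skew.
Qed.

Lemma frame_iota0M F G L L' w : F *m G = 1%:M -> su11 L -> su11 L' ->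
  frame_iota0 F G (commutator L L') w =
  commutator (frame_iota0 F G L) (frame_iota0 F G L') w.
Proof.
move=> FG sL sL'; rewrite /commutator /frame_iota0 !from_frameK // -/(commutator L L').
rewrite iota0_VM //; congr pair; rewrite /= ?mulmxBl //.
by rewrite linearB /= mulmxBr.
Qed.

Lemma frame_iota0_iota1 F G L u xi : F *m G = 1%:M -> su11 L ->
  frame_iota0 F G L (frame_iota1 F G u xi) = frame_iota1 F G (L u) xi.
Proof. by move=> FG sL; rewrite /frame_iota0 /frame_iota1 from_frameK // iota0_iota1_V. Qed.

Lemma frame_iota1B F G u v xi :
  frame_iota1 F G (u - v) xi = frame_iota1 F G u xi - frame_iota1 F G v xi.
Proof.
rewrite /frame_iota1 /from_frame /iota1_V; congr pair; rewrite /= vmulBr ?mulmxBl //.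
by rewrite linearB /= mulmxBr.
Qed.

Lemma frame_iota1P F G (a : R) u v xi :
  frame_iota1 F G (a *: u + v) xi = a *: frame_iota1 F G u xi + frame_iota1 F G v xi.
Proof.
rewrite /frame_iota1 /from_frame /iota1_V; congr pair; rewrite /= vmulDr linearZ /=.
  by rewrite mulmxDl -scalemxAl.
by rewrite linearD linearZ /= mulmxDr -scalemxAr.
Qed.

Lemma frame_iota0P F G (a : R) L L' w :
  frame_iota0 F G (fun u => a *: L u + L' u) w =
  a *: frame_iota0 F G L w + frame_iota0 F G L' w.
Proof.
rewrite /frame_iota0 /from_frame /iota0_V /=.
congr pair; rewrite /= !vmulDr !linearZ /= addrACA -scalerDr.
  by rewrite mulmxDl -scalemxAl.
by rewrite linearD linearZ /= mulmxDr -scalemxAr.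
Qed.

Definition frame_norm F (xi : 'cV[R]_m) : R := dot (F *m xi)^T (F *m xi)^T.

Lemma Qform_frame_iota1 F G u v xi : F *m G = 1%:M ->
  Qform (frame_iota1 F G u xi) (frame_iota1 F G v xi) = frame_norm F xi * qcheck u v.
Proof. by move=> FG; rewrite Qform_from_frame // QV_iota1. Qed.

Lemma frame_iota1_inj F G u v : (0 < n)%N -> F *m G = 1%:M ->
  (forall xi, frame_iota1 F G u xi = frame_iota1 F G v xi) -> u = v.
Proof.
move=> n0 FG uv.
have kd : (0 < kdim k)%N by elim: (k) => //= l IH; rewrite addn_gt0 IH.
have nk : (0 < m)%N by rewrite muln_gt0 n0.
pose y : V := delta_mx 0 (Ordinal nk).
have y0 : y != 0.
  apply/eqP => /rowP/(_ (Ordinal nk)); rewrite !mxE !eqxx => /eqP.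
  by rewrite oner_eq0.
have := congr1 (to_frame F G) (uv (G *m y^T)); rewrite !from_frameK // mulmxA FG mul1mx.
rewrite trmxK => -[/(vmul_inj hk y0) E1 /(vmul_inj hk y0) E2].
by case: u v E1 E2 {uv} => u1 u2 [v1 v2] /= -> ->.
Qed.

(** By [frame_iota0_iota1] the operator determines [frame_iota1] of [L u] for every [u], hence [L u]
    itself. *)
Lemma frame_iota0_inj F G L L' : (0 < n)%N -> F *m G = 1%:M -> su11 L -> su11 L' ->
  (forall w, frame_iota0 F G L w = frame_iota0 F G L' w) -> L = L'.
Proof.
move=> n0 FG sL sL' LL'; apply/funext => u; apply: (@frame_iota1_inj F G) => // xi.
by rewrite -!frame_iota0_iota1.
Qed.

(** Equivariance of [iota] under the structure group; as [phi] is orthogonal, the inverse of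
    [phi *m F] is [G *m phi^T]. *)
Lemma frame_iota0_change F G phi t L L' w :
  phi *m phi^T = 1%:M -> kone R k *m t = kone R k -> is_theta phi t ->
  (forall u, L (Phi t u) = Phi t (L' u)) ->
  frame_iota0 F G L w = frame_iota0 (phi *m F) (G *m phi^T) L' w.
Proof.
move=> pp t1 ht LL'; have pp' := mulmx1C pp.
rewrite /frame_iota0.
have -> : to_frame F G w = phiV phi (to_frame (phi *m F) (G *m phi^T) w).
  rewrite /to_frame /phiV /= -!mulmxA pp' mulmx1; congr pair.
  by rewrite !trmx_mul -!mulmxA pp' mulmx1.
rewrite (iota0_V_phi _ t1 ht LL') /from_frame /phiV /=.
by rewrite [(_ *m phi)^T]trmx_mul !mulmxA.
Qed.

Lemma frame_iota1_change F G phi t u' xi :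
  phi *m phi^T = 1%:M -> is_theta phi t ->
  frame_iota1 F G (Phi t u') xi = frame_iota1 (phi *m F) (G *m phi^T) u' xi.
Proof.
move=> pp ht; have pp' := mulmx1C pp.
rewrite /frame_iota1.
have -> : (F *m xi)^T = (phi *m F *m xi)^T *m phi.
  by rewrite !trmx_mul -!mulmxA pp' mulmx1.
rewrite (iota1_V_phi _ _ ht) /from_frame /phiV /=.
by rewrite [(_ *m phi)^T]trmx_mul !mulmxA.
Qed.

Section Smoothness.
Variables (T : Type) (S : set (T -> R)) (hS : fun_alg S).

(** A bilinear map is expanded in bases: its coordinates are polynomials with constant
    coefficients. *)
Lemma alg_vmul (x : T -> V) (a : T -> K) : (forall j, S (fun t => x t 0 j)) ->
  (forall b, S (fun t => a t 0 b)) -> forall j, S (fun t => vmul (x t) (a t) 0 j).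
Proof.
move=> Sx Sa j.
have -> : (fun t => vmul (x t) (a t) 0 j) = (fun t => \sum_i \sum_b
    x t 0 i * (a t 0 b * vmul (delta_mx 0 i) (delta_mx 0 b) 0 j)).
  apply/funext => t; rewrite {1}(row_sum_delta (x t)).
  rewrite -/(vmulr _ _) linear_sum summxE; apply: eq_bigr => i _.
  rewrite linearZ /= mxE /vmulr {1}(row_sum_delta (a t)) linear_sum summxE mulr_sumr.
  by apply: eq_bigr => b _; rewrite linearZ mxE.
apply: (alg_sum hS) => i _; apply: (alg_sum hS) => b _; apply: (alg_mul hS) => //.
by apply: (alg_mul hS) => //; exact: alg_cst.
Qed.

Variables (F G : T -> 'M[R]_m).
Hypotheses (SF : forall i j, S (fun t => F t i j)) (SG : forall i j, S (fun t => G t i j)).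

Lemma alg_from_frame (w : T -> V * V) :
  (forall j, S (fun t => (w t).1 0 j)) -> (forall j, S (fun t => (w t).2 0 j)) ->
  forall j, S (fun t => (from_frame (F t) (G t) (w t)).1 0 j) /\
            S (fun t => (from_frame (F t) (G t) (w t)).2 j 0).
Proof.
move=> S1 S2 j; split; rewrite /from_frame /=.
  by apply: (alg_mulmx hS) => // i l; rewrite [i]ord1.
by apply: (alg_mulmx hS) => // i l; rewrite [l]ord1; under eq_fun do rewrite mxE.
Qed.

Lemma alg_frame_iota1 (u : T -> K * K) (xi : T -> 'cV[R]_m) :
  (forall b, S (fun t => (u t).1 0 b)) -> (forall b, S (fun t => (u t).2 0 b)) ->
  (forall j, S (fun t => xi t j 0)) ->
  forall j, S (fun t => (frame_iota1 (F t) (G t) (u t) (xi t)).1 0 j) /\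
            S (fun t => (frame_iota1 (F t) (G t) (u t) (xi t)).2 j 0).
Proof.
move=> S1 S2 Sx.
have Sy j : S (fun t => (F t *m xi t)^T 0 j).
  under eq_fun do rewrite mxE; apply: (alg_mulmx hS) => // i l; by rewrite [l]ord1.
by apply: alg_from_frame => j; exact: alg_vmul.
Qed.

Lemma alg_frame_iota0 (L : T -> K * K -> K * K) (w : T -> W) :
  (forall u b, S (fun t => (L t u).1 0 b) /\ S (fun t => (L t u).2 0 b)) ->
  (forall j, S (fun t => (w t).1 0 j)) -> (forall j, S (fun t => (w t).2 j 0)) ->
  forall j, S (fun t => (frame_iota0 (F t) (G t) (L t) (w t)).1 0 j) /\
            S (fun t => (frame_iota0 (F t) (G t) (L t) (w t)).2 j 0).
Proof.
move=> SL S1 S2.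
have Sy1 j : S (fun t => ((w t).1 *m G t) 0 j).
  by apply: (alg_mulmx hS) => // i l; rewrite [i]ord1.
have Sy2 j : S (fun t => (F t *m (w t).2)^T 0 j).
  under eq_fun do rewrite mxE; apply: (alg_mulmx hS) => // i l; by rewrite [l]ord1.
have SL1 u b := (SL u b).1; have SL2 u b := (SL u b).2.
apply: alg_from_frame => j; rewrite /iota0_V /to_frame /=.
  have -> : (fun t => (vmul ((w t).1 *m G t) (L t (kone R k, 0)).1 +
      vmul (F t *m (w t).2)^T (L t (0, kone R k)).1) 0 j) =
    (fun t => vmul ((w t).1 *m G t) (L t (kone R k, 0)).1 0 j +
      vmul (F t *m (w t).2)^T (L t (0, kone R k)).1 0 j).
    by apply/funext => t; rewrite [LHS]mxE.
  exact: (alg_add hS (alg_vmul Sy1 (SL1 _) j) (alg_vmul Sy2 (SL1 _) j)).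
have -> : (fun t => (vmul ((w t).1 *m G t) (L t (kone R k, 0)).2 +
    vmul (F t *m (w t).2)^T (L t (0, kone R k)).2) 0 j) =
  (fun t => vmul ((w t).1 *m G t) (L t (kone R k, 0)).2 0 j +
    vmul (F t *m (w t).2)^T (L t (0, kone R k)).2 0 j).
  by apply/funext => t; rewrite [LHS]mxE.
exact: (alg_add hS (alg_vmul Sy1 (SL2 _) j) (alg_vmul Sy2 (SL2 _) j)).
Qed.

End Smoothness.

End FrameAlgebra.

(** * Change of coordinates for the spin action *)

Section CasimirChange.
Variables (R : realType) (m : nat).
Local Notation W := (TTd R m).

Definition conj_op (A A' : 'M[R]_m) (y : W -> W) (w : W) : W :=
  let z := y (w.1 *m A, A' *m w.2) in (z.1 *m A', A *m z.2).

Lemma conj_op_linear A A' y : linear y -> linear (conj_op A A' y).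
Proof.
move=> ly a w z; rewrite /conj_op.
have -> : ((a *: w + z).1 *m A, A' *m (a *: w + z).2) =
    a *: (w.1 *m A, A' *m w.2) + (z.1 *m A, A' *m z.2) :> W.
  by congr pair => /=; rewrite ?mulmxDl ?mulmxDr -?scalemxAl -?scalemxAr.
by rewrite ly; congr pair => /=; rewrite ?mulmxDl ?mulmxDr -?scalemxAl -?scalemxAr.
Qed.

(** The formula for [cas] is a contraction of dual bases, hence independent of the basis by
    [trace_change]. *)
Lemma ext_map_cas A A' (y : W -> W) phi : linear y -> A *m A' = 1%:M -> A' *m A = 1%:M ->
  ext_map A (cas y phi) = cas (conj_op A A' y) (ext_map A phi).
Proof.
move=> ly AA' A'A; have ly' := conj_op_linear A A' ly.
set y' := conj_op A A' y in ly' *; set phi' := ext_map A phi.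
pose inX (X : 'rV[R]_m) : W := (X, 0); pose inxi (xi : 'cV[R]_m) : W := (0, xi).
have lX : linear inX by move=> a X X'; congr pair => /=; rewrite ?scaler0 ?addr0.
have lxi : linear inxi by move=> a X X'; congr pair => /=; rewrite ?scaler0 ?addr0.
pose F xi X := cl_prod (inX X) (cl_prod (y' (inxi xi)) phi') +
               cl_prod (inxi xi) (cl_prod (y' (inX X)) phi').
have clP (a : R) (w z : W) (psi : ext R m) :
    cl_prod (a *: w + z) psi = a *: cl_prod w psi + cl_prod z psi.
  exact: (cl_prodr_is_linear psi).
have Fl X : linear (F^~ X).
  move=> a xi eta; rewrite /F lxi ly' clP cl_prod_is_linear clP.
  by rewrite addrACA -scalerDr.
have Fr xi : linear (F xi).
  move=> a X X'; rewrite /F lX ly' !clP cl_prod_is_linear addrACA -scalerDr.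
  by [].
rewrite /cas linearZ; congr (_ *: _); rewrite linear_sum /=.
have -> : \sum_a (cl_prod (ev R a) (cl_prod (y' (ec R a)) phi') +
    cl_prod (ec R a) (cl_prod (y' (ev R a)) phi')) =
  \sum_a F (delta_mx a 0) (delta_mx 0 a) by [].
rewrite -(trace_change Fl Fr AA'); apply: eq_bigr => a _.
rewrite linearD /= !(ext_map_cl_prod _ _ A'A) /F /y' /conj_op /inX /inxi /ev /ec /=.
by rewrite !mul0mx !mulmx0 mulmxA A'A mul1mx -mulmxA A'A mulmx1.
Qed.

End CasimirChange.

(** * Frames of the reduction and smoothness of iota *)

Section FrameGeometry.
Variables (R : realType) (k n : nat) (hk : (k <= 2)%N) (hn : (0 < n)%N).
Local Notation m := (n * kdim k)%N.
Local Notation K := 'rV[R]_(kdim k).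
Variables (M : manifold R m) (g : metric M) (D : connection M).
Variable P : @reduction R k n M g D.
Implicit Types (p q : M) (i : mchart M) (F : 'M[R]_m).

Lemma frame_atP p : P p (frame_at P p).
Proof.
rewrite /frame_at; case: xgetP => [F _ //|nF].
have [U [s [oU Up _ /(_ _ Up)]]] := fr_local P p.
by move=> /nF.
Qed.

Lemma frameV p F : P p F -> F *m (g p *m F^T) = 1%:M.
Proof. by move=> /fr_orthonormal; rewrite /orthonormal_frame mulmxA. Qed.

Lemma invmx_frame p F : P p F -> invmx F = g p *m F^T.
Proof.
move=> /frameV FG; have [uF _] := mulmx1_unit FG.
by rewrite -[LHS]mulmx1 -FG mulKmx.
Qed.

Lemma frame_change p F F' : P p F -> P p F' -> exists phi t,
  [/\ @GK0 R k n phi, is_theta phi t, F' = phi *m F, phi *m phi^T = 1%:M &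
      kone R k *m t = kone R k].
Proof.
move=> PF /(fr_torsor _ PF)[phi Gphi FF'].
have [pp [t ht]] := connected_component_sub Gphi.
by exists phi, t; split=> //; exact: is_theta_one hn pp ht.
Qed.

Lemma invmx_change p F (phi : 'M[R]_m) :
  g p *m (phi *m F)^T = (g p *m F^T) *m phi^T.
Proof. by rewrite trmx_mul mulmxA. Qed.

(** Any frame of [P] computes the same operator, by equivariance of both the section and [iota];
    this replaces the arbitrary [frame_at P p] by a smooth local frame. *)
Lemma iota0E x p F w : Gamma0 P x -> P p F ->
  iota0 P x p w = frame_iota0 F (g p *m F^T) (x p F) w.
Proof.
move=> [_ _ eqx _] PF; have PF0 := frame_atP p.
have [phi [t [Gphi ht -> pp t1]]] := frame_change PF0 PF.
rewrite -[LHS]/(frame_iota0 (frame_at P p) (invmx (frame_at P p)) (x p (frame_at P p)) w).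
rewrite (invmx_frame PF0) invmx_change //.
apply: (frame_iota0_change _ _ _ pp t1 ht) => u.
exact: eqx PF0 Gphi ht u.
Qed.

Lemma iota1E u p F xi : Gamma1 P u -> P p F ->
  iota1 P u p xi = frame_iota1 F (g p *m F^T) (u p F) xi.
Proof.
move=> [_ equ _] PF; have PF0 := frame_atP p.
have [phi [t [Gphi ht -> pp t1]]] := frame_change PF0 PF.
rewrite -[LHS]/(frame_iota1 (frame_at P p) (invmx (frame_at P p)) (u p (frame_at P p)) xi).
rewrite (invmx_frame PF0) invmx_change (equ _ _ _ _ PF0 Gphi ht).
exact: frame_iota1_change pp ht.
Qed.

Definition frame_in i q F : 'M[R]_m := F *m tov q i.
Definition coframe_in i q F : 'M[R]_m := gram_in g i q *m (frame_in i q F)^T.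

Lemma coframe_inE i q F : dom i q -> coframe_in i q F = ofv q i *m (g q *m F^T).
Proof.
move=> qi; rewrite /coframe_in /frame_in /gram_in trmx_mul -!mulmxA.
have E : (ofv q i)^T *m (tov q i)^T = 1%:M by rewrite -trmx_mul tovK // trmx1.
by rewrite (mulmxA (ofv q i)^T (tov q i)^T) E mul1mx.
Qed.

Lemma conj_frame_iota0 i q F G L w :
  conj_op (ofv q i) (tov q i) (frame_iota0 F G L) w =
  frame_iota0 (F *m tov q i) (ofv q i *m G) L w.
Proof.
rewrite /conj_op /frame_iota0 /from_frame /to_frame /=.
by rewrite !mulmxA.
Qed.

Lemma hom_in_frame_iota1 u i q F G v xi :
  (forall xi, u q xi = frame_iota1 F G v xi) ->
  hom_in u i q xi = frame_iota1 (F *m tov q i) (ofv q i *m G) v xi.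
Proof.
move=> uE; rewrite /hom_in uE /frame_iota1 /from_frame /=.
by rewrite !mulmxA.
Qed.

Section LocalFrame.
Variables (i : mchart M) (U : set M) (s : M -> 'M[R]_m).
Hypothesis sU : local_frame P U s.

Lemma open_chart_frame : open (dom i `&` U).
Proof. by case: sU => oU _ _; apply: openI => //; exact: dom_open. Qed.

Lemma smooth_frame_in a b : smooth_fun (dom i `&` U) (fun q => frame_in i q (s q) a b).
Proof. by case: sU => _ sf _; exact: sf. Qed.

Lemma smooth_coframe_in a b : smooth_fun (dom i `&` U) (fun q => coframe_in i q (s q) a b).
Proof.
have hA := smooth_fun_fun_alg open_chart_frame.
apply: (alg_mulmx hA) => [c e|c e].
  by apply: smooth_fun_sub (gram_smooth g i c e) => q [].
by apply: (alg_tr (S := smooth_fun (dom i `&` U))) => x y; exact: smooth_frame_in.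
Qed.

End LocalFrame.

Lemma local_frame_exists p : exists U s, U p /\ local_frame P U s.
Proof.
have [U [s [oU Up sf Ps]]] := fr_local P p.
by exists U, s; split.
Qed.

Lemma smooth_hom_iota1 u : Gamma1 P u -> smooth_hom (iota1 P u).
Proof.
move=> Gu; split=> [p|i a b]; first exact: frame_iota1_linear.
have [_ _ su] := Gu.
suff loc p : dom i p -> exists V : set M, [/\ V p,
     smooth_fun V (fun q => (hom_in (iota1 P u) i q (ecov R a)).1 0 b) &
     smooth_fun V (fun q => (hom_in (iota1 P u) i q (ecov R a)).2 b 0)].
  by split; apply: smooth_fun_local => p /loc[V [Vp h1 h2]]; exists V.
move=> pi; have [U [s [Up sU]]] := local_frame_exists p.
have oV := open_chart_frame i sU; have hA := smooth_fun_fun_alg oV.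
exists (dom i `&` U); have [_ _ Ps] := sU.
have E q : (dom i `&` U) q -> frame_iota1 (frame_in i q (s q)) (coframe_in i q (s q))
    (u q (s q)) (ecov R a) = hom_in (iota1 P u) i q (ecov R a).
  move=> [qi qU]; rewrite coframe_inE //; apply/esym; apply: hom_in_frame_iota1 => xi.
  by apply: iota1E => //; exact: Ps.
have sk := su U s sU.
have [h1 h2] : smooth_fun (dom i `&` U) (fun q => (frame_iota1 (frame_in i q (s q))
      (coframe_in i q (s q)) (u q (s q)) (ecov R a)).1 0 b) /\
    smooth_fun (dom i `&` U) (fun q => (frame_iota1 (frame_in i q (s q))
      (coframe_in i q (s q)) (u q (s q)) (ecov R a)).2 b 0).
  apply: (alg_frame_iota1 hA).
  - by move=> *; exact: smooth_frame_in.
  - by move=> *; exact: smooth_coframe_in.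
  - by move=> c; apply: smooth_fun_sub (sk c).1 => q [].
  - by move=> c; apply: smooth_fun_sub (sk c).2 => q [].
  - by move=> c; exact: alg_cst.
by split=> //; [apply: smooth_fun_eq h1|apply: smooth_fun_eq h2] => // q Vq; rewrite E.
Qed.

Lemma smooth_iota0 x i w b : Gamma0 P x ->
  smooth_fun (dom i) (fun q => (conj_op (ofv q i) (tov q i) (iota0 P x q) w).1 0 b) /\
    smooth_fun (dom i) (fun q => (conj_op (ofv q i) (tov q i) (iota0 P x q) w).2 b 0).
Proof.
move=> Gx; have [_ _ _ sx] := Gx.
suff loc p : dom i p -> exists V : set M, [/\ V p,
     smooth_fun V (fun q => (conj_op (ofv q i) (tov q i) (iota0 P x q) w).1 0 b) &
     smooth_fun V (fun q => (conj_op (ofv q i) (tov q i) (iota0 P x q) w).2 b 0)].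
  by split; apply: smooth_fun_local => p /loc[V [Vp h1 h2]]; exists V.
move=> pi; have [U [s [Up sU]]] := local_frame_exists p.
have oV := open_chart_frame i sU; have hA := smooth_fun_fun_alg oV.
exists (dom i `&` U); have [_ _ Ps] := sU.
have E q : (dom i `&` U) q -> frame_iota0 (frame_in i q (s q)) (coframe_in i q (s q))
    (x q (s q)) w = conj_op (ofv q i) (tov q i) (iota0 P x q) w.
  move=> [qi qU]; rewrite coframe_inE // -conj_frame_iota0 /conj_op.
  by rewrite (iota0E _ Gx (Ps _ qU)).
have [h1 h2] : smooth_fun (dom i `&` U) (fun q => (frame_iota0 (frame_in i q (s q))
      (coframe_in i q (s q)) (x q (s q)) w).1 0 b) /\
    smooth_fun (dom i `&` U) (fun q => (frame_iota0 (frame_in i q (s q))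
      (coframe_in i q (s q)) (x q (s q)) w).2 b 0).
  apply: (alg_frame_iota0 hA).
  - by move=> *; exact: smooth_frame_in.
  - by move=> *; exact: smooth_coframe_in.
  - move=> u c; have sk := sx U s sU u c.
    by split; [apply: smooth_fun_sub sk.1|apply: smooth_fun_sub sk.2] => q [].
  - by move=> c; exact: alg_cst.
  - by move=> c; exact: alg_cst.
by split=> //; [apply: smooth_fun_eq h1|apply: smooth_fun_eq h2] => // q Vq; rewrite E.
Qed.

(* [F^T *m F] is the inverse of the Gram matrix for every orthonormal frame [F],
   so this is the metric on covectors in the coordinates of the chart [i]. *)
Definition conorm_in i q : 'M[R]_m :=
  (frame_in i q (frame_at P q))^T *m frame_in i q (frame_at P q).

Lemma smooth_conorm i a b : smooth_fun (dom i) (fun q => conorm_in i q a b).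
Proof.
apply: smooth_fun_local => p pi; have [U [s [Up sU]]] := local_frame_exists p.
have oV := open_chart_frame i sU; have hA := smooth_fun_fun_alg oV.
exists (dom i `&` U) => //; have [_ _ Ps] := sU.
apply: (smooth_fun_eq (f := fun q => ((frame_in i q (s q))^T *m frame_in i q (s q)) a b)) => //.
  move=> q [qi qU]; have [phi [t [_ _ sE pp _]]] := frame_change (frame_atP q) (Ps _ qU).
  rewrite /conorm_in /frame_in sE !trmx_mul -!mulmxA (mulmxA phi^T) (mulmx1C pp).
  by rewrite mul1mx.
apply: (alg_mulmx hA) => [c e|c e]; last exact: smooth_frame_in.
by apply: (alg_tr (S := smooth_fun (dom i `&` U))) => x y; exact: smooth_frame_in.
Qed.

Lemma frame_norm_in i q (eta : 'cV[R]_m) :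
  frame_norm (frame_at P q) (tov q i *m eta) = (eta^T *m conorm_in i q *m eta) 0 0.
Proof.
rewrite /frame_norm /dot /conorm_in /frame_in !trmxK !trmx_mul !mulmxA.
by [].
Qed.

Lemma frame_norm_sum p xi : frame_norm (frame_at P p) xi =
  \sum_a \sum_b xi a 0 * xi b 0 * conorm_in (chart_at p) p a b.
Proof.
rewrite -[xi in LHS]mul1mx -(tov_chart p) frame_norm_in mxE exchange_big /=.
apply: eq_bigr => b _; rewrite mxE mulr_suml; apply: eq_bigr => a _.
by rewrite mxE mulrAC.
Qed.

End FrameGeometry.

(** * The symbols of the operators Psi *)

Section SoCommutator.
Variables (R : realType) (m : nat).

Lemma so_commutator (x y : TTd R m -> TTd R m) : so_form (@Qform R m) x ->
  so_form (@Qform R m) y -> so_form (@Qform R m) (commutator x y).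
Proof.
move=> [lx sx] [ly sy]; split=> [a v w|v w].
  by rewrite /commutator lx ly lx ly scalerBr opprD addrACA.
have QB (v1 v2 w1 : TTd R m) : Qform (v1 - v2) w1 = Qform v1 w1 - Qform v2 w1.
  by rewrite -scaleN1r addrC Qform_sym QformP mulN1r addrC !(Qform_sym w1).
have E x' y' v1 w1 : so_form (@Qform R m) x' -> so_form (@Qform R m) y' ->
    Qform (x' (y' v1)) w1 = Qform v1 (y' (x' w1)).
  move=> [_ hx] [_ hy]; have /eqP := hx (y' v1) w1; rewrite addr_eq0 => /eqP->.
  by have /eqP := hy v1 (x' w1); rewrite addr_eq0 => /eqP->; rewrite opprK.
have QBr (v1 v2 w1 : TTd R m) : Qform w1 (v1 - v2) = Qform w1 v1 - Qform w1 v2.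
  by rewrite !(Qform_sym w1) QB.
have lxs : so_form (@Qform R m) x by []; have lys : so_form (@Qform R m) y by [].
by rewrite /commutator QB QBr (E x y v w lxs lys) (E y x v w lys lxs); ring.
Qed.

Lemma so_linear (a : R) (x y : TTd R m -> TTd R m) : so_form (@Qform R m) x ->
  so_form (@Qform R m) y -> so_form (@Qform R m) (fun w => a *: x w + y w).
Proof.
move=> [lx sx] [ly sy]; split=> [b v w|v w].
  by rewrite lx ly scalerDr addrACA scalerDr !scalerA mulrC.
rewrite QformP (Qform_sym (_ + _)) QformP !(Qform_sym w).
have /eqP := sx v w; rewrite addr_eq0 => /eqP ->.
have /eqP := sy v w; rewrite addr_eq0 => /eqP ->.
ring.
Qed.

Lemma cas_is_linear (x : TTd R m -> TTd R m) : linear (cas x).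
Proof.
move=> a f h; rewrite /cas scalerA mulrC -scalerA -scalerDr; congr (_ *: _).
rewrite scaler_sumr -big_split; apply: eq_bigr => b _ /=.
by rewrite !cl_prod_is_linear addrACA -scalerDr.
Qed.

Lemma cas_linear_op (a : R) (x y : TTd R m -> TTd R m) phi :
  cas (fun w => a *: x w + y w) phi = a *: cas x phi + cas y phi.
Proof.
have clP (w z : TTd R m) (psi : ext R m) :
    cl_prod (a *: w + z) psi = a *: cl_prod w psi + cl_prod z psi.
  exact: (cl_prodr_is_linear psi).
rewrite /cas scalerA mulrC -scalerA -scalerDr; congr (_ *: _).
rewrite scaler_sumr -big_split; apply: eq_bigr => b _ /=.
by rewrite !clP !cl_prod_is_linear addrACA -scalerDr.
Qed.

(** The commutator of [cas x] with Clifford multiplication by [w] is Clifford multiplication by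
    [x w], which determines [x w]. *)
Lemma cas_inj (Cl : clifford_algebra (@Qform R m)) (act : Cl -> ext R m -> ext R m)
    (x y : TTd R m -> TTd R m) : clifford_module (@cl_prod R m) act ->
  so_form (@Qform R m) x -> so_form (@Qform R m) y ->
  (forall phi, cas x phi = cas y phi) -> forall w, x w = y w.
Proof.
move=> hact sx sy xy w; apply: cl_prod_inj => phi.
by rewrite -(act_br hact _ _ sx) -(act_br hact _ _ sy) !xy.
Qed.

End SoCommutator.

(** * Coordinates on the cotangent bundle *)

Section SymbolSmoothness.
Variables (R : realType) (m : nat) (M : manifold R m).
Variable i : mchart M.

Definition cotangent_chart : set 'rV[R]_(m + m) := [set z | (crd i @` dom i) (lsubmx z)].

Lemma open_cotangent_chart : open cotangent_chart.
Proof.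
apply: (@open_comp _ _ (fun z : 'rV[R]_(m + m) => lsubmx z)); last exact: cod_open.
by move=> z _; apply: differentiable_continuous; exact: differentiable_lsubmx.
Qed.

Lemma smooth_base f : smooth_fun (dom i) f ->
  smooth_on cotangent_chart (fun z => f (par i (lsubmx z))).
Proof.
move=> /(_ i); rewrite setIid => sf.
apply: (smooth_comp open_cotangent_chart _ sf) => // b.
apply: (smooth_eq (f := fun z : 'rV[R]_(m + m) => z 0 (lshift m b))).
- exact: open_cotangent_chart.
- by move=> z _; rewrite mxE.
- exact: smooth_coord open_cotangent_chart.
Qed.

Lemma smooth_fiber (b : 'I_m) :
  smooth_on cotangent_chart (fun z => (rsubmx z)^T b 0).
Proof.
apply: (smooth_eq (f := fun z : 'rV[R]_(m + m) => z 0 (rshift m b))).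
- exact: open_cotangent_chart.
- by move=> z _; rewrite !mxE.
- exact: smooth_coord open_cotangent_chart.
Qed.

End SymbolSmoothness.

(** * A closed formula for the symbols *)

Section SymbolMap.
Variables (R : realType) (k n : nat) (hk : (k <= 2)%N) (hn : (0 < n)%N).
Local Notation m := (n * kdim k)%N.
Local Notation K := 'rV[R]_(kdim k).
Variables (M : manifold R m) (g : metric M) (D : connection M).
Variable P : @reduction R k n M g D.
Variables (Cl : clifford_algebra (@Qform R m)) (act : Cl -> ext R m -> ext R m).
Hypothesis hact : clifford_module (@cl_prod R m) act.
Implicit Types (p q : M) (i : mchart M) (a b : sec M).

(* In degree 2 the symbol of [triangle] is [- 2 Q (iota eps1 xi, iota eps2 xi)], that
   is [- |xi|^2], by the Clifford relation. *)
Definition sym a (r : nat) : symb_fun M := fun p xi w =>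
  match r with
  | 0 => cas (iota0 P a.1.1 p) w
  | 1 => cl_prod (iota1 P a.1.2 p xi) w
  | 2 => (a.2 p * frame_norm (frame_at P p) xi) *: w
  | _ => 0
  end.

Lemma frame_atV p : frame_at P p *m invmx (frame_at P p) = 1%:M.
Proof. by have PF := frame_atP P p; rewrite (invmx_frame PF) (frameV PF). Qed.

Lemma frame_atVl p : invmx (frame_at P p) *m frame_at P p = 1%:M.
Proof. exact: mulmx1C (frame_atV p). Qed.

Lemma iota0_so x p : Gamma0 P x -> so_form (@Qform R m) (iota0 P x p).
Proof.
move=> [sx _ _ _]; apply: (frame_iota0_so hk (frame_atV p) (frame_atVl p)).
exact: sx (frame_atP P p).
Qed.

Lemma iota1_linear u p : linear (iota1 P u p).
Proof. exact: frame_iota1_linear. Qed.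

Lemma eps_Gamma1 (u : K * K) :
  (forall t, kone R k *m t = kone R k -> Phi t u = u) -> Gamma1 P (const_sec1 P u).
Proof.
move=> ut; split.
- by move=> p F nP; rewrite /const_sec1 asboolF.
- move=> p F phi t PF Gphi ht; rewrite /const_sec1 !asboolT //; last first.
    by apply/(fr_torsor _ PF); exists phi.
  have [pp _] := connected_component_sub Gphi.
  by rewrite ut //; exact: is_theta_one hn pp ht.
- move=> U s [oU _ Ps] b; have hA := smooth_fun_fun_alg oU.
  split; [apply: (smooth_fun_eq (f := fun=> u.1 0 b))|
          apply: (smooth_fun_eq (f := fun=> u.2 0 b))] => //;
    try exact: (alg_cst hA); by move=> q qU; rewrite /const_sec1 asboolT //; exact: Ps.
Qed.

Lemma Gamma1_eps1 : Gamma1 P (eps1 P).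
Proof. by apply: eps_Gamma1 => t t1; rewrite /Phi /= t1 mul0mx. Qed.

Lemma Gamma1_eps2 : Gamma1 P (eps2 P).
Proof. by apply: eps_Gamma1 => t t1; rewrite /Phi /= t1 mul0mx. Qed.

Lemma Qform_eps p xi :
  Qform (iota1 P (eps1 P) p xi) (iota1 P (eps2 P) p xi) =
  2^-1 * frame_norm (frame_at P p) xi.
Proof.
rewrite (Qform_frame_iota1 hk _ _ _ (frame_atV p)) /eps1 /eps2 /const_sec1.
rewrite !asboolT; [|exact: frame_atP..].
rewrite /qcheck /= kconj1 kconj0 kmul1r kmul0r addr0 linearZ /=.
have -> : kre (kone R k) = 1 by elim: (k) => [|l IH] /=; rewrite ?row_mxKl // mxE eqxx.
by rewrite [_ *: _]mulr1 mulrC.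
Qed.

(** The hypothesis concerns each point separately, so the formula also applies to linear
    combinations and brackets, whose skewness is a pointwise matter. *)
Lemma sigmaE a : (forall p, so_form (@Qform R m) (iota0 P a.1.1 p)) ->
  sigma (Psi P act a) = sym a.
Proof.
move=> sa; apply/funext => r; apply/funext => p; apply/funext => xi; apply/funext => w.
case: r => [|[|[|r]]]; rewrite /sigma /=.
- rewrite -[LHS]/(symbol 0 (fun phi p => act (ad_inv Cl (iota0 P a.1.1 p)) (phi p)) p xi w).
  rewrite (symbol0E (fun p w => act (ad_inv Cl (iota0 P a.1.1 p)) w)).
  by rewrite (ad_invE hact) // (act_casg hact).
- by rewrite symbol1E //; exact: iota1_linear.
- apply: symbolE => h s sh ss dh sp; rewrite /triangle.
  have s1 := smooth_hom_iota1 hk hn Gamma1_eps1.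
  have s2 := smooth_hom_iota1 hk hn Gamma1_eps2.
  rewrite (D_op2_square D p s1.1 s2 sh ss) (D_op2_square D p s2.1 s1 sh ss).
  rewrite dh sp (cl_prod_anti hact) Qform_eps scalerA; congr (_ *: _).
  by field.
- by apply: symbolE => h s _ _ _ _.
Qed.

Lemma iota0_linear x p : linear (iota0 P x p).
Proof. exact: frame_iota0_linear. Qed.

Lemma form_in_rho x phi i q : Gamma0 P x -> dom i q ->
  form_in (rho act (iota0 P x) phi) i q =
  cas (conj_op (ofv q i) (tov q i) (iota0 P x q)) (form_in phi i q).
Proof.
move=> Gx qi; rewrite /form_in /rho (ad_invE hact); last exact: iota0_so.
rewrite (act_casg hact) (ext_map_cas _ (iota0_linear x q) (ofvK qi) (tovK qi)).
by [].
Qed.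

Lemma alg_cas (T : Type) (S : set (T -> R)) (hS : fun_alg S)
    (y : T -> TTd R m -> TTd R m) (f : T -> ext R m) :
  (forall w j, S (fun t => (y t w).1 0 j) /\ S (fun t => (y t w).2 j 0)) ->
  (forall J, S (fun t => f t J)) -> forall J, S (fun t => cas (y t) (f t) J).
Proof.
move=> Sy Sf; rewrite /cas; apply: (alg_scale hS); first exact: alg_cst.
apply: (alg_ext_sum hS) => b _ J.
have Sc w z : forall J, S (fun t => cl_prod w (cl_prod (y t z) (f t)) J).
  apply: (alg_cl_prod hS); [by move=> j; exact: (alg_cst hS)..|].
  by apply: (alg_cl_prod hS) => // j; [case: (Sy z j)|case: (Sy z j)].
have -> : (fun t => (cl_prod (ev R b) (cl_prod (y t (ec R b)) (f t)) +
    cl_prod (ec R b) (cl_prod (y t (ev R b)) (f t))) J) =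
  (fun t => cl_prod (ev R b) (cl_prod (y t (ec R b)) (f t)) J +
    cl_prod (ec R b) (cl_prod (y t (ev R b)) (f t)) J).
  by apply/funext => t; rewrite [LHS]ext_addE.
exact: (alg_add hS (Sc _ _ J) (Sc _ _ J)).
Qed.

Lemma diffop_rho x : Gamma0 P x -> diffop 0 (rho act (iota0 P x)).
Proof.
move=> Gx; have E phi p : rho act (iota0 P x) phi p = cas (iota0 P x p) (phi p).
  by rewrite /rho (ad_invE hact) ?(act_casg hact) //; exact: iota0_so.
apply/diffop0E; split; [split|].
- move=> phi sphi i J; have oi := dom_open i; have hA := smooth_fun_fun_alg oi.
  apply: (smooth_fun_eq (f := fun q =>
    cas (conj_op (ofv q i) (tov q i) (iota0 P x q)) (form_in phi i q) J)) => //.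
    by move=> q qi; rewrite form_in_rho.
  apply: (alg_cas hA) => [w j|]; last exact: sphi.
  exact: (smooth_iota0 hk hn i w j Gx).
- move=> c phi psi _ _; apply/funext => p.
  by rewrite !E cas_is_linear.
- move=> f _ phi _; apply/funext => p; rewrite /comm_op !E.
  by rewrite (linZ _ _ (cas_is_linear _)) subrr.
Qed.

Lemma diffop_triangle : diffop 2 (triangle P).
Proof.
have d1 := diffop_D_op D (smooth_hom_iota1 hk hn Gamma1_eps1).
have d2 := diffop_D_op D (smooth_hom_iota1 hk hn Gamma1_eps2).
exact: (diffop_add (diffop_comp d1 d2) (diffop_comp d2 d1)).
Qed.

Lemma diffop_Psi a r : sa_dom (s := Gamma_su P) a -> diffop r (Psi P act a r).
Proof.
move=> [G0 G1 G2]; case: r => [|[|[|r]]].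
- exact: diffop_rho.
- exact: (diffop_D_op D (smooth_hom_iota1 hk hn G1)).
- apply: (@diffop_scale _ _ _ 2 (fun p => - a.2 p)); last exact: diffop_triangle.
  exact: (alg_opp (smooth_fun_fun_alg openT) G2).
- exact: diffop_zero.
Qed.

Lemma sym_linear a r p xi : linear (sym a r p xi).
Proof.
case: r => [|[|[|r]]] c v w; rewrite /sym.
- exact: cas_is_linear.
- exact: cl_prod_is_linear.
- by rewrite scalerDr !scalerA mulrC.
- by rewrite scaler0 addr0.
Qed.

End SymbolMap.

Lemma fst_linear (R : realType) (U V : lmodType R) (c : R) (x y : U * V) :
  (c *: x + y).1 = c *: x.1 + y.1.
Proof. by []. Qed.

Lemma snd_linear (R : realType) (U V : lmodType R) (c : R) (x y : U * V) :
  (c *: x + y).2 = c *: x.2 + y.2.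
Proof. by []. Qed.

(** * Homomorphism property and injectivity *)

Section LieSuperalgebraMap.
Variables (R : realType) (k n : nat) (hk : (k <= 2)%N) (hn : (0 < n)%N).
Local Notation m := (n * kdim k)%N.
Local Notation K := 'rV[R]_(kdim k).
Variables (M : manifold R m) (g : metric M) (D : connection M).
Variable P : @reduction R k n M g D.
Variables (Cl : clifford_algebra (@Qform R m)) (act : Cl -> ext R m -> ext R m).
Hypothesis hact : clifford_module (@cl_prod R m) act.
Implicit Types (p q : M) (i : mchart M) (a b : sec M).

Lemma cotangent_chart_dom i z : cotangent_chart i z -> dom i (par i (lsubmx z)).
Proof. exact: dom_par. Qed.

Lemma hom_in_linear u i q : linear (u q) -> linear (hom_in u i q).
Proof.
move=> lu c xi eta; rewrite /hom_in mulmxDr -scalemxAr lu.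
by congr pair => /=; rewrite ?mulmxDl ?mulmxDr -?scalemxAl -?scalemxAr.
Qed.

Lemma smooth_symb_sym a r : Gamma0 P a.1.1 -> Gamma1 P a.1.2 -> Gamma2 (M := M) a.2 ->
  smooth_symb (sym P a r).
Proof.
move=> G0 G1 G2 i I J; have oZ := @open_cotangent_chart R m M i.
have hA := smooth_fun_alg oZ.
case: r => [|[|[|r]]].
- apply: (smooth_eq (f := fun z => let q := par i (lsubmx z) in
    cas (conj_op (ofv q i) (tov q i) (iota0 P a.1.1 q)) (ext_basis R J) I)) => //.
    move=> z /cotangent_chart_dom zi; rewrite /sym /=.
    rewrite (ext_map_cas _ (iota0_linear P _ _) (ofvK zi) (tovK zi)).
    by rewrite ext_mapM ofvK // ext_map1.
  apply: (alg_cas hA) => [w j|L]; last exact: alg_cst.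
  have [h1 h2] := smooth_iota0 hk hn i w j G0.
  by split; [exact: smooth_base h1|exact: smooth_base h2].
- have [lu su] := smooth_hom_iota1 hk hn G1.
  apply: (smooth_eq (f := fun z => let q := par i (lsubmx z) in
    cl_prod (\sum_c (rsubmx z)^T c 0 *: hom_in (iota1 P a.1.2) i q (ecov R c))
      (ext_basis R J) I)) => //.
    move=> z /cotangent_chart_dom zi; rewrite /sym /=.
    rewrite (ext_map_cl_prod _ _ (tovK zi)) ext_mapM ofvK // ext_map1.
    rewrite -(lin_sumZ _ _ _ (hom_in_linear i (lu _))).
    by rewrite -[\sum_c _]/(\sum_c (rsubmx z)^T c 0 *: delta_mx c 0) -cov_sum_delta.
  have Eh z (b : 'I_m) :
      (\sum_c (rsubmx z)^T c 0 *:
         hom_in (iota1 P a.1.2) i (par i (lsubmx z)) (ecov R c)).1 0 b =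
      \sum_c (rsubmx z)^T c 0 *
         (hom_in (iota1 P a.1.2) i (par i (lsubmx z)) (ecov R c)).1 0 b.
    by elim/big_rec2: _ => [|c x y _ <-]; rewrite /= mxE // mxE.
  have Eh2 z (b : 'I_m) :
      (\sum_c (rsubmx z)^T c 0 *:
         hom_in (iota1 P a.1.2) i (par i (lsubmx z)) (ecov R c)).2 b 0 =
      \sum_c (rsubmx z)^T c 0 *
         (hom_in (iota1 P a.1.2) i (par i (lsubmx z)) (ecov R c)).2 b 0.
    by elim/big_rec2: _ => [|c x y _ <-]; rewrite /= mxE // mxE.
  apply: (alg_cl_prod hA) => [b|b|L]; last exact: alg_cst.
    under eq_fun do rewrite Eh; apply: (alg_sum hA) => c _; apply: (alg_mul hA).
      exact: smooth_fiber.
    exact: smooth_base (su i c b).1.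
  under eq_fun do rewrite Eh2; apply: (alg_sum hA) => c _; apply: (alg_mul hA).
    exact: smooth_fiber.
  exact: smooth_base (su i c b).2.
- apply: (smooth_eq (f := fun z => let q := par i (lsubmx z) in
    (a.2 q * (rsubmx z *m conorm_in P i q *m (rsubmx z)^T) 0 0) * ext_basis R J I)) => //.
    move=> z /cotangent_chart_dom zi; rewrite /sym /= linearZ /= ext_scaleE.
    by rewrite frame_norm_in trmxK ext_mapM ofvK // ext_map1.
  apply: (alg_mul hA); last exact: alg_cst.
  apply: (alg_mul hA); first by apply: smooth_base; exact: smooth_fun_sub G2.
  apply: (alg_mulmx hA) => [c e|c e]; last by rewrite [e]ord1; exact: smooth_fiber.
  apply: (alg_mulmx hA) => [c' e'|c' e']; last exact: smooth_base (smooth_conorm hk hn P i c' e').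
  rewrite [c']ord1; have := @smooth_fiber R m M i e'.
  by apply: smooth_eq => // z _; rewrite mxE.
- apply: (smooth_eq (f := fun=> 0)) => //; last exact: (alg_cst hA).
  by move=> z _ /=; rewrite linear0 ffunE.
Qed.

Lemma sum_ffun1 (V : nmodType) (G : 'I_m -> V) :
  \sum_c G c = \sum_(t : {ffun 'I_1 -> 'I_m}) G (t ord0).
Proof.
rewrite [RHS](reindex (fun c : 'I_m => [ffun=> c])) /=.
  by apply: eq_bigr => c _; rewrite ffunE.
exists (fun t => t ord0) => [c _|t _]; first by rewrite ffunE.
by apply/ffunP => j; rewrite ffunE [j]ord1.
Qed.

Lemma sum_ffun2 (V : nmodType) (G : 'I_m -> 'I_m -> V) :
  \sum_c \sum_e G c e = \sum_(t : {ffun 'I_2 -> 'I_m}) G (t ord0) (t ord_max).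
Proof.
rewrite pair_bigA [RHS](reindex (fun ce : 'I_m * 'I_m =>
  [ffun l : 'I_2 => if l == ord0 then ce.1 else ce.2])) /=.
  by apply: eq_bigr => -[c e] _; rewrite !ffunE.
exists (fun t : {ffun 'I_2 -> 'I_m} => (t ord0, t ord_max)) => [[c e] _|t _].
  by rewrite !ffunE.
apply/ffunP => -[[|[|//]] lt2]; rewrite ffunE /=; congr (t _); exact: val_inj.
Qed.

Lemma is_symb_sym a r : Gamma0 P a.1.1 -> Gamma1 P a.1.2 -> Gamma2 (M := M) a.2 ->
  is_symb r (sym P a r).
Proof.
move=> G0 G1 G2; split; [by move=> p xi; exact: sym_linear| |exact: smooth_symb_sym].
move=> p; case: r => [|[|[|r]]].
- exists (fun _ w => cas (iota0 P a.1.1 p) w) => [t|xi w]; first exact: cas_is_linear.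
  (* In degree 0 the sum has a single term, the empty map, with empty product 1. *)
  have t0 : {ffun 'I_0 -> 'I_m} by apply: finfun => -[].
  rewrite (big_pred1 t0) => [|t]; first by rewrite big_ord0 scale1r.
  by apply/esym/eqP/ffunP => -[].
- exists (fun t w => cl_prod (iota1 P a.1.2 p (ecov R (t ord0))) w) => [t|xi w].
    exact: cl_prod_is_linear.
  rewrite /sym {1}(cov_sum_delta xi) (lin_sumZ _ _ _ (iota1_linear P _ p)).
  rewrite -/(cl_prodr _ _) (lin_sumZ _ _ _ (cl_prodr_is_linear w)) sum_ffun1.
  by apply: eq_bigr => t _; rewrite big_ord_recl big_ord0 mulr1.
- exists (fun t w => (a.2 p * conorm_in P (chart_at p) p (t ord0) (t ord_max)) *: w) => [t|xi w].
    by move=> c x y; rewrite scalerDr !scalerA mulrC.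
  rewrite /sym frame_norm_sum // mulr_sumr scaler_suml.
  under eq_bigr do rewrite mulr_sumr scaler_suml.
  rewrite sum_ffun2; apply: eq_bigr => t _; rewrite scalerA; congr (_ *: _).
  rewrite !big_ord_recl big_ord0 mulr1.
  have -> : lift ord0 ord0 = ord_max :> 'I_2 by exact: val_inj.
  by rewrite mulrCA.
- exists (fun _ _ => 0) => [t c x y|xi w]; first by rewrite scaler0 addr0.
  by rewrite big1 // => t _; rewrite scaler0.
Qed.

Lemma Symb_sym a : Gamma0 P a.1.1 -> Gamma1 P a.1.2 -> Gamma2 (M := M) a.2 ->
  Symb (sym P a).
Proof.
move=> G0 G1 G2; split=> [r|]; first exact: is_symb_sym.
by exists 3%N => -[|[|[|r]]].
Qed.

Lemma iota0P (c : R) x y p :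
  iota0 P (c *: x + y) p = fun w => c *: iota0 P x p w + iota0 P y p w.
Proof. by apply/funext => w; exact: frame_iota0P. Qed.

Lemma iota1P (c : R) u v p xi :
  iota1 P (c *: u + v) p xi = c *: iota1 P u p xi + iota1 P v p xi.
Proof. exact: frame_iota1P. Qed.

Lemma symP (c : R) a b : sym P (c *: a + b) = c *: sym P a + sym P b.
Proof.
apply/funext => r; apply/funext => p; apply/funext => xi; apply/funext => w.
rewrite -[RHS]/(c *: sym P a r p xi w + sym P b r p xi w).
case: r => [|[|[|r]]]; rewrite /sym.
- by rewrite !fst_linear iota0P cas_linear_op.
- rewrite fst_linear snd_linear iota1P; exact: (cl_prodr_is_linear w).
- rewrite snd_linear -[(_ + _) p]/(c * a.2 p + b.2 p).
  by rewrite mulrDl scalerDl -mulrA scalerA.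
- by rewrite scaler0 addr0.
Qed.

Lemma iota0_commutator x y p : Gamma0 P x -> Gamma0 P y ->
  iota0 P (fun p F => commutator (x p F) (y p F)) p =
  commutator (iota0 P x p) (iota0 P y p).
Proof.
move=> [sx _ _ _] [sy _ _ _]; apply/funext => w.
have PF := frame_atP P p.
by apply: (frame_iota0M hk); [exact: frame_atV|exact: sx|exact: sy].
Qed.

Lemma sym_scalar a r p xi : (2 <= r)%N -> exists c : R, forall w, sym P a r p xi w = c *: w.
Proof.
case: r => [|[|[|r]]] // _.
  by exists (a.2 p * frame_norm (frame_at P p) xi).
by exists 0 => w; rewrite scale0r.
Qed.

Lemma sym_bracket a b : sa_dom (s := Gamma_su P) a -> sa_dom (s := Gamma_su P) b ->
  sym P (sa_bracket (s := Gamma_su P) a b) = symb_bracket (sym P a) (sym P b).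
Proof.
case: a => [[x u] f]; case: b => [[y v] h] [/= Gx Gu Gf] [/= Gy Gv Gh].
set a : sec M := (x, u, f); set b : sec M := (y, v, h).
have [sx _ _ _] := Gx; have [sy _ _ _] := Gy.
apply/funext => r; apply/funext => p; apply/funext => xi; apply/funext => w.
have PF := frame_atP P p; have FV := frame_atV P p.
have sbE : symb_bracket (sym P a) (sym P b) r p xi w = \sum_(j < r.+1)
    (sym P a j p xi (sym P b (r - j) p xi w) -
     (-1) ^+ (j * (r - j)) *: sym P b (r - j) p xi (sym P a j p xi w)) by [].
(* A term vanishes if a factor is scalar and the sign is +1, or if a factor has degree at least 3
   and so is 0. *)
have scl j l : (2 <= j)%N || (2 <= l)%N -> ~~ odd (j * l) || (3 <= j)%N || (3 <= l)%N ->
    sym P a j p xi (sym P b l p xi w) - (-1) ^+ (j * l) *: sym P b l p xi (sym P a j p xi w) = 0.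
  have lin s j0 := sym_linear P s j0 p xi.
  have zero s j0 : (3 <= j0)%N -> forall w, sym P s j0 p xi w = 0 by case: j0 => [|[|[|j0]]].
  case: (leqP 3 j) => [j3 _ _|j3].
    by rewrite !(zero a j j3) (lin0 (lin b l)) scaler0 subr0.
  case: (leqP 3 l) => [l3 _ _|l3].
    by rewrite !(zero b l l3) (lin0 (lin a j)) scaler0 subr0.
  rewrite !orbF -signr_odd => jl /negbTE ->; rewrite expr0 scale1r.
  case/orP: jl => /(sym_scalar _ p xi) sc.
    by have [c cE] := sc a; rewrite !cE (linZ _ _ (lin _ _)) subrr.
  by have [c cE] := sc b; rewrite !cE (linZ _ _ (lin _ _)) subrr.
rewrite sbE; case: r {sbE} => [|[|[|r]]].
- rewrite big_ord1 expr0 scale1r {1}/sym /= iota0_commutator //.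
  by rewrite (cas_commutator hact) //; exact: (iota0_so hk).
- rewrite big_ord_recl big_ord1 /= mul0n mul1n expr0 !scale1r.
  (* Both terms in degree 1, for (0,1) and (1,0), are such commutators, the second with the opposite
     sign. *)
  have brs (z : sec0 M) e : Gamma0 P z ->
      cas (iota0 P z p) (cl_prod (iota1 P e p xi) w) -
        cl_prod (iota1 P e p xi) (cas (iota0 P z p) w) =
      cl_prod (frame_iota1 (frame_at P p) (invmx (frame_at P p))
        (z p (frame_at P p) (e p (frame_at P p))) xi) w.
    move=> Gz; rewrite (act_br hact); last exact: (iota0_so hk).
    congr (cl_prod _ w); have [sz _ _ _] := Gz.
    by apply: (frame_iota0_iota1 hk) => //; exact: sz.
  rewrite /sym /= (brs x v Gx) -[X in _ = _ + X]opprB (brs y u Gy).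
  rewrite -[iota1 P _ p xi]/(frame_iota1 (frame_at P p) (invmx (frame_at P p))
    (x p (frame_at P p) (v p (frame_at P p)) - y p (frame_at P p) (u p (frame_at P p))) xi).
  rewrite frame_iota1B -scaleN1r addrC -[cl_prod _ w]/(cl_prodr w _).
  by rewrite cl_prodr_is_linear scaleN1r addrC.
(* The pairs (0,2) and (2,0) cancel; for (1,1) the supercommutator is an anticommutator, evaluated
   by the Clifford relation. *)
- rewrite big_ord_recl big_ord_recl big_ord1.
  rewrite scl // add0r [X in _ = _ + X]scl // addr0 /= muln1 expr1 scaleN1r opprK.
  rewrite (cl_prod_anti hact) (Qform_frame_iota1 hk _ _ _ FV) /sym /=.
  by congr (_ *: _); ring.
(* In total degree at least 3 every pair has a factor of degree at least 2. *)
- rewrite big1 // => -[j /= _] _; apply: scl.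
    by case: j => [|[|j]].
  case: j => [|[|[|j]]].
  - by rewrite mul0n.
  - by case: r => [|r] //; rewrite orbT.
  - by rewrite oddM.
  - by rewrite orbT.
Qed.

Lemma Phi_inj t : SO_K t -> injective (@Phi R k t).
Proof.
move=> [tt _] [u1 u2] [v1 v2] [/(congr1 (mulmx^~ t^T)) + /(congr1 (mulmx^~ t^T))].
by rewrite -!mulmxA tt !mulmx1 => -> ->.
Qed.

(** The structure group is transitive on the frames of [P] at a point, so equivariance propagates
    equality from one frame to all. *)
Lemma Gamma0_eq x y : Gamma0 P x -> Gamma0 P y ->
  (forall p, x p (frame_at P p) = y p (frame_at P p)) -> x = y.
Proof.
move=> [_ x0 eqx _] [_ y0 eqy _] xy; apply/funext => p; apply/funext => F.
have [PF|nPF] := pselect (P p F); last by rewrite x0 // y0.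
have PF0 := frame_atP P p.
have [phi [t [Gphi ht -> _ _]]] := frame_change hk hn PF0 PF.
apply/funext => u; apply: (Phi_inj ht.1).
by rewrite -(eqx _ _ _ _ PF0 Gphi ht) -(eqy _ _ _ _ PF0 Gphi ht) xy.
Qed.

Lemma Gamma1_eq u v : Gamma1 P u -> Gamma1 P v ->
  (forall p, u p (frame_at P p) = v p (frame_at P p)) -> u = v.
Proof.
move=> [u0 equ _] [v0 eqv _] uv; apply/funext => p; apply/funext => F.
have [PF|nPF] := pselect (P p F); last by rewrite u0 // v0.
have PF0 := frame_atP P p.
have [phi [t [Gphi ht -> _ _]]] := frame_change hk hn PF0 PF.
apply: (Phi_inj ht.1).
by rewrite -(equ _ _ _ _ PF0 Gphi ht) -(eqv _ _ _ _ PF0 Gphi ht) uv.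
Qed.

Lemma frame_norm_neq0 p : exists xi, frame_norm (frame_at P p) xi != 0.
Proof.
have kd : (0 < kdim k)%N by elim: (k) => //= l IH; rewrite addn_gt0 IH.
have nk : (0 < m)%N by rewrite muln_gt0 hn.
pose y : 'cV[R]_m := delta_mx (Ordinal nk) 0.
exists (invmx (frame_at P p) *m y); rewrite /frame_norm mulmxA frame_atV mul1mx dot_eq0.
apply/eqP => /rowP/(_ (Ordinal nk)); rewrite !mxE !eqxx => /eqP.
by rewrite oner_eq0.
Qed.

Lemma sym_inj a b : sa_dom (s := Gamma_su P) a -> sa_dom (s := Gamma_su P) b ->
  sym P a = sym P b -> a = b.
Proof.
case: a => [[x u] f]; case: b => [[y v] h] [/= Gx Gu Gf] [/= Gy Gv Gh] E.
have Er r p xi w : sym P (x, u, f) r p xi w = sym P (y, v, h) r p xi w by rewrite E.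
have [sx _ _ _] := Gx; have [sy _ _ _] := Gy.
congr (_, _, _).
- apply: Gamma0_eq => // p; have PF := frame_atP P p.
  apply: (frame_iota0_inj hk hn (frame_atV P p) (sx _ _ PF) (sy _ _ PF)).
  apply: (cas_inj hact (iota0_so hk p Gx) (iota0_so hk p Gy)) => w.
  (* The symbol of degree 0 is constant in the covector, so the value 0 is an arbitrary choice. *)
  exact: Er 0%N p 0 w.
- apply: Gamma1_eq => // p; apply: (frame_iota1_inj hk hn (frame_atV P p)) => xi.
  by apply: cl_prod_inj => w; exact: Er 1%N p xi w.
- apply/funext => p; have [xi nxi] := frame_norm_neq0 p.
  (* Evaluation at the form 1, at its coefficient for the empty set, turns an identity of scalar
     operators into one of numbers. *)
  have := Er 2 p xi (ext_one R m); rewrite /sym /= => /ffunP/(_ finset.set0).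
  rewrite !ext_scaleE ffunE eqxx !mulr1 => /eqP; rewrite -subr_eq0 -mulrBl mulf_eq0.
  by rewrite (negbTE nxi) orbF subr_eq0 => /eqP.
Qed.

Lemma sym_part a e : sa_part (s := Gamma_su P) e a ->
  sa_part (s := Symb_su M) e (sym P a).
Proof.
have u0 p xi : iota1 P 0 p xi = 0.
  by have := iota1P (-1) 0 0 p xi; rewrite scaler0 addr0 scaleN1r addNr.
have x0 p w : cas (iota0 P 0 p) w = 0.
  have := iota0P (-1) 0 0 p; rewrite scaler0 addr0 => ->.
  by rewrite cas_linear_op scaleN1r addNr.
case: e => /= h r er; apply/funext => p; apply/funext => xi; apply/funext => w;
  case: r er => [|[|[|r]]] //= _; rewrite /sym.
- by rewrite h.1 x0.
- by rewrite h.2 mul0r scale0r.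
- by rewrite h u0; exact: (linear0 (cl_prodr w)).
Qed.

Lemma sigma_sym a : sa_dom (s := Gamma_su P) a -> sigma (Psi P act a) = sym P a.
Proof. by move=> [G0 _ _]; apply: (sigmaE hk hn hact) => p; exact: (iota0_so hk). Qed.

Lemma sigma_Psi_mono :
  superalgebra_mono (A := Gamma_su P) (B := Symb_su M) (fun a => sigma (Psi P act a)).
Proof.
split.
- by move=> a ha; rewrite (sigma_sym ha); case: ha => *; exact: Symb_sym.
- move=> c a b ha hb; rewrite (sigma_sym ha) (sigma_sym hb) -[RHS](symP c a b).
  apply: (sigmaE hk hn hact) => p; have [Ga _ _] := ha; have [Gb _ _] := hb.
  rewrite !fst_linear iota0P.
  by apply: so_linear; exact: (iota0_so hk).
- by move=> e a ha; rewrite (sigma_sym ha); exact: sym_part.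
- move=> a b ha hb; rewrite (sigma_sym ha) (sigma_sym hb) -[RHS](sym_bracket ha hb).
  apply: (sigmaE hk hn hact) => p; have [Ga _ _] := ha; have [Gb _ _] := hb.
  rewrite (_ : (sa_bracket (s := Gamma_su P) a b).1.1 =
    fun p F => commutator (a.1.1 p F) (b.1.1 p F)); last first.
    by case: (a) => [[x u] f]; case: (b) => [[y v] h].
  by rewrite iota0_commutator //; apply: so_commutator; exact: (iota0_so hk).
- by move=> a b ha hb; rewrite (sigma_sym ha) (sigma_sym hb); exact: sym_inj.
Qed.

End LieSuperalgebraMap.

Theorem theorem3p14 (R : realType) (k n : nat) (hk : (k <= 2)%N) (hn : (0 < n)%N)
    (M : manifold R (n * kdim k)) (g : metric M) (o : orientation M)
    (D : connection M) (hD : levi_civita g D) (hK : K_manifold g D)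
    (P : reduction g D)
    (Cl : clifford_algebra (@Qform R (n * kdim k)))
    (act : Cl -> ext R (n * kdim k) -> ext R (n * kdim k))
    (hact : clifford_module (@cl_prod R (n * kdim k)) act) :
  (forall a, sa_dom (s := Gamma_su P) a -> forall r, diffop r (Psi P act a r)) /\
  superalgebra_mono (A := Gamma_su P) (B := Symb_su M)
    (fun a => sigma (Psi P act a)).
Proof.
split; last exact: sigma_Psi_mono.
by move=> a ha r; exact: diffop_Psi.
Qed.
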